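(* Let $1 \le m < n$ and let $\theta \in \mathcal{SA}(\mathbb{D}^n)$ with $\theta(0) \neq 0$. Then \[ \theta(\boldsymbol{z}) = \phi(z_1,\ldots,z_m)\, \psi(z_{m+1},\ldots,z_n) \qquad (\boldsymbol{z} = (z_1,\ldots,z_n) \in \mathbb{D}^n) \] for some $\phi \in \mathcal{SA}(\mathbb{D}^m)$ and $\psi \in \mathcal{SA}(\mathbb{D}^{n-m})$ if and only if \[ \theta(\boldsymbol{z}) = \tau_V(\boldsymbol{z}) \qquad (\boldsymbol{z} \in \mathbb{D}^n) \] for some isometric colligation $V$ satisfying property $\mathcal{F}_m(n)$.
   Context: All Hilbert spaces are complex; $\mathcal{B}(\mathcal{H},\mathcal{K})$ denotes the bounded linear operators from $\mathcal{H}$ to $\mathcal{K}$, and $\mathcal{B}(\mathcal{H}) = \mathcal{B}(\mathcal{H},\mathcal{H})$. $\mathbb{D}^k$ is the open unit polydisc in $\mathbb{C}^k$. Schur-Agler class: $\mathcal{SA}(\mathbb{D}^k)$ is the set of analytic functions $\varphi : \mathbb{D}^k \to \mathbb{C}$ such that $\|\varphi(T_1,\ldots,T_k)\|_{\mathcal{B}(\mathcal{H})} \le 1$ for every Hilbert space $\mathcal{H}$ and every $k$-tuple $(T_1,\ldots,T_k)$ of commuting strict contractions on $\mathcal{H}$. Transfer function: given Hilbert spaces $\mathcal{H}_1,\ldots,\mathcal{H}_n$, an isometric colligation is an isometry $V = \begin{bmatrix} a & B \\ C & D\end{bmatrix} \in \mathcal{B}(\mathbb{C} \oplus \mathcal{H}_1^n)$,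 where $\mathcal{H}_1^n = \bigoplus_{i=1}^n \mathcal{H}_i$ (so $a \in \mathbb{C}$, $B \in \mathcal{B}(\mathcal{H}_1^n,\mathbb{C})$, $C \in \mathcal{B}(\mathbb{C},\mathcal{H}_1^n)$, $D \in \mathcal{B}(\mathcal{H}_1^n)$). Its transfer function is \[ \tau_V(\boldsymbol{z}) = a + B\,(I_{\mathcal{H}_1^n} - E(\boldsymbol{z})D)^{-1}E(\boldsymbol{z})\,C, \qquad E(\boldsymbol{z}) = \bigoplus_{i=1}^n z_i I_{\mathcal{H}_i} \qquad (\boldsymbol{z} \in \mathbb{D}^n). \] Property $\mathcal{F}_m(n)$ ($1 \le m < n$): an isometry $V \in \mathcal{B}(\mathcal{H})$ satisfies property $\mathcal{F}_m(n)$ if there exist Hilbert spaces $\mathcal{H}_1,\ldots,\mathcal{H}_n$ such that $\mathcal{H} = \mathbb{C} \oplus \mathcal{H}_1^n$ and, writing $\mathcal{H}_1^m = \bigoplus_{i=1}^m \mathcal{H}_i$, $\mathcal{H}_{m+1}^n = \bigoplus_{i=m+1}^n \mathcal{H}_i$ and \[ V = \begin{bmatrix} a & B_1 & B_2 \\ C_1 & D_{11} & D_{12} \\ C_2 & D_{21} & D_{22}\end{bmatrix} \in \mathcal{B}(\mathbb{C} \oplus \mathcal{H}_1^m \oplus \mathcal{H}_{m+1}^n), \] one has $D_{21} = 0$ and $a D_{12} = C_1 B_2$. The transfer function $\tau_V$ of such a $V$ is taken with respect to this decomposition $\mathbb{C} \oplus (\mathcal{H}_1 \oplus \cdots \oplus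 \mathcal{H}_n)$. *)

(* Defs.v *)
From HB Require Import structures.
From mathcomp Require Import all_boot all_order all_algebra finmap ring.
From mathcomp Require Import sesquilinear complex.
From mathcomp Require Import boolp classical_sets functions reals.
From mathcomp Require Import topology normedtype derive.
From mathcomp.analysis.showcase Require Import summability.

Set Implicit Arguments.
Unset Strict Implicit.
Unset Printing Implicit Defensive.

Import Order.TTheory GRing.Theory Num.Theory Num.Def.
Import numFieldNormedType.Exports.

Local Open Scope classical_set_scope.
Local Open Scope ring_scope.

Section dot_norm.
Variables (C : numClosedFieldType) (U : lmodType C) (f : {dot U for conjC}).

Lemma dot_CauchySchwarz u v : `|f u v| ^+ 2 <= f u u * f v v.
Proof.
have [->|v0] := eqVneq v 0.
  by rewrite !linear0r normr0 expr0n.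
have vgt0 : 0 < f v v by rewrite dnorm_gt0.
have := dnorm_ge0 f (f v v *: u - f u v *: v).
rewrite dnormB/= (dnormZ f (f v v) u) (dnormZ f (f u v) v).
have -> : f (f v v *: u) (f u v *: v) = f v v * `|f u v| ^+ 2.
  rewrite (linearZr_LR f) (linearZl_LR f)/=.
  by rewrite mulrCA -normCKC.
rewrite (ger0_norm (dnorm_ge0 f v)) (@geC0_conj _ (_ * _)); last first.
  by rewrite mulr_ge0// ?exprn_ge0// ltW.
set a := f v v; set b := `|f u v|; set c := f u u.
rewrite (_ : _ - _ = a * (c * a - b ^+ 2)); last by rewrite /a /b /c; ring.
by rewrite pmulr_rge0// subr_ge0.
Qed.

Definition dot_norm u : C := sqrtC (f u u).

Lemma dot_normD u v : dot_norm (u + v) <= dot_norm u + dot_norm v.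
Proof.
have n0 w : 0 <= dot_norm w by exact: sqrt_dnorm_ge0.
rewrite -(@ler_pXn2r _ 2)// ?nnegrE ?addr_ge0//.
rewrite sqrrD !sqrtCK dnormD/= [leRHS]addrAC lerD2l.
have dreal : f u v + (f u v)^* \is Num.real.
  by apply/CrealP; rewrite rmorphD/= conjCK addrC.
apply: (le_trans (real_ler_norm dreal)); apply: (le_trans (ler_normD _ _)).
rewrite norm_conjC -mulr2n lerMn2r/= -(@ler_pXn2r _ 2)// ?nnegrE ?mulr_ge0//.
by rewrite exprMn !sqrtCK dot_CauchySchwarz.
Qed.

Lemma dot_normZ a u : dot_norm (a *: u) = `|a| * dot_norm u.
Proof.
by rewrite /dot_norm dnormZ rootCMl ?exprn_ge0// sqrCK.
Qed.

Lemma dot_norm0_eq0 u : dot_norm u = 0 -> u = 0.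
Proof. by move/eqP; rewrite sqrt_dnorm_eq0 => /eqP. Qed.

Lemma sqr_dot_norm u : dot_norm u ^+ 2 = f u u.
Proof. exact: sqrtCK. Qed.

End dot_norm.

(* Makes R[i] a normed module over itself. *)
HB.instance Definition _ (R : realType) := NormedModule.copy R[i] (R[i])^o.

Section complex_complete.
Variable R : realType.
Local Open Scope complex_scope.

Lemma normci : `|'i| = 1 :> R[i].
Proof. by rewrite normc_def/= expr0n/= expr1n add0r sqrtr1. Qed.

Lemma complex_cauchy_cvg (F : set_system R[i]) :
  ProperFilter F -> cauchy F -> cvg F.
Proof.
move=> FF /cauchy_ballP Fc.
have coord (p : {linear Rcomplex R -> R}) :
    (forall z : R[i], `|p z|%:C <= `|z|) -> cvg (p @ F).
  move=> pz; apply: cauchy_cvg; apply/cauchy_ballP => e e0.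
  have [/= [A B] [FA FB] AB] := Fc e%:C (ltac:(by rewrite ltcR)).
  exists (p @` A, p @` B).
    by split; [apply: filterS FA => x; exists x|apply: filterS FB => x; exists x].
  move=> /= [_ _] [/= [x Ax <-] [y By <-]].
  have := AB (x, y) (conj Ax By).
  rewrite -!ball_normE/= => xy.
  by rewrite -raddfB -ltcR; apply: le_lt_trans xy; exact: pz.
have /cvg_ex[/= a Fa] : cvg (@complex.Re R @ F).
  by apply: (coord (@complex.Re R : Rcomplex R -> R)) => z; rewrite normc_ge_Re.
have /cvg_ex[/= b Fb] : cvg (@complex.Im R @ F).
  apply: (coord (@complex.Im R : Rcomplex R -> R)) => z.
  by rewrite -normrN -ReiNIm (le_trans (normc_ge_Re _))// normrM normci mulr1.
apply: (@cvgP _ _ (a +i* b)); apply/cvgrPdist_lt => -[e e'].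
rewrite ltcE/= => /andP[/eqP-> e0].
have e20 : 0 < e / 2 by rewrite divr_gt0.
have /cvgrPdist_lt/(_ _ e20) Fa' := Fa.
have /cvgrPdist_lt/(_ _ e20) Fb' := Fb.
have zE (z : R[i]) :
    a +i* b - z = (a - complex.Re z)%:C + 'i * (b - complex.Im z)%:C.
  by case: z => x y; simpc.
near=> z; rewrite zE (le_lt_trans (ler_normD _ _))// normrM normci mul1r.
rewrite !normc_def/= !expr0n/= !addr0 !sqrtr_sqr.
rewrite complexr0 [e]splitr rmorphD/= ltrD// ltcR; near: z.
- exact: Fa'.
- exact: Fb'.
Unshelve. all: by end_near. Qed.

End complex_complete.

HB.instance Definition _ (R : realType) :=
  Uniform_isComplete.Build R[i] (@complex_cauchy_cvg R).

HB.mixin Record NormedModule_isHilbert (R : realType) V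
    & CompleteNormedModule R[i] V := {
  inner : {dot V for conjC} ;
  sqr_normE : forall x : V, `|x| ^+ 2 = inner x x
}.

#[short(type="hilbertType")]
HB.structure Definition Hilbert (R : realType) :=
  {V of CompleteNormedModule R[i] V & NormedModule_isHilbert R V}.

Section complex_hilbert.
Variable R : realType.

Definition complex_inner (x y : R[i]) : R[i] := x * y^*.

Fact complex_inner_bilinear : bilinear_for
  (GRing.Scale.Law.clone _ _ ( *%R ) _)
  (GRing.Scale.Law.clone _ _ (conjC \; *%R ) _) complex_inner.
Proof.
split=> [u'|u] a x y; rewrite /complex_inner /=; first by rewrite mulrDl mulrA.
by rewrite rmorphD rmorphM/= mulrDr mulrCA.
Qed.

HB.instance Definition _ := bilinear_isBilinear.Build R[i] R[i] R[i] R[i]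
  ( *%R ) (conjC \; *%R ) complex_inner complex_inner_bilinear.

Fact complex_inner_hermitian x y :
  complex_inner x y = (-1) ^+ false * (complex_inner y x)^*.
Proof. by rewrite expr0 mul1r /complex_inner rmorphM/= conjCK mulrC. Qed.

HB.instance Definition _ := isHermitianSesquilinear.Build R[i] R[i] false conjC
  complex_inner complex_inner_hermitian.

Fact complex_inner_gt0 x : x != 0 -> 0 < complex_inner x x.
Proof. by move=> x0; rewrite /complex_inner -normCK exprn_gt0// normr_gt0. Qed.

HB.instance Definition _ := isDotProduct.Build R[i] R[i] complex_inner
  complex_inner_gt0.

HB.instance Definition _ := @NormedModule_isHilbert.Build R R[i] complex_inner
  (fun x => normCK x).

End complex_hilbert.
Lemma linear_contraction_cvg (K : numFieldType) (V : normedModType K)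
    (W : completeNormedModType K) (p : {linear V -> W}) (F : set_system V) :
  (forall z, `|p z| <= `|z|) -> ProperFilter F -> cauchy F -> cvg (p @ F).
Proof.
move=> pz FF /cauchy_ballP Fc; apply: cauchy_cvg; apply/cauchy_ballP => e e0.
have [/= [A B] [FA FB] AB] := Fc e e0.
exists (p @` A, p @` B).
  by split; [apply: filterS FA => x; exists x|apply: filterS FB => x; exists x].
move=> /= [_ _] [/= [x Ax <-] [y By <-]].
have := AB (x, y) (conj Ax By).
rewrite -!ball_normE/= => xy.
by rewrite -raddfB; apply: le_lt_trans xy; exact: pz.
Qed.


(* Hilbert space direct sum of two Hilbert spaces; the product type [K * L]
   itself carries the sup norm in the library, hence the alias. *)
Definition hpair (R : realType) (K L : hilbertType R) : Type := (K * L)%type.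

Section hpair.
Variables (R : realType) (K L : hilbertType R).

HB.instance Definition _ := GRing.Lmodule.copy (hpair K L) (K * L)%type.

Definition hpair_inner (x y : hpair K L) : R[i] :=
  inner x.1 y.1 + inner x.2 y.2.

Fact hpair_inner_bilinear : bilinear_for
  (GRing.Scale.Law.clone _ _ ( *%R ) _)
  (GRing.Scale.Law.clone _ _ (conjC \; *%R ) _) hpair_inner.
Proof.
split=> [u'|u] a x y; rewrite /hpair_inner /=.
  by rewrite !linearPl/= mulrDr addrACA.
by rewrite !linearPr/= mulrDr addrACA.
Qed.

HB.instance Definition _ := bilinear_isBilinear.Build R[i]
  (hpair K L) (hpair K L) R[i]
  ( *%R ) (conjC \; *%R ) hpair_inner hpair_inner_bilinear.

Fact hpair_inner_hermitian x y :
  hpair_inner x y = (-1) ^+ false * (hpair_inner y x)^*.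
Proof.
rewrite /hpair_inner mul1r rmorphD/=; congr (_ + _).
- by rewrite (hermC inner) mul1r.
- by rewrite (hermC inner) mul1r.
Qed.

HB.instance Definition _ := isHermitianSesquilinear.Build R[i] (hpair K L)
  false conjC hpair_inner hpair_inner_hermitian.

Fact hpair_inner_gt0 x : x != 0 -> 0 < hpair_inner x x.
Proof.
rewrite lt_def /hpair_inner addr_ge0 ?dnorm_ge0// andbT.
apply: contra; rewrite paddr_eq0 ?dnorm_ge0// !dnorm_eq0.
by case: x => x y /andP[/= /eqP-> /eqP->].
Qed.

HB.instance Definition _ := isDotProduct.Build R[i] (hpair K L) hpair_inner
  hpair_inner_gt0.

HB.instance Definition _ := @Lmodule_isNormed.Build R[i] (hpair K L)
  (dot_norm hpair_inner) (dot_normD hpair_inner)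
  (dot_normZ hpair_inner) (@dot_norm0_eq0 _ _ hpair_inner).

Lemma hpair_norm_ge (x : hpair K L) : `|x.1| <= `|x| /\ `|x.2| <= `|x|.
Proof.
have e : `|x| ^+ 2 = `|x.1| ^+ 2 + `|x.2| ^+ 2.
  by rewrite (sqr_dot_norm hpair_inner) !sqr_normE.
by split; rewrite -(@ler_pXn2r _ 2)// ?nnegrE// e ?lerDl ?lerDr exprn_ge0.
Qed.

Lemma hpair_norm_le (x : hpair K L) : `|x| <= `|x.1| + `|x.2|.
Proof.
rewrite -(@ler_pXn2r _ 2)// ?nnegrE ?addr_ge0//.
rewrite (sqr_dot_norm hpair_inner) /= /hpair_inner -!sqr_normE sqrrD.
by rewrite addrAC lerDl mulrn_wge0// mulr_ge0.
Qed.

Lemma hpair_cauchy_cvg (F : set_system (hpair K L)) :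
  ProperFilter F -> cauchy F -> cvg F.
Proof.
move=> FF Fc.
have /cvg_ex[/= a Fa] : cvg ((fst : hpair K L -> K) @ F).
  by apply: (@linear_contraction_cvg _ (hpair K L) K (fst : K * L -> K) F _ _ Fc) => z; have [] := hpair_norm_ge z.
have /cvg_ex[/= b Fb] : cvg ((snd : hpair K L -> L) @ F).
  by apply: (@linear_contraction_cvg _ (hpair K L) L (snd : K * L -> L) F _ _ Fc) => z; have [] := hpair_norm_ge z.
apply: (@cvgP _ _ ((a, b) : hpair K L)); apply/cvgrPdist_lt => e e0.
have e20 : 0 < e / 2 by rewrite divr_gt0.
have /cvgrPdist_lt/(_ _ e20) Fa' := Fa.
have /cvgrPdist_lt/(_ _ e20) Fb' := Fb.
near=> z; rewrite (le_lt_trans (hpair_norm_le _))//=.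
rewrite [e]splitr ltrD//; near: z.
- exact: Fa'.
- exact: Fb'.
Unshelve. all: by end_near. Qed.

HB.instance Definition _ := Uniform_isComplete.Build (hpair K L)
  hpair_cauchy_cvg.

HB.instance Definition _ := @NormedModule_isHilbert.Build R (hpair K L)
  hpair_inner (sqr_dot_norm hpair_inner).

End hpair.

(* Finite Hilbert space direct sum, with norm |x|^2 = sum_i |x_i|^2. *)
Definition hsum (R : realType) (I : finType) (H : I -> hilbertType R) : Type :=
  forall i, H i.

Section hsum.
Variables (R : realType) (I : finType) (H : I -> hilbertType R).

HB.instance Definition _ := Choice.copy (hsum H) (forall i, H i).

Definition hsum_zero : hsum H := fun=> 0.
Definition hsum_opp (x : hsum H) : hsum H := fun i => - x i.
Definition hsum_add (x y : hsum H) : hsum H := fun i => x i + y i.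
Definition hsum_scale (a : R[i]) (x : hsum H) : hsum H := fun i => a *: x i.

Fact hsum_addA : associative hsum_add.
Proof. by move=> x y z; apply: functional_extensionality_dep => i; exact: addrA. Qed.
Fact hsum_addC : commutative hsum_add.
Proof. by move=> x y; apply: functional_extensionality_dep => i; exact: addrC. Qed.
Fact hsum_add0 : left_id hsum_zero hsum_add.
Proof. by move=> x; apply: functional_extensionality_dep => i; exact: add0r. Qed.
Fact hsum_addN : left_inverse hsum_zero hsum_opp hsum_add.
Proof. by move=> x; apply: functional_extensionality_dep => i; exact: addNr. Qed.

HB.instance Definition _ := GRing.isZmodule.Build (hsum H)
  hsum_addA hsum_addC hsum_add0 hsum_addN.

Fact hsum_scaleA a b x : hsum_scale a (hsum_scale b x) = hsum_scale (a * b) x.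
Proof. by apply: functional_extensionality_dep => i; exact: scalerA. Qed.
Fact hsum_scale1 : left_id 1 hsum_scale.
Proof. by move=> x; apply: functional_extensionality_dep => i; exact: scale1r. Qed.
Fact hsum_scaleDr : right_distributive hsum_scale +%R.
Proof. by move=> a x y; apply: functional_extensionality_dep => i; exact: scalerDr. Qed.
Fact hsum_scaleDl x : {morph hsum_scale^~ x : a b / a + b}.
Proof. by move=> a b; apply: functional_extensionality_dep => i; exact: scalerDl. Qed.

HB.instance Definition _ := GRing.Zmodule_isLmodule.Build R[i] (hsum H)
  hsum_scaleA hsum_scale1 hsum_scaleDr hsum_scaleDl.

Definition hsum_inner (x y : hsum H) : R[i] := \sum_i inner (x i) (y i).

Fact hsum_inner_bilinear : bilinear_for
  (GRing.Scale.Law.clone _ _ ( *%R ) _)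
  (GRing.Scale.Law.clone _ _ (conjC \; *%R ) _) hsum_inner.
Proof.
split=> [u'|u] a x y; rewrite /hsum_inner /= mulr_sumr -big_split/=.
  by apply: eq_bigr => i _; exact: linearPl.
by apply: eq_bigr => i _; exact: linearPr.
Qed.

HB.instance Definition _ := bilinear_isBilinear.Build R[i]
  (hsum H) (hsum H) R[i]
  ( *%R ) (conjC \; *%R ) hsum_inner hsum_inner_bilinear.

Fact hsum_inner_hermitian x y :
  hsum_inner x y = (-1) ^+ false * (hsum_inner y x)^*.
Proof.
rewrite /hsum_inner mul1r rmorph_sum/=; apply: eq_bigr => i _.
by rewrite (hermC inner) mul1r.
Qed.

HB.instance Definition _ := isHermitianSesquilinear.Build R[i] (hsum H)
  false conjC hsum_inner hsum_inner_hermitian.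

Fact hsum_inner_gt0 x : x != 0 -> 0 < hsum_inner x x.
Proof.
rewrite lt_def /hsum_inner sumr_ge0 => [|i _]; last exact: dnorm_ge0.
rewrite andbT; apply: contra; rewrite psumr_eq0 => [|i _]; last exact: dnorm_ge0.
move=> /allP x0; apply/eqP/functional_extensionality_dep => i; apply/eqP.
by have := x0 i (mem_index_enum i); rewrite /= dnorm_eq0.
Qed.

HB.instance Definition _ := isDotProduct.Build R[i] (hsum H) hsum_inner
  hsum_inner_gt0.

HB.instance Definition _ := @Lmodule_isNormed.Build R[i] (hsum H)
  (dot_norm hsum_inner) (dot_normD hsum_inner)
  (dot_normZ hsum_inner) (@dot_norm0_eq0 _ _ hsum_inner).

Lemma hsum_normE (x : hsum H) : `|x| ^+ 2 = \sum_i `|x i| ^+ 2.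
Proof.
rewrite (sqr_dot_norm hsum_inner); apply: eq_bigr => i _.
by rewrite sqr_normE.
Qed.

Lemma hsum_norm_ge (x : hsum H) i : `|x i| <= `|x|.
Proof.
rewrite -(@ler_pXn2r _ 2)// ?nnegrE// hsum_normE (bigD1 i)//= lerDl.
by apply: sumr_ge0 => j _; exact: exprn_ge0.
Qed.

Lemma hsum_norm_le (x : hsum H) : `|x| <= \sum_i `|x i|.
Proof.
rewrite -(@ler_pXn2r _ 2)// ?nnegrE ?sumr_ge0// hsum_normE.
pose P (s t : R[i]) := s <= t ^+ 2 /\ 0 <= t.
suff [] : P (\sum_i `|x i| ^+ 2) (\sum_i `|x i|) by [].
apply: (big_ind2 P) => [|s t u v [st t0] [uv v0]|i _] //; rewrite /P.
- by rewrite expr0n.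
- split; last exact: addr_ge0.
  by rewrite sqrrD addrAC (le_trans (lerD st uv))// lerDl mulrn_wge0// mulr_ge0.
Qed.

Definition hsum_proj i (x : hsum H) : H i := x i.

Fact hsum_proj_linear i : linear (hsum_proj i).
Proof. by []. Qed.

HB.instance Definition _ i := GRing.isLinear.Build R[i] (hsum H) (H i) *:%R
  (hsum_proj i) (@hsum_proj_linear i).

Lemma hsum_cauchy_cvg (F : set_system (hsum H)) :
  ProperFilter F -> cauchy F -> cvg F.
Proof.
move=> FF Fc.
have Fi i : hsum_proj i @ F --> lim (hsum_proj i @ F).
  apply: (@linear_contraction_cvg _ (hsum H) (H i) (@hsum_proj i) F _ FF Fc) => z.
  exact: hsum_norm_ge.
apply: (@cvgP _ _ ((fun i => lim (hsum_proj i @ F)) : hsum H)).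
apply/cvgrPdist_lt => e e0.
have d0 : 0 < e / #|I|.+1%:R by rewrite divr_gt0// ltr0n.
have Fd : \forall z \near F, forall i,
    `|lim (hsum_proj i @ F) - z i| < e / #|I|.+1%:R.
  by apply: filter_forall => i; have /cvgrPdist_lt/(_ _ d0) := Fi i.
near=> z.
have zd : forall i, `|lim (hsum_proj i @ F) - z i| < e / #|I|.+1%:R.
  by near: z; exact: Fd.
apply: (le_lt_trans (hsum_norm_le _)).
apply: (@le_lt_trans _ _ (\sum_(i : I) e / #|I|.+1%:R)).
  by apply: ler_sum => i _; exact/ltW/zd.
rewrite sumr_const -[_ *+ _]mulr_natr mulrAC ltr_pdivrMr ?ltr0n//.
by rewrite ltr_pM2l// ltr_nat.
Unshelve. all: by end_near. Qed.

HB.instance Definition _ := Uniform_isComplete.Build (hsum H) hsum_cauchy_cvg.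

HB.instance Definition _ := @NormedModule_isHilbert.Build R (hsum H)
  hsum_inner (sqr_dot_norm hsum_inner).

End hsum.
Section operators.
Variable R : realType.

(* The library norm on [H] takes values in R[i], hence the real part. *)
Definition opnorm (H K : hilbertType R) (f : H -> K) : R :=
  sup [set complex.Re `|f x| | x in [set x : H | `|x| <= 1]].

Definition strict_contraction (H : hilbertType R) (T : H -> H) : Prop :=
  continuous T /\ opnorm T < 1.

Definition isometric (H K : hilbertType R) (V : H -> K) : Prop :=
  continuous V /\ forall x, `|V x| = `|x|.

End operators.

Section schur_agler.
Variables (R : realType) (k : nat).
Implicit Types (phi : 'rV[R[i]]_k -> R[i]) (c : {ffun 'I_k -> nat} -> R[i]).

Definition polydisc : set 'rV[R[i]]_k := [set z | forall i, `|z 0 i| < 1].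

(* Complex Frechet differentiability: the scalar field of both normed modules
   is R[i]. *)
Definition analytic phi : Prop :=
  forall z, polydisc z -> differentiable phi z.

(* Multi-indices are finite functions [a : {ffun 'I_k -> nat}]; sums over them
   are unordered, i.e. limits of finite partial sums along [totally]. *)
Definition monomial (z : 'rV[R[i]]_k) (a : {ffun 'I_k -> nat}) : R[i] :=
  \prod_i z 0 i ^+ a i.

Definition power_series_of phi c : Prop := forall z, polydisc z ->
  partial_sum (fun a => c a * monomial z a) @ totally --> phi z.

Definition op_monomial (H : hilbertType R) (T : 'I_k -> H -> H)
    (a : {ffun 'I_k -> nat}) : H -> H :=
  \big[(fun f g => f \o g)/idfun]_(i < k) iter (a i) (T i).

(* [S] is phi(T_1, ..., T_k): the sum in operator norm of the power series of
   phi at 0, evaluated at the T_i. The coefficients are determined by phi, since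
   an unordered power series on the polydisc converges absolutely. *)
Definition functional_calculus phi (H : hilbertType R)
    (T : 'I_k -> H -> H) (S : H -> H) : Prop :=
  exists2 c, power_series_of phi c &
    opnorm (fun x => S x - partial_sum (fun a => c a *: op_monomial T a x) A)
      @[A --> totally] --> (0 : R).

Definition schur_agler phi : Prop :=
  analytic phi /\
  forall (H : hilbertType R) (T : 'I_k -> {linear H -> H}),
    (forall i, strict_contraction (T i)) ->
    (forall i j x, T i (T j x) = T j (T i x)) ->
    exists S : {linear H -> H},
      [/\ continuous S, functional_calculus phi T S & opnorm S <= 1].

End schur_agler.

Section subsums.
Variables (R : realType) (I : finType) (H : I -> hilbertType R).

Definition hsubsum (P : pred I) : hilbertType R :=
  hsum (fun i : {i | P i} => H (val i)).

Definition hsum_restrict (P : pred I) (x : hsum H) : hsubsum P :=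
  fun i => x (val i).

Definition hsum_extend (P : pred I) (y : hsubsum P) : hsum H :=
  fun i => match @idP (P i) with
           | ReflectT Pi => y (exist _ i Pi)
           | ReflectF _ => 0
           end.

End subsums.

Section colligation.
Variables (R : realType) (n : nat) (H : 'I_n -> hilbertType R).

Definition colligation_space : hilbertType R := hpair R[i] (hsum H).

Implicit Type V : colligation_space -> colligation_space.

Definition block_a V : R[i] := (V (1, 0)).1.
Definition block_B V (x : hsum H) : R[i] := (V (0, x)).1.
Definition block_C V (c : R[i]) : hsum H := (V (c, 0)).2.
Definition block_D V (x : hsum H) : hsum H := (V (0, x)).2.

Definition diag_op (z : 'rV[R[i]]_n) (x : hsum H) : hsum H :=
  fun i => z 0 i *: x i.

(* [pinv setT f] is the inverse of the bijection [f]. *)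
Definition transfer_function V (z : 'rV[R[i]]_n) : R[i] :=
  block_a V +
  block_B V (pinv setT (fun x => x - diag_op z (block_D V x))
                       (diag_op z (block_C V 1))).

Section property_F.
Variables (m : nat) (V : colligation_space -> colligation_space).

(* With 0-based indices, [lo] selects the summands of H_1^m and [hi] those of
   H_(m+1)^n. *)
Definition lo : pred 'I_n := fun i => (i < m)%N.
Definition hi : pred 'I_n := fun i => (m <= i)%N.

Definition block_B2 (y : hsubsum H hi) : R[i] := block_B V (hsum_extend y).
Definition block_C1 (c : R[i]) : hsubsum H lo := hsum_restrict (block_C V c).
Definition block_D12 (y : hsubsum H hi) : hsubsum H lo :=
  hsum_restrict (block_D V (hsum_extend y)).
Definition block_D21 (x : hsubsum H lo) : hsubsum H hi :=
  hsum_restrict (block_D V (hsum_extend x)).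

Definition property_F : Prop :=
  (forall x, block_D21 x = 0) /\
  (forall y, block_a V *: block_D12 y = block_C1 (block_B2 y)).

End property_F.
End colligation.

Section variables.
Variables (T : Type) (m n : nat) (lt_mn : (m < n)%N).

Definition first_vars (z : 'rV[T]_n) : 'rV[T]_m :=
  \row_i z 0 (widen_ord (ltnW lt_mn) i).

Definition last_vars (z : 'rV[T]_n) : 'rV[T]_(n - m) :=
  \row_j z 0 (cast_ord (subnKC (ltnW lt_mn)) (rshift m j)).

End variables.

(* Main.v *)
(* A factorization gives a colligation because, by Agler's theorem, each factor
   is the transfer function of an isometric colligation V1, V2 on a common state
   space; (V1 (+) I) (V2 (+) I) has property F_m(n) and the product as transfer
   function. Agler's theorem itself: on finitely many points, a functional
   separating 1 - phi(z) phi(w)^* from the cone generated by the kernels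
   (1 - z_i w_i^* ) f(z) f(w)^* would be an inner product on C^N for which
   multiplication by the coordinates is a tuple of commuting strict contractions
   T with |phi(T)| > 1. Triangular Gram factors of the resulting approximate
   decompositions converge along an ultrafilter, for a dense sequence of points;
   this yields vectors u_i(z) in l2 and an isometry
   (1, E(z) u(z)) |-> (phi(z), u(z)), extended to the whole space by feeding the
   orthogonal defect into a unilateral shift.

   Conversely, if V has property F_m(n) and b^2 = |a|^2 + |C_1|^2, then V is,
   after rescaling, a product of the above form, with
   phi(z) = theta(z, 0) / b and psi(w) = (b / a) theta(0, w). Both come from
   contractive colligations. Such a function f satisfies |f(T)| <= 1: if y_a are
   the power series coefficients of the state and
   W_N = sum_(|a| < N) y_a (x) T^a h, then
   |f_(N+1)(T) h|^2 + |W_(N+1)|^2 <= |h|^2 + |W_N|^2, which telescopes. *)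

From HB Require Import structures.
From mathcomp Require Import all_boot all_order all_algebra finmap ring lra.
From mathcomp Require Import sesquilinear complex.
From mathcomp Require Import boolp classical_sets functions reals.
From mathcomp Require Import topology normedtype derive sequences.
From mathcomp.analysis.showcase Require Import summability.
Require Import Defs.

Set Implicit Arguments.
Unset Strict Implicit.
Unset Printing Implicit Defensive.

Import Order.TTheory GRing.Theory Num.Theory Num.Def.
Import numFieldNormedType.Exports.

Local Open Scope classical_set_scope.
Local Open Scope ring_scope.

(* The hypothesis [theta 0 <> 0] means a <> 0. Property F then gives D_12 = C_1 B_2 / a, so what the
   last variables send into H_1^m is a multiple of C_1. The constant b compensates exactly for
   discarding that part in one factor and C_2 in the other, which keeps both rescaled factors
   contractive, and theta(z, w) = theta(z, 0) theta(0, w) / a.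

   The cone is never shown to be closed: separation gives decompositions up to an error, and the
   limit is taken on Gram factors. Triangularity makes the identity at two given points involve a
   number of entries independent of the number of points, so entrywise limits suffice. A separating
   functional may be degenerate; a small multiple of the identity is added, which also makes the
   multiplications strict contractions.

   The energies |W_N|^2 are nonnegative, so they cannot drop by a fixed amount at each step: this
   bounds the limit f(T) h, not each partial sum. Tensor products occur only through finite sums of
   products of inner products. *)
#[local] Existing Instance totally_filter.

(** * Real-valued norms and inner products *)

Lemma cvg_sumr (K : numFieldType) (W : normedModType K) T (F : set_system T) {FF : Filter F} I (s : seq I) (f : I -> T -> W)
    (l : I -> W) : (forall i, f i @ F --> l i) ->
  (fun t => \sum_(i <- s) f i t) @ F --> \sum_(i <- s) l i.
Proof.
move=> h; elim: s => [|i s ih].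
  by rewrite big_nil; under eq_fun do rewrite big_nil; exact: cvg_cst.
by rewrite big_cons; under eq_fun do rewrite big_cons; exact: (cvgD (h i) ih).
Qed.

Section real_norm.
Variable R : realType.
Notation C := R[i].
Local Open Scope complex_scope.

Lemma conjCE (z : C) : Num.conj z = conjc z.
Proof.
by [].
Qed.

Lemma cReD (x y : C) : complex.Re (x + y) = complex.Re x + complex.Re y.
Proof. by case: x y => a b [c d]. Qed.
Lemma cReN (x : C) : complex.Re (- x) = - complex.Re x.
Proof. by case: x. Qed.
Lemma cReZ (a : R) (x : C) : complex.Re (a%:C * x) = a * complex.Re x.
Proof. by case: x => c d /=; rewrite mul0r subr0. Qed.
Lemma cRe_conj (x : C) : complex.Re (Num.conj x) = complex.Re x.
Proof. by rewrite conjCE; case: x. Qed.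
Lemma Re_sum I (s : seq I) (P : pred I) (f : I -> C) :
  complex.Re (\sum_(i <- s | P i) f i) = \sum_(i <- s | P i) complex.Re (f i).
Proof. by elim/big_rec2: _ => // i x y _ <-; rewrite cReD. Qed.
Lemma real_CRe (x : C) : 0 <= x -> x = (complex.Re x)%:C.
Proof. by move=> x0; rewrite RRe_real// ger0_real. Qed.

(* The library norms are R[i]-valued; [rn] is the same norm seen in R, where the
   order is total. *)
Definition rn (W : normedModType C) (x : W) : R := complex.Re `|x|.

Section rn.
Variable W : normedModType C.
Implicit Types x y : W.

Lemma rnE x : `|x| = (rn x)%:C.
Proof. exact: real_CRe. Qed.
Lemma rn_ge0 x : 0 <= rn x.
Proof. by rewrite -ler0c -rnE. Qed.
Lemma rn0 : rn (0 : W) = 0.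
Proof. by rewrite /rn normr0. Qed.
Lemma rn_eq0 x : rn x = 0 -> x = 0.
Proof. by move=> h; apply/normr0_eq0; rewrite rnE h. Qed.
Lemma rnD x y : rn (x + y) <= rn x + rn y.
Proof. by rewrite -lecR rmorphD /= -!rnE ler_normD. Qed.
Lemma rnN x : rn (- x) = rn x.
Proof. by rewrite /rn normrN. Qed.
Lemma rnB x y : rn (x - y) = rn (y - x).
Proof. by rewrite /rn distrC. Qed.
Lemma rn_tri z x y : rn (x - y) <= rn (x - z) + rn (z - y).
Proof. by rewrite (le_trans _ (rnD _ _))// addrA subrK. Qed.
Lemma rn_sum I (s : seq I) (P : pred I) (f : I -> W) :
  rn (\sum_(i <- s | P i) f i) <= \sum_(i <- s | P i) rn (f i).
Proof.
elim/big_rec2: _ => [|i a b _ h]; first by rewrite rn0.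
by rewrite (le_trans (rnD _ _))// lerD2l.
Qed.
Lemma rnZ (a : C) x : rn (a *: x) = rn a * rn x.
Proof. by apply: complexI; rewrite rmorphM /= -!rnE normrZ. Qed.
Lemma le_rn x (e : R) : (`|x| <= e%:C) = (rn x <= e).
Proof. by rewrite rnE lecR. Qed.
Lemma lt_rn x (e : R) : (`|x| < e%:C) = (rn x < e).
Proof. by rewrite rnE ltcR. Qed.

Lemma cvg_rnP T (F : set_system T) {FF : Filter F} (u : T -> W) (l : W) :
  u @ F --> l <-> forall e : R, 0 < e -> \forall t \near F, rn (l - u t) < e.
Proof.
split=> [/cvgrPdist_lt h e e0|h].
  have e0' : 0 < e%:C :> C by rewrite ltcR.
  by apply: filterS (h _ e0') => t; rewrite lt_rn.
apply/cvgrPdist_lt => e e0; rewrite (real_CRe (ltW e0)).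
have e1 : 0 < complex.Re e by rewrite -ltcR -real_CRe// ltW.
by apply: filterS (h _ e1) => t; rewrite lt_rn.
Qed.

Lemma cvg_rn T (F : set_system T) {FF : Filter F} (u : T -> W) (l : W) :
  u @ F --> l -> (fun t => rn (u t)) @ F --> rn l.
Proof.
move/cvg_rnP => h; apply/cvgrPdist_lt => e e0.
apply: filterS (h _ e0) => t; apply: le_lt_trans.
have h1 := rnD (l - u t) (u t); have h2 := rnD (u t - l) l.
rewrite subrK in h1; rewrite subrK -rnB in h2.
rewrite ler_norml; apply/andP; split; lra.
Qed.

Lemma rn_unique x y : (forall e : R, 0 < e -> rn (x - y) < e) -> x = y.
Proof.
move=> h; apply/eqP; rewrite -subr_eq0; apply/eqP/rn_eq0/le_anti.
rewrite rn_ge0 andbT; apply/ler_addgt0Pl => e e0; rewrite addr0.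
exact/ltW/h.
Qed.

End rn.

Lemma rn_cauchy_cvg (W : completeNormedModType C) T (F : set_system T)
    {FF : ProperFilter F} (u : T -> W) :
  (forall e : R, 0 < e -> exists2 A, F A &
     forall x y, A x -> A y -> rn (u x - u y) < e) ->
  exists l : W, u @ F --> l.
Proof.
move=> h; suff /cvg_ex[l ul] : cvg (u @ F) by exists l.
apply: cauchy_cvg; apply/cauchy_ballP => e e0.
have e1 : 0 < complex.Re e by rewrite -ltcR -real_CRe// ltW.
have [A FA Ae] := h _ e1.
exists (u @` A, u @` A); first by split; rewrite /nbhs/=; apply: (@filterS _ _ _ A) => // x Ax; exists x.
move=> [_ _] [/= [x Ax <-] [y Ay <-]]; rewrite -ball_normE/=.
by rewrite (real_CRe (ltW e0)) lt_rn; exact: Ae.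
Qed.

Lemma rnM (a b : C) : rn (a * b) = rn a * rn b.
Proof. exact: rnZ. Qed.
Lemma rn1 : rn (1 : C) = 1.
Proof. by rewrite /rn normr1. Qed.
Lemma rnC (a : R) : rn (a%:C : C) = `|a|.
Proof. by rewrite /rn normc_def/= expr0n/= addr0 sqrtr_sqr. Qed.
Lemma rn_conj (a : C) : rn (Num.conj a) = rn a.
Proof. by rewrite /rn norm_conjC. Qed.
Lemma rn2E (a : C) : rn a ^+ 2 = complex.Re (a * Num.conj a).
Proof. by apply: complexI; rewrite rmorphXn /= -rnE normCK -real_CRe// mul_conjC_ge0. Qed.
Lemma rn_prod I (s : seq I) (P : pred I) (f : I -> C) :
  rn (\prod_(i <- s | P i) f i) = \prod_(i <- s | P i) rn (f i).
Proof. by elim/big_rec2: _ => [|i a b _ <-]; rewrite ?rn1 ?rnM. Qed.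
Lemma rnX (a : C) n : rn (a ^+ n) = rn a ^+ n.
Proof. by elim: n => [|n ih]; rewrite ?expr0 ?rn1// !exprS rnM ih. Qed.
Lemma Re_le_rn (a : C) : complex.Re a <= rn a.
Proof. by rewrite (le_trans (ler_norm _))// -lecR -rnE normc_ge_Re. Qed.

Definition mklin (U V : lmodType C) (f : U -> V) (h : linear f) : {linear U -> V} :=
  HB.pack f (GRing.isLinear.Build C U V *:%R f h).

Lemma bounded_lin_cont (V W : normedModType C) (f : {linear V -> W}) (M : R) :
  (forall x, rn (f x) <= M * rn x) -> continuous f.
Proof.
move=> h; apply/linear_bounded_continuous/linear_boundedP.
near=> r => x; rewrite !rnE.
have : M%:C <= r by near: r; apply: nbhs_pinfty_ge; apply/complex_realP; exists M.
move=> /(ler_wpM2r (_ : 0 <= (rn x)%:C)) /le_trans h1.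
apply: le_trans (h1 _ _ (lexx _)); last by rewrite ler0c rn_ge0.
by rewrite -rmorphM lecR.
Unshelve. all: by end_near. Qed.

Lemma cont_lin_bounded (V W : normedModType C) (f : {linear V -> W}) :
  continuous f -> exists2 M : R, 0 <= M & forall x, rn (f x) <= M * rn x.
Proof.
move=> /linear_bounded_continuous/linear_boundedP/pinfty_ex_gt0[r r0 h].
exists (complex.Re r); first by rewrite -ler0c -real_CRe// ltW.
by move=> x; rewrite -lecR rmorphM /= -!rnE -real_CRe ?h// ltW.
Qed.

End real_norm.

Section hilbert.
Variable R : realType.
Notation C := R[i].
Local Open Scope complex_scope.

Section ip.
Variable H : hilbertType R.
Implicit Types x y z : H.

Lemma ipDl x y z : inner (x + y) z = inner x z + inner y z.
Proof. exact: linearDl. Qed.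
Lemma ipDr x y z : inner z (x + y) = inner z x + inner z y.
Proof. exact: linearDr. Qed.
Lemma ipZl a x z : inner (a *: x) z = a * inner x z.
Proof. exact: linearZl_LR. Qed.
Lemma ipZr a x z : inner z (a *: x) = Num.conj a * inner z x.
Proof. exact: linearZr_LR. Qed.
Lemma ipNl x z : inner (- x) z = - inner x z.
Proof. exact: linearNl. Qed.
Lemma ipNr x z : inner z (- x) = - inner z x.
Proof. exact: linearNr. Qed.
Lemma ip0l z : inner 0 z = 0.
Proof. exact: linear0l. Qed.
Lemma ip0r z : inner z 0 = 0.
Proof. exact: linear0r. Qed.
Lemma ipC x y : inner x y = Num.conj (inner y x).
Proof. by rewrite (hermC inner) expr0 mul1r. Qed.
Lemma ip_suml I (s : seq I) (P : pred I) (f : I -> H) z :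
  inner (\sum_(i <- s | P i) f i) z = \sum_(i <- s | P i) inner (f i) z.
Proof. by elim/big_rec2: _ => [|i a b _ <-]; rewrite ?ip0l ?ipDl. Qed.
Lemma ip_sumr I (s : seq I) (P : pred I) (f : I -> H) z :
  inner z (\sum_(i <- s | P i) f i) = \sum_(i <- s | P i) inner z (f i).
Proof. by elim/big_rec2: _ => [|i a b _ <-]; rewrite ?ip0r ?ipDr. Qed.
Lemma ip_rn x : inner x x = (rn x ^+ 2)%:C.
Proof. by rewrite -sqr_normE rnE rmorphXn. Qed.
Lemma Re_ip x : complex.Re (inner x x) = rn x ^+ 2.
Proof. by rewrite ip_rn. Qed.

Lemma rn2D x y :
  rn (x + y) ^+ 2 = rn x ^+ 2 + rn y ^+ 2 + 2 * complex.Re (inner x y).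
Proof.
rewrite -!Re_ip ipDl !ipDr !cReD [in complex.Re (inner y x)]ipC cRe_conj.
by rewrite mulr2n mulrDl !mul1r; ring.
Qed.
Lemma rn2B x y :
  rn (x - y) ^+ 2 = rn x ^+ 2 + rn y ^+ 2 - 2 * complex.Re (inner x y).
Proof. by rewrite rn2D rnN ipNr cReN mulrN. Qed.

Lemma parallelogram x y :
  rn (x + y) ^+ 2 + rn (x - y) ^+ 2 = 2 * rn x ^+ 2 + 2 * rn y ^+ 2.
Proof. by rewrite rn2D rn2B; ring. Qed.

Lemma ip_CS x y : rn (inner x y) <= rn x * rn y.
Proof.
rewrite -(@ler_pXn2r _ 2)// ?nnegrE ?mulr_ge0 ?rn_ge0//.
rewrite -lecR rmorphXn /= -rnE exprMn rmorphM /= -!ip_rn.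
exact: dot_CauchySchwarz.
Qed.

(** The vectors may be dependent: a vanishing remainder [w] contributes the zero vector, so [e] is
    orthonormal up to zeros and no rank has to be tracked. The third clause is the triangularity. *)
Lemma gram_schmidt (v : nat -> H) n : exists e : nat -> H,
  [/\ forall l k, l != k -> inner (e l) (e k) = 0,
      forall l, inner (e l) (e l) = (e l != 0)%:R,
      forall j, (j < n)%N -> v j = \sum_(l < j.+1) inner (v j) (e l) *: e l &
      forall l, (n <= l)%N -> e l = 0].
Proof.
elim: n => [|n [e [eo e1 ev e0]]].
  by exists (fun=> 0); split => // *; rewrite ip0l ?eqxx.
pose w := v n - \sum_(l < n) inner (v n) (e l) *: e l.
have we l : inner w (e l) = 0.
  rewrite /w ipDl ipNl ip_suml; have [ln|nl] := ltnP l n; last first.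
    by rewrite e0// ip0r big1 ?subrr// => i _; rewrite ip0r.
  rewrite (bigD1 (Ordinal ln))//= big1 ?addr0 => [|i il].
    rewrite ipZl e1; case: eqVneq => [->|_]; rewrite ?ip0r ?mulr0 ?mulr1 subrr//.
  by rewrite ipZl eo ?mulr0//; apply: contra il => /eqP il; apply/eqP/val_inj.
pose w1 := ((rn w)^-1)%:C *: w.
have w11 : inner w1 w1 = (w1 != 0)%:R.
  rewrite /w1; have [->|w0] := eqVneq w 0; first by rewrite scaler0 ip0l eqxx.
  have rw0 : rn w != 0 by apply: contra w0 => /eqP/rn_eq0->.
  rewrite scaler_eq0 negb_or w0 andbT fmorph_eq0 invr_eq0 rw0.
  rewrite ipZl ipZr conjCE conjc_real ip_rn -!rmorphM /= -[1]/(1%:C); congr _%:C.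
  by field.
have ww1 : inner w w1 *: w1 = w.
  rewrite /w1; have [->|w0] := eqVneq w 0; first by rewrite !scaler0.
  have rw0 : rn w != 0 by apply: contra w0 => /eqP/rn_eq0->.
  rewrite ipZr conjCE conjc_real ip_rn scalerA -!rmorphM /=.
  rewrite (_ : _ * _ = 1) ?scale1r//; by field.
have w1e l : inner w1 (e l) = 0 by rewrite ipZl we mulr0.
have ew1 l : inner (e l) w1 = 0 by rewrite ipC w1e conjC0.
exists (fun l => if l == n then w1 else e l); split.
- move=> l k lk; have [ln|ln] := eqVneq l n; have [kn|kn] := eqVneq k n => //; last exact: eo.
  by move: lk; rewrite ln kn eqxx.
- by move=> l; case: eqVneq.
- move=> j; rewrite ltnS leq_eqVlt => /orP[/eqP->|jn].
    rewrite big_ord_recr/= eqxx.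
    have vE : v n = \sum_(l < n) inner (v n) (e l) *: e l + w by rewrite addrC subrK.
    have -> : inner (v n) w1 = inner w w1.
      rewrite [in LHS]vE ipDl ip_suml big1 ?add0r// => i _.
      by rewrite ipZl ew1 mulr0.
    rewrite ww1 [LHS]vE; congr (_ + _); apply: eq_bigr => i _.
    by rewrite ltn_eqF.
  rewrite [LHS]ev//; apply: eq_bigr => i _; rewrite ltn_eqF//.
  by rewrite (leq_trans (ltn_ord i)).
- move=> l nl; rewrite gtn_eqF// e0// ltnW//.
Qed.

(** The entries are the coordinates of [v i] in the Gram-Schmidt family. Row i stops at column i, so
    the Gram matrix of the first vectors never involves later columns. *)
Lemma triangular_gram (v : nat -> H) n : exists U : nat -> nat -> C,
  (forall i l, (i < l)%N -> (i < n)%N -> U i l = 0) /\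
  (forall i j, (i < n)%N -> (j < n)%N ->
     inner (v i) (v j) = \sum_(l < n) U i l * Num.conj (U j l)).
Proof.
have [e [eo e1 ev e0]] := gram_schmidt v n.
exists (fun i l => inner (v i) (e l)).
have U0 i l : (i < l)%N -> (i < n)%N -> inner (v i) (e l) = 0.
  move=> il iN; rewrite ev// ip_suml big1// => k _; rewrite ipZl eo ?mulr0//.
  by rewrite neq_ltn (leq_trans (ltn_ord k)).
split=> // i j iN jN.
rewrite {1}(ev i iN) ip_suml.
rewrite (big_ord_widen n (fun l => inner (inner (v i) (e l) *: e l) (v j)) iN).
rewrite big_mkcond/=; apply: eq_bigr => l _.
rewrite ltnS; case: leqP => il; first by rewrite ipZl [in inner (e l) _]ipC.
by rewrite U0// mul0r.
Qed.

End ip.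

(* Gram-Schmidt on the h_p makes the double sum a sum of values F(y, y). *)
Lemma tensor_ge0 (X : lmodType C) (H : hilbertType R) (F : X -> X -> C)
    (I : Type) (s : seq I) (x : I -> X) (h : I -> H) :
  (forall a x y z, F (a *: x + y) z = a * F x z + F y z) ->
  (forall z a x y, F z (a *: x + y) = Num.conj a * F z x + F z y) ->
  (forall x, 0 <= F x x) ->
  0 <= \sum_(p <- s) \sum_(q <- s) F (x p) (x q) * inner (h p) (h q).
Proof.
move=> Fl Fr F0.
have Fl0 z : F 0 z = 0.
  have := Fl (-1) 0 0 z; rewrite scaler0 addr0 => ->.
  by rewrite mulN1r addNr.
have Fr0 z : F z 0 = 0.
  have := Fr z (-1) 0 0; rewrite scaler0 addr0 => ->.
  by rewrite rmorphN rmorph1 mulN1r addNr.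
have Fsl J (r : seq J) (a : J -> C) (y : J -> X) z :
    F (\sum_(j <- r) a j *: y j) z = \sum_(j <- r) a j * F (y j) z.
  by elim/big_rec2: _ => [|j u v _ <-]; rewrite ?Fl0 ?Fl.
have Fsr J (r : seq J) (a : J -> C) (y : J -> X) z :
    F z (\sum_(j <- r) a j *: y j) = \sum_(j <- r) Num.conj (a j) * F z (y j).
  by elim/big_rec2: _ => [|j u v _ <-]; rewrite ?Fr0 ?Fr.
case: s => [|i0 s0]; first by rewrite big_nil.
set s := i0 :: s0.
have [U [_ UE]] := triangular_gram (fun n => h (nth i0 s n)) (size s).
suff -> : \sum_(p <- s) \sum_(q <- s) F (x p) (x q) * inner (h p) (h q) =
    \sum_(l < size s) F (\sum_(p < size s) U p l *: x (nth i0 s p))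
                        (\sum_(p < size s) U p l *: x (nth i0 s p)).
  by apply: sumr_ge0 => l _.
rewrite (big_nth i0) big_mkord.
under eq_bigr do rewrite (big_nth i0) big_mkord.
under [RHS]eq_bigr do rewrite Fsl.
rewrite [RHS]exchange_big/=; apply: eq_bigr => p _.
under [RHS]eq_bigr do rewrite Fsr mulr_sumr.
rewrite [RHS]exchange_big/=; apply: eq_bigr => q _.
rewrite UE// mulr_sumr; apply: eq_bigr => l _.
by rewrite mulrCA; congr (_ * _); rewrite mulrC.
Qed.

End hilbert.

(** * Unordered sums over multi-indices *)

Section fset_sums.
Variables (I : choiceType) (W : nmodType).
Local Open Scope fset_scope.
Local Open Scope ring_scope.

Lemma sum_fsetU (x : I -> W) (A B : {fset I}) : A `&` B = fset0 ->
  \sum_(a <- A `|` B) x a = \sum_(a <- A) x a + \sum_(a <- B) x a.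
Proof.
move=> dis; rewrite -big_cat; apply: perm_big; apply: uniq_perm => //.
  rewrite cat_uniq !fset_uniq/= andbT; apply/hasPn => a aB; apply/negP => aA.
  by have := in_fset0 a; rewrite -dis inE aA aB.
by move=> a; rewrite mem_cat inE.
Qed.

Lemma sum_fsetD (x : I -> W) (A B : {fset I}) : A `<=` B ->
  \sum_(a <- B) x a = \sum_(a <- A) x a + \sum_(a <- B `\` A) x a.
Proof.
move=> sAB; rewrite -sum_fsetU.
  by congr (\sum_(a <- enum_fset _) _); apply/fsetP => a; rewrite !inE; have := fsubsetP sAB a; case: (a \in A) => // ->.
by apply/fsetP => a; rewrite !inE; case: (a \in A).
Qed.

End fset_sums.

Section unordered_sums.
Variables (R : realType) (I : choiceType) (g : I -> R) (M : R).
Hypothesis g0 : forall a, 0 <= g a.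
Hypothesis gM : forall A : {fset I}, \sum_(a <- A) g a <= M.
Local Open Scope fset_scope.
Local Open Scope ring_scope.

Lemma partial_sumE (W : zmodType) (x : I -> W) (A : {fset I}) :
  partial_sum x A = \sum_(a <- A) x a.
Proof. by rewrite /partial_sum big_seq_fsetE. Qed.

(** A finite set whose sum is within e of the supremum leaves at most e for everything disjoint from
    it. *)
Lemma small_tail (e : R) : 0 < e ->
  exists A0 : {fset I}, forall B, A0 `&` B = fset0 -> \sum_(a <- B) g a <= e.
Proof.
move=> e0; pose S := [set \sum_(a <- A) g a | A in [set: {fset I}]]%classic.
have supS : has_sup S.
  split; first by exists (\sum_(a <- fset0) g a); exists fset0.
  by exists M => _ [A _ <-].
have [_ [A0 _ <-] hA0] := sup_adherent e0 supS.
exists A0 => B dis; have : \sum_(a <- A0 `|` B) g a <= sup S.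
  by apply: sup_ubound; [case: supS|exists (A0 `|` B)].
by rewrite sum_fsetU//; move: hA0; lra.
Qed.

Variable W : completeNormedModType R[i].
Variables (x : I -> W) (c : R).
Hypothesis c0 : 0 <= c.
Hypothesis xg : forall a, rn (x a) <= c * g a.

Lemma partial_sum_diff (e : R) (A0 A B : {fset I}) :
  (forall B, A0 `&` B = fset0 -> \sum_(a <- B) g a <= e) ->
  A0 `<=` A -> A `<=` B ->
  rn (partial_sum x B - partial_sum x A) <= c * e.
Proof.
move=> hA0 sA0 sAB; rewrite !partial_sumE.
rewrite (sum_fsetD x sAB).
rewrite addrC addKr (le_trans (rn_sum _ _ _))//.
rewrite (le_trans (ler_sum _ (fun a _ => xg a)))// -mulr_sumr ler_wpM2l//.
apply: hA0; apply/eqP; rewrite -fsubset0; apply/fsubsetP => a.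
rewrite !inE => /and3P[aA0 aA _]; move: aA.
by rewrite (fsubsetP sA0).
Qed.

Lemma partial_sum_cvg : exists l : W, partial_sum x @ totally --> l.
Proof.
apply: rn_cauchy_cvg => e e0.
(* Two partial sums are compared through the one over A0, which gives the 2; adding 1 keeps the
   divisor positive when c = 0. *)
have c1 : 0 < 2 * (c + 1) by rewrite mulr_gt0// ltr_wpDl.
have [A0 hA0] := small_tail (divr_gt0 e0 c1).
exists (fun B : {fset I} => A0 `<=` B : Prop); first by exists A0.
move=> A B sA sB; rewrite (le_lt_trans (rn_tri (partial_sum x A0) _ _))//.
have hA := partial_sum_diff hA0 (fsubset_refl A0) sA.
have hB := partial_sum_diff hA0 (fsubset_refl A0) sB.
rewrite rnB in hB; apply: le_lt_trans (lerD hA hB) _.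
have d0 := divr_gt0 e0 c1; have := divfK (lt0r_neq0 c1) e.
by move: (e / _) d0 => d d0 <-; lra.
Qed.

Lemma partial_sum_tail l (e : R) (A0 A : {fset I}) :
  partial_sum x @ totally --> l ->
  (forall B, A0 `&` B = fset0 -> \sum_(a <- B) g a <= e) ->
  A0 `<=` A -> rn (l - partial_sum x A) <= c * e.
Proof.
move=> /cvg_rnP xl hA0 sA; apply/ler_addgt0Pl => d d0.
have [A1 _ hA1] := xl _ d0.
have := hA1 (A `|` A1); rewrite /= fsubsetUr => /(_ isT) h1.
have h2 := partial_sum_diff hA0 sA (fsubsetUl A A1).
apply: (le_trans (rn_tri (partial_sum x (A `|` A1)) _ _)).
by rewrite lerD// ltW.
Qed.

End unordered_sums.

Section multiindex.
Variable k : nat.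
Notation I := {ffun 'I_k -> nat}.
Implicit Types (a : I) (j : 'I_k).

Definition deg a : nat := (\sum_j a j)%N.
Definition inc j a : I := [ffun i => ((i == j) + a i)%N].
Definition dec j a : I := [ffun i => (a i - (i == j))%N].
Definition mi0 : I := [ffun=> 0%N].

Lemma decK j a : (0 < a j)%N -> inc j (dec j a) = a.
Proof.
move=> aj; apply/ffunP => i; rewrite !ffunE; case: eqVneq => [->|_].
  by rewrite subnKC.
by rewrite subn0.
Qed.
Lemma incK j a : dec j (inc j a) = a.
Proof. by apply/ffunP => i; rewrite !ffunE addKn. Qed.
Lemma inc_gt0 j a : (0 < inc j a j)%N.
Proof. by rewrite ffunE eqxx. Qed.
Lemma deg_inc j a : deg (inc j a) = (deg a).+1.
Proof.
rewrite /deg (eq_bigr (fun i => (i == j) + a i)%N) => [|i _]; last by rewrite ffunE.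
by rewrite big_split/= -big_mkcond/= big_pred1_eq.
Qed.
Lemma deg_dec j a : (0 < a j)%N -> deg a = (deg (dec j a)).+1.
Proof. by move=> aj; rewrite -{1}(decK aj) deg_inc. Qed.
Lemma deg_eq0 a : (deg a == 0)%N = (a == mi0).
Proof.
rewrite sum_nat_eq0; apply/forallP/eqP => [h|-> i]; last by rewrite ffunE.
by apply/ffunP => i; rewrite ffunE; apply/eqP; exact: h.
Qed.
Lemma leq_deg j a : (a j <= deg a)%N.
Proof. by rewrite /deg (bigD1 j)//= leq_addr. Qed.

Local Open Scope fset_scope.
Local Open Scope ring_scope.

(** Indices with entries below N come from a finite type; this makes [box N] a finite set and lets
    [geom_multi] expand a product of sums over it. *)
Definition of_box N (b : {ffun 'I_k -> 'I_N}) : I := [ffun j => val (b j)].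

Definition box N : {fset I} := [fset a in codom (@of_box N)].

Lemma in_box N a : (a \in codom (@of_box N)) = [forall j, (a j < N)%N].
Proof.
apply/codomP/forallP => [[b ->] j|h]; first by rewrite /of_box ffunE ltn_ord.
exists [ffun j => Ordinal (h j)].
by apply/ffunP => j; rewrite !ffunE.
Qed.

Definition ball_idx N : {fset I} := [fset a in box N | (deg a < N)%N].

Lemma in_ball_idx N a : (a \in ball_idx N) = (deg a < N)%N.
Proof.
rewrite !inE/= in_box andb_idl// => aN; apply/forallP => j.
by rewrite (leq_ltn_trans (leq_deg j a)).
Qed.

Lemma ball_idxS N : ball_idx N `<=` ball_idx N.+1.
Proof. by apply/fsubsetP => a; rewrite !in_ball_idx => /ltnW. Qed.

Lemma ball_idx_sub N1 N2 : (N1 <= N2)%N -> ball_idx N1 `<=` ball_idx N2.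
Proof. by move=> h; apply/fsubsetP => a; rewrite !in_ball_idx => /leq_trans; apply. Qed.

Lemma ball_idx_cofinal (A : {fset I}) : exists N, A `<=` ball_idx N.
Proof.
exists (\max_(a <- A) deg a).+1; apply/fsubsetP => a aA.
by rewrite in_ball_idx ltnS; apply: leq_bigmax_seq.
Qed.

(** Multiplication by z_j, seen on coefficients: [dec j] maps the indices of level N + 1 with
    [0 < a j] bijectively onto level N. The telescoping inequalities rest on this. *)
Lemma sum_dec (W : nmodType) N j (G : I -> W) :
  \sum_(a <- ball_idx N.+1 | (0 < a j)%N) G (dec j a) = \sum_(a <- ball_idx N) G a.
Proof.
rewrite -big_filter.
rewrite (perm_big [seq inc j a | a <- ball_idx N])/=.
  by rewrite big_map; apply: eq_bigr => a _; rewrite incK.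
apply: uniq_perm; first by rewrite filter_uniq ?fset_uniq.
  by rewrite map_inj_uniq ?fset_uniq// => a b /(congr1 (dec j)); rewrite !incK.
move=> a; rewrite mem_filter in_ball_idx.
apply/andP/mapP => [[aj aN]|[b]].
  by exists (dec j a); rewrite ?decK// in_ball_idx -ltnS -deg_dec.
by rewrite in_ball_idx => bN ->; rewrite inc_gt0 deg_inc.
Qed.

Lemma sum_mi0 (W : nmodType) N (G : I -> W) :
  \sum_(a <- ball_idx N.+1 | a == mi0) G a = G mi0.
Proof.
rewrite -big_filter filter_pred1_uniq ?fset_uniq ?big_seq1//.
by rewrite in_ball_idx; have /eqP -> : deg (mi0) == 0%N by rewrite deg_eq0.
Qed.

(** Enlarging [A] to a box turns the sum into a product of k finite geometric sums, one for each
    coordinate. *)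
Lemma geom_multi (R : realType) (r : R) (A : {fset I}) : 0 <= r -> r < 1 ->
  \sum_(a <- A) r ^+ deg a <= ((1 - r)^-1) ^+ k.
Proof.
move=> r0 r1; have [N AN] := ball_idx_cofinal A.
have AB : A `<=` box N.
  by apply: (fsubset_trans AN); apply/fsubsetP => a; rewrite !inE /= => /andP[].
apply: (@le_trans _ _ (\sum_(a <- box N) r ^+ deg a)).
  by rewrite (sum_fsetD _ AB) lerDl sumr_ge0// => a _; rewrite exprn_ge0.
rewrite (perm_big (codom (@of_box N)))/=; last first.
  apply: uniq_perm; [exact: fset_uniq| |by move=> a; rewrite !inE].
  apply: (introT (injectiveP (@of_box N))) => b c /ffunP h.
  by apply/ffunP => j; apply/val_inj; have := h j; rewrite !ffunE.
rewrite big_image/=.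
rewrite (eq_bigr (fun b : {ffun 'I_k -> 'I_N} => \prod_j r ^+ b j)); last first.
  move=> b _; rewrite /deg -prodrXr; apply: eq_bigr => j _; by rewrite ffunE.
rewrite -(bigA_distr_bigA (fun (j : 'I_k) (i : 'I_N) => r ^+ i)) /=.
rewrite prodr_const card_ord lerXn2r ?nnegrE ?invr_ge0 ?subr_ge0 ?(ltW r1)//.
  by rewrite sumr_ge0// => i _; rewrite exprn_ge0.
have r1' : 0 < 1 - r by rewrite subr_gt0.
rewrite -(ler_pM2r r1') mulVf ?gt_eqF// mulrC.
rewrite -(big_mkord xpredT (fun i => r ^+ i)) -opprB mulNr.
have := subrX1 r N; rewrite big_mkord => <-.
by rewrite opprB lerBlDr lerDl exprn_ge0.
Qed.

Lemma small_geom_tail (R : realType) (r e : R) : 0 <= r -> r < 1 -> 0 < e ->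
  exists A0 : {fset I}, forall B, A0 `&` B = fset0 -> \sum_(a <- B) r ^+ deg a <= e.
Proof.
move=> r0 r1 e0.
apply: (small_tail (M := ((1 - r)^-1) ^+ k)) e0 => A.
exact: geom_multi.
Qed.

Lemma ball_idx_cvg (R : realType) (W : normedModType R[i]) (x : I -> W) (l : W) :
  partial_sum x @ totally --> l ->
  (fun N => \sum_(a <- ball_idx N) x a) @ \oo --> l.
Proof.
move=> /cvg_rnP h; apply/cvg_rnP => e e0.
have [A _ hA] := h _ e0; have [N AN] := ball_idx_cofinal A.
exists N => // n /= Nn; rewrite -partial_sumE.
apply: hA => /=; exact: (fsubset_trans AN (ball_idx_sub Nn)).
Qed.

End multiindex.

Section op_monomial.
Variables (R : realType) (k : nat) (H : hilbertType R) (T : 'I_k -> {linear H -> H}).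
Notation I := {ffun 'I_k -> nat}.

Let opm (s : seq 'I_k) (a : I) : H -> H :=
  \big[(fun f g => f \o g)/idfun]_(i <- s) iter (a i) (T i).

Lemma op_monomialE a : op_monomial T a = opm (index_enum 'I_k) a.
Proof. by []. Qed.

Lemma opm_cons i s a x : opm (i :: s) a x = iter (a i) (T i) (opm s a x).
Proof. by rewrite /opm big_cons. Qed.

Lemma op_monomial0 x : op_monomial T (mi0 k) x = x.
Proof.
rewrite op_monomialE; elim: (index_enum _) => [|i s ih]; first by rewrite /opm big_nil.
by rewrite opm_cons ffunE.
Qed.

Lemma op_monomial_linear a : linear (op_monomial T a).
Proof.
move=> c x y; rewrite op_monomialE; elim: (index_enum _) => [|i s ih].
  by rewrite /opm big_nil.
rewrite !opm_cons ih; elim: (a i) => [//|n ihn] /=.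
by rewrite ihn linearP.
Qed.

Lemma op_monomial_inc j a x : (forall i j x, T i (T j x) = T j (T i x)) ->
  op_monomial T (inc j a) x = T j (op_monomial T a x).
Proof.
move=> com; rewrite !op_monomialE.
have itc i n y : T j (iter n (T i) y) = iter n (T i) (T j y).
  by elim: n => //= n <-; rewrite com.
(* [op_monomial] multiplies in a fixed order in which j occurs once; in the rest of the list [inc j]
   changes nothing, and commutativity pulls the extra [T j] to the front. *)
have notin s : j \notin s -> opm s (inc j a) x = opm s a x.
  elim: s => [|i s ih]; first by rewrite /opm !big_nil.
  rewrite inE negb_or => /andP[ji js]; rewrite !opm_cons ih// ffunE.
  by rewrite eq_sym (negbTE ji).
have : j \in index_enum 'I_k by rewrite mem_index_enum.
have : uniq (index_enum 'I_k) by rewrite index_enum_uniq.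
elim: (index_enum _) => // i s ih /andP[/= ins us]; rewrite inE !opm_cons ffunE.
have [ij|ij] := eqVneq i j => /= js.
  by rewrite ij notin// -ij.
by rewrite ih ?add0n ?itc//; move: js; rewrite eq_sym (negbTE ij).
Qed.

Lemma op_monomial_bound (r : R) a x : 0 <= r ->
  (forall i x, rn (T i x) <= r * rn x) ->
  rn (op_monomial T a x) <= r ^+ deg a * rn x.
Proof.
move=> r0 hT; rewrite op_monomialE /deg.
elim: (index_enum _) => [|i s ih].
  by rewrite /opm !big_nil expr0 mul1r.
rewrite opm_cons big_cons exprD -mulrA.
apply: (@le_trans _ _ (r ^+ a i * rn (opm s a x))); last first.
  by rewrite ler_wpM2l// exprn_ge0.
elim: (a i) => [|n ihn] /=; first by rewrite expr0 mul1r.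
by rewrite (le_trans (hT _ _))// exprS -mulrA ler_wpM2l.
Qed.

End op_monomial.

Section monomial.
Variables (R : realType) (k : nat) (z : 'rV[R[i]]_k).

Lemma monomial0 : monomial z (mi0 k) = 1.
Proof. by rewrite /monomial big1// => i _; rewrite ffunE expr0. Qed.

Lemma monomial_inc j a : monomial z (inc j a) = z 0 j * monomial z a.
Proof.
rewrite /monomial (bigD1 j)//= [in RHS](bigD1 j)//= ffunE eqxx exprS mulrA.
by congr (_ * _); apply: eq_bigr => i ij; rewrite ffunE (negbTE ij).
Qed.

Lemma monomial_bound (r : R) a : (forall i, rn (z 0 i) <= r) ->
  rn (monomial z a) <= r ^+ deg a.
Proof.
move=> h; rewrite /monomial rn_prod /deg -prodrXr.
apply: ler_prod => i _; rewrite rn_ge0 rnX lerXn2r ?nnegrE ?rn_ge0//.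
exact: le_trans (rn_ge0 _) (h i).
Qed.

End monomial.

Section polydisc.
Variables (R : realType) (k : nat).

Lemma polydiscE (z : 'rV[R[i]]_k) : polydisc z <-> forall i, rn (z 0 i) < 1.
Proof. by split=> h i; have := h i; rewrite -lt_rn. Qed.

(** Finitely many strict bounds have a maximum below 1; starting it at 0 covers k = 0 and gives
    [0 <= r]. *)
Lemma uniform_lt1 (u : 'I_k -> R) : (forall i, u i < 1) ->
  exists r, [/\ 0 <= r, r < 1 & forall i, u i <= r].
Proof.
move=> h; exists (\big[Num.max/0]_i u i); split.
- exact: bigmax_ge_id.
- by apply/bigmax_ltP.
- by move=> i; exact: le_bigmax.
Qed.

End polydisc.

Section opnorm.
Variables (R : realType) (H K : hilbertType R).

Lemma opnorm_le (f : H -> K) (M : R) : 0 <= M ->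
  (forall x, rn (f x) <= M * rn x) -> opnorm f <= M.
Proof.
move=> M0 h; apply: ge_sup; first by exists (rn (f 0)), 0 => //=; rewrite normr0.
move=> _ [x /= x1 <-]; rewrite (le_trans (h x))// -[leRHS]mulr1 ler_wpM2l//.
by rewrite -le_rn.
Qed.

Lemma opnorm_ge0 (f : H -> K) (M : R) :
  (forall x, rn (f x) <= M * rn x) -> 0 <= opnorm f.
Proof.
move=> h; apply: (le_trans (rn_ge0 (f 0))); apply: sup_ubound.
  exists `|M| => _ [x /= x1 <-]; rewrite (le_trans (h x))//.
  rewrite (le_trans (ler_wpM2r (rn_ge0 x) (ler_norm M)))// -[leRHS]mulr1 ler_wpM2l//.
  by rewrite -le_rn.
by exists 0 => //=; rewrite normr0.
Qed.

Lemma le_opnorm (f : {linear H -> K}) x : continuous f ->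
  rn (f x) <= opnorm f * rn x.
Proof.
move=> /cont_lin_bounded[M M0 h].
have [->|x0] := eqVneq x 0; first by rewrite linear0 !rn0 mulr0.
have rx0 : 0 < rn x.
  by rewrite lt_def rn_ge0 andbT; apply: contra x0 => /eqP/rn_eq0->.
rewrite -ler_pdivrMr//; apply: sup_ubound.
  exists M => _ [y /= y1 <-]; rewrite (le_trans (h y))// -[leRHS]mulr1 ler_wpM2l//.
  by rewrite -le_rn.
exists (((rn x)^-1)%:C%C *: x).
  by rewrite /= le_rn rnZ rnC ger0_norm ?mulVf ?gt_eqF// invr_ge0 ltW.
rewrite linearZ/= -/(rn _) rnZ rnC ger0_norm ?invr_ge0 ?ltW//.
by rewrite mulrC.
Qed.

End opnorm.

(** * Contractive colligations have Schur-Agler transfer functions *)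

Lemma rn_sqr_le (R : realType) (W W' : normedModType R[i]) (x : W) (x' : W') :
  (rn x ^+ 2 <= rn x' ^+ 2) = (rn x <= rn x').
Proof. by rewrite ler_pXn2r// nnegrE rn_ge0. Qed.

Section hilbert_extra.
Variables (R : realType) (H : hilbertType R).

Lemma rn2_sum_ortho (I : finType) (x : I -> H) :
  (forall i j, i != j -> inner (x i) (x j) = 0) ->
  rn (\sum_i x i) ^+ 2 = \sum_i rn (x i) ^+ 2.
Proof.
move=> h; rewrite -Re_ip ip_suml Re_sum; apply: eq_bigr => i _.
rewrite ip_sumr (bigD1 i)//= big1 ?addr0 ?Re_ip// => j ji.
by rewrite h// eq_sym.
Qed.

Lemma ip_sum_ortho (I : finType) (x y : I -> H) :
  (forall i j, i != j -> inner (x i) (y j) = 0) ->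
  inner (\sum_i x i) (\sum_i y i) = \sum_i inner (x i) (y i).
Proof.
move=> h; rewrite ip_suml; apply: eq_bigr => i _.
rewrite ip_sumr (bigD1 i)//= big1 ?addr0// => j ji.
by rewrite h// eq_sym.
Qed.

Lemma hpair_rn (K : hilbertType R) (x : hpair H K) :
  rn x ^+ 2 = rn x.1 ^+ 2 + rn x.2 ^+ 2.
Proof. by rewrite -!Re_ip -cReD. Qed.

Lemma complex_ipE (x y : R[i]) : inner x y = x * Num.conj y.
Proof. by []. Qed.

Lemma hpair_ipE (K : hilbertType R) (x y : hpair H K) :
  inner x y = inner x.1 y.1 + inner x.2 y.2.
Proof. by []. Qed.

End hilbert_extra.

Section realization.
Variables (R : realType) (k : nat) (X : hilbertType R).
Notation C := R[i].
Notation I := {ffun 'I_k -> nat}.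
Variable V : {linear hpair C X -> hpair C X}.
Hypothesis V_contr : forall x, rn (V x) <= rn x.
Variable Q : 'I_k -> {linear X -> X}.
Hypothesis Q_ortho : forall i j x y, i != j -> inner (Q i x) (Q j y) = 0.
Hypothesis Q_bessel : forall x, \sum_j rn (Q j x) ^+ 2 <= rn x ^+ 2.
Local Notation mi0 := (mi0 k).

(** Coefficient of index a in E(z) y(z), where E(z) is the sum of the z_j Q_j. Only a Bessel
    inequality is asked of the [Q j], because they may be projections onto just some of the summands
    of the state space. *)
Definition shift_in (y : I -> X) (a : I) : X :=
  \sum_j (if (0 < a j)%N then Q j (y (dec j a)) else 0).

(** The coefficient of index a depends on those of degree one less, so the recursion runs on d,
    meant to be [deg a + 1]. The value at d = 0 is then never reached. *)
Fixpoint state_lev d (a : I) : X :=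
  if d is d'.+1 then (V (((a == mi0)%:R, shift_in (state_lev d') a) : hpair C X)).2
  else 0.

Definition state_coef a : X := state_lev (deg a).+1 a.
Definition input_coef a : hpair C X := ((a == mi0)%:R, shift_in state_coef a).
Definition transfer_coef a : C := (V (input_coef a)).1.

Local Notation y := state_coef.
Local Notation f := transfer_coef.
Local Notation u := input_coef.

Lemma V_input_coef a : V (u a) = (f a, y a).
Proof.
rewrite [LHS]surjective_pairing; congr pair.
rewrite /y /= /u; congr (V (_, _)).2; apply: eq_bigr => j _.
by case: ifP => // aj; rewrite (deg_dec aj).
Qed.

Lemma input_ip a b : inner (u a) (u b) = (a == mi0)%:R * (b == mi0)%:R +
  \sum_j (if (0 < a j)%N && (0 < b j)%N
          then inner (Q j (y (dec j a))) (Q j (y (dec j b))) else 0).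
Proof.
rewrite hpair_ipE /= complex_ipE conjC_nat; congr (_ + _).
rewrite ip_sum_ortho; last first.
  move=> i j ij; case: ifP; case: ifP; rewrite ?ip0l ?ip0r// => _ _.
  exact: Q_ortho.
by apply: eq_bigr => j _; case: ifP; case: ifP => //=; rewrite ?ip0l ?ip0r.
Qed.

(** Energy balance of the contraction V. The inputs of degree at most N have total squared norm 1,
    from the constant term, plus that of the shifted states of degree below N, which [Q_bessel]
    bounds. *)
Lemma transfer_coef_sq N :
  \sum_(a <- ball_idx k N.+1) rn (f a) ^+ 2 +
  \sum_(a <- ball_idx k N.+1) rn (y a) ^+ 2 <=
  1 + \sum_(a <- ball_idx k N) rn (y a) ^+ 2.
Proof.
rewrite -big_split/=.
apply: (@le_trans _ _ (\sum_(a <- ball_idx k N.+1) rn (u a) ^+ 2)).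
  apply: ler_sum => a _.
  have := V_contr (u a); rewrite -rn_sqr_le.
  by rewrite V_input_coef hpair_rn.
under [leLHS]eq_bigr do rewrite -Re_ip input_ip cReD Re_sum.
rewrite big_split/= lerD//.
  rewrite (eq_bigr (fun a => if a == mi0 then 1 else 0)) => [|a _].
    by rewrite -big_mkcond/= sum_mi0 ?lexx.
  by case: eqP => _ /=; rewrite ?mul1r ?mul0r ?subr0.
rewrite exchange_big/=.
apply: (@le_trans _ _ (\sum_j \sum_(a <- ball_idx k N) rn (Q j (y a)) ^+ 2)).
  apply: ler_sum => j _.
  rewrite -(sum_dec N j (fun a => rn (Q j (y a)) ^+ 2)) big_mkcond/= [leRHS]big_mkcond/=.
  by apply: ler_sum => a _; rewrite andbb; case: ifP => _; rewrite ?Re_ip.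
by rewrite exchange_big/=; apply: ler_sum => a _; exact: Q_bessel.
Qed.

(** The states of degree below N cancel in [transfer_coef_sq], which leaves a sum of |f_b|^2 bounded
    by 1. *)
Lemma transfer_coef_le1 a : rn (f a) <= 1.
Proof.
have h : \sum_(b <- ball_idx k (deg a).+1) rn (f b) ^+ 2 <= 1.
  have := transfer_coef_sq (deg a).
  rewrite (sum_fsetD (fun b => rn (y b) ^+ 2) (ball_idxS k (deg a))).
  have : 0 <= \sum_(b <- (ball_idx k (deg a).+1 `\` ball_idx k (deg a))%fset) rn (y b) ^+ 2.
    by rewrite sumr_ge0// => b _; rewrite exprn_ge0// rn_ge0.
  lra.
rewrite -(@ler_pXn2r _ 2)// ?nnegrE ?rn_ge0// expr1n (le_trans _ h)//.
rewrite (big_rem a) ?in_ball_idx//= lerDl sumr_ge0// => b _.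
by rewrite exprn_ge0// rn_ge0.
Qed.

Section scalar.
Variables (z : 'rV[C]_k) (r : R).
Hypotheses (r0 : 0 <= r) (r1 : r < 1) (zr : forall i, rn (z 0 i) <= r).

Let E (x : X) : X := \sum_j z 0 j *: Q j x.

Lemma diag_bound x : rn (E x) <= r * rn x.
Proof.
rewrite -(@ler_pXn2r _ 2)// ?nnegrE ?mulr_ge0 ?rn_ge0//.
rewrite rn2_sum_ortho; last first.
  by move=> i j ij; rewrite ipZl ipZr Q_ortho ?mulr0.
rewrite exprMn (le_trans _ (ler_wpM2l _ (Q_bessel x))) ?exprn_ge0//.
rewrite mulr_sumr; apply: ler_sum => j _; rewrite rnZ exprMn ler_wpM2r//.
  by rewrite exprn_ge0// rn_ge0.
by rewrite lerXn2r ?nnegrE ?rn_ge0.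
Qed.

(** The state equation holds for truncations, with one more degree in the output: it is
    [V_input_coef] summed against the monomials. *)
Lemma transfer_partial N :
  V ((1, E (\sum_(a <- ball_idx k N) monomial z a *: y a)) : hpair C X) =
  (\sum_(a <- ball_idx k N.+1) monomial z a * f a,
   \sum_(a <- ball_idx k N.+1) monomial z a *: y a).
Proof.
have -> : ((1, E (\sum_(a <- ball_idx k N) monomial z a *: y a)) : hpair C X) =
    \sum_(a <- ball_idx k N.+1) monomial z a *: u a.
  rewrite [RHS]surjective_pairing; congr pair.
    rewrite (raddf_sum fst) /= (eq_bigr (fun a => if a == mi0 then 1 else 0)) => [|a _].
      by rewrite -big_mkcond/= sum_mi0 ?lexx.
    by case: eqP => [->|_] /=; rewrite ?monomial0 ?scale1r ?scaler0.
  rewrite (raddf_sum snd) /= /E.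
  under [RHS]eq_bigr do rewrite /shift_in scaler_sumr.
  rewrite [RHS]exchange_big/=; apply: eq_bigr => j _.
  rewrite raddf_sum scaler_sumr.
  rewrite -(sum_dec N j (fun a => z 0 j *: Q j (monomial z a *: y a))) big_mkcond/=.
  apply: eq_bigr => a _; case: ifP => aj; last by rewrite scaler0.
  by rewrite linearZ scalerA -monomial_inc decK.
rewrite raddf_sum/= [RHS]surjective_pairing /=.
under eq_bigr do rewrite linearZ/= V_input_coef.
by rewrite [LHS]surjective_pairing (raddf_sum fst) (raddf_sum snd).
Qed.

Variables (y0 : X) (w : C).
Hypothesis Vy0 : V ((1, E y0) : hpair C X) = (w, y0).

(** The exact state and its truncation satisfy the same equation up to one degree, so their
    difference passes through [E] and [V] and shrinks by r at each level. *)
Lemma transfer_approx N :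
  rn (w - \sum_(a <- ball_idx k N.+1) monomial z a * f a) <= r ^+ N.+1 * rn y0 /\
  rn (y0 - \sum_(a <- ball_idx k N.+1) monomial z a *: y a) <= r ^+ N.+1 * rn y0.
Proof.
have step n : let e := y0 - \sum_(a <- ball_idx k n) monomial z a *: y a in
  let e' := y0 - \sum_(a <- ball_idx k n.+1) monomial z a *: y a in
  rn (w - \sum_(a <- ball_idx k n.+1) monomial z a * f a) <= r * rn e /\
  rn e' <= r * rn e.
  move=> e e'.
  have Ve : V ((0, E e) : hpair C X) =
      (w - \sum_(a <- ball_idx k n.+1) monomial z a * f a, e').
    have -> : ((0, E e) : hpair C X) = (1, E y0) -
       (1, E (\sum_(a <- ball_idx k n) monomial z a *: y a)).
      congr pair; first by rewrite subrr.
      by rewrite /E /e -sumrB; apply: eq_bigr => j _; rewrite linearB scalerBr.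
    by rewrite linearB Vy0 transfer_partial.
  have : rn (V ((0, E e) : hpair C X)) <= r * rn e.
    apply: (le_trans (V_contr _)); apply: (le_trans _ (diag_bound e)).
    by rewrite -rn_sqr_le hpair_rn /= rn0 expr0n add0r.
  rewrite Ve => h; split; apply: le_trans h.
    by rewrite -rn_sqr_le hpair_rn /= lerDl exprn_ge0 ?rn_ge0.
  by rewrite -rn_sqr_le hpair_rn /= lerDr exprn_ge0 ?rn_ge0.
elim: N => [|N [_ ih]].
  have := step 0%N; have -> : ball_idx k 0 = fset0.
    by apply/fsetP => a; rewrite in_ball_idx ltn0.
  by rewrite big_seq_fset0 subr0 expr1.
have [h1 h2] := step N.+1; rewrite exprS -mulrA.
by split; [apply: le_trans h1 _|apply: le_trans h2 _]; rewrite ler_wpM2l.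
Qed.

(** Coefficients bounded by 1 give some unordered limit by comparison with a geometric series; the
    truncations by degree identify it as [w]. *)
Lemma transfer_power_series :
  partial_sum (fun a => f a * monomial z a) @ totally --> w.
Proof.
have bd a : rn (f a * monomial z a) <= 1 * r ^+ deg a.
  rewrite rnM ler_pM ?rn_ge0 ?transfer_coef_le1//; exact: monomial_bound.
have [l hl] := @partial_sum_cvg _ _ _ _ (fun A => geom_multi A r0 r1)
  _ _ _ ler01 bd.
suff -> : w = l by [].
have /cvg_rnP hl' := ball_idx_cvg hl.
apply: rn_unique => e e0.
have e20 : 0 < e / 2 by rewrite divr_gt0.
have [N0 _ hN0] := hl' _ e20.
have y1 : 0 < rn y0 + 1 by rewrite ltr_wpDl ?rn_ge0.
have /cvgrPdist_lt/(_ _ (divr_gt0 e20 y1))[N1 _ hN1] : (fun n => r ^+ n) @ \oo --> (0 : R).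
  by apply: cvg_expr; rewrite ger0_norm.
pose N := maxn N0 N1.
apply: (le_lt_trans (rn_tri (\sum_(a <- ball_idx k N.+1) f a * monomial z a) _ _)).
rewrite (splitr e) ltrD//; last first.
  by rewrite rnB; apply: hN0; rewrite /= leqW// leq_maxl.
under eq_bigr do rewrite mulrC.
apply: (le_lt_trans (transfer_approx N).1).
have := hN1 N.+1; rewrite /= leqW ?leq_maxr// => /(_ isT).
rewrite sub0r normrN ger0_norm ?exprn_ge0// ltr_pdivlMr// => h.
by apply: le_lt_trans h; rewrite ler_wpM2l ?exprn_ge0// lerDl.
Qed.

End scalar.

Section operator.
Variables (K : hilbertType R) (T : 'I_k -> {linear K -> K}) (r : R).
Hypotheses (r0 : 0 <= r) (r1 : r < 1) (Tr : forall i x, rn (T i x) <= r * rn x).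
Hypothesis Tcom : forall i j x, T i (T j x) = T j (T i x).

Let t h a := op_monomial T a h.
Let G N h := \sum_(a <- ball_idx k N) \sum_(b <- ball_idx k N)
  inner (y a) (y b) * inner (t h a) (t h b).

(* [G N h] is the squared norm of sum_(|a| < N) y_a (x) T^a h in the Hilbert tensor
   product, which is never formed. *)
Lemma tensor_step N h :
  inner (\sum_(a <- ball_idx k N.+1) f a *: t h a)
        (\sum_(a <- ball_idx k N.+1) f a *: t h a) + G N.+1 h <=
  inner h h + G N h.
Proof.
have T1 i x : rn (T i x) <= rn x.
  by rewrite (le_trans (Tr i x))// -[leRHS]mul1r ler_wpM2r ?rn_ge0// ltW.
have lin1 (U W : hilbertType R) (A : {linear U -> W}) a x x' z :
  inner (A (a *: x + x')) (A z) = a * inner (A x) (A z) + inner (A x') (A z).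
  by rewrite linearP ipDl ipZl.
have lin2 (U W : hilbertType R) (A : {linear U -> W}) z a x x' :
  inner (A z) (A (a *: x + x')) = Num.conj a * inner (A z) (A x) + inner (A z) (A x').
  by rewrite linearP ipDr ipZr.
have le_ip (U W : hilbertType R) (x : U) (x' : W) : rn x <= rn x' -> inner x x <= inner x' x'.
  by move=> h1; rewrite !ip_rn lecR lerXn2r ?nnegrE ?rn_ge0.
have tdec (j : 'I_k) (a : I) : (0 < a j)%N -> t h a = T j (t h (dec j a)).
  by move=> aj; rewrite -{1}(decK aj) /t op_monomial_inc.
(* First loss: [V] contracts the first tensor factor, by [tensor_ge0] for the form |x|^2 - |V
   x|^2. *)
apply: (@le_trans _ _ (\sum_(a <- ball_idx k N.+1) \sum_(b <- ball_idx k N.+1)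
   inner (u a) (u b) * inner (t h a) (t h b))).
  rewrite -subr_ge0.
  refine (le_trans (@tensor_ge0 R (hpair C X) K (fun x x' => inner x x' - inner (V x) (V x'))
    _ (ball_idx k N.+1) u (t h) _ _ _) _).
  - move=> a x x' z; rewrite lin1 ipDl ipZl; ring.
  - move=> z a x x'; rewrite lin2 ipDr ipZr; ring.
  - by move=> x; rewrite subr_ge0; apply: le_ip; exact: V_contr.
  rewrite le_eqVlt; apply/orP; left; apply/eqP.
  rewrite ip_suml /G -big_split -sumrB/=; apply: eq_bigr => a _.
  rewrite ip_sumr -big_split -sumrB/=; apply: eq_bigr => b _.
  rewrite !V_input_coef [in X in _ - X]hpair_ipE /= complex_ipE ipZl ipZr; ring.
under eq_bigr do under eq_bigr do rewrite input_ip mulrDl mulr_suml.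
under eq_bigr do rewrite big_split/=.
rewrite big_split/= lerD//.
  rewrite (eq_bigr (fun a => if a == mi0 then inner h h else 0)) => [|a _].
    by rewrite -big_mkcond/= sum_mi0 ?lexx.
  case: eqP => [->|_]; last by rewrite big1// => b _; rewrite !mul0r.
  rewrite (eq_bigr (fun a => if a == mi0 then inner h h else 0)) => [|b _].
    by rewrite -big_mkcond/= sum_mi0 ?lexx.
  by case: eqP => [->|_]; rewrite ?mulr0 ?mul0r ?mul1r /t ?op_monomial0.
(* An equality in fact: [sum_dec] reindexes both sums, and [tdec] splits one factor [T j] off each
   monomial. *)
apply: (@le_trans _ _ (\sum_j \sum_(a <- ball_idx k N) \sum_(b <- ball_idx k N)
   inner (Q j (y a)) (Q j (y b)) * inner (T j (t h a)) (T j (t h b)))).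
  rewrite le_eqVlt; apply/orP; left; apply/eqP.
  under eq_bigr do rewrite exchange_big/=.
  rewrite exchange_big/=; apply: eq_bigr => j _.
  rewrite -(sum_dec N j (fun a => \sum_(b <- ball_idx k N)
   inner (Q j (y a)) (Q j (y b)) * inner (T j (t h a)) (T j (t h b)))) [RHS]big_mkcond/=.
  apply: eq_bigr => a _; case: ifP => aj; last by rewrite big1// => b _; rewrite mul0r.
  rewrite -(sum_dec N j (fun b => inner (Q j (y (dec j a))) (Q j (y b)) *
     inner (T j (t h (dec j a))) (T j (t h b)))) [RHS]big_mkcond/=.
  apply: eq_bigr => b _; case: ifP => bj /=; last by rewrite mul0r.
  by rewrite (tdec _ _ aj) (tdec _ _ bj).
(* Second loss: each [T j] contracts the other tensor factor. *)
apply: (@le_trans _ _ (\sum_j \sum_(a <- ball_idx k N) \sum_(b <- ball_idx k N)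
   inner (Q j (y a)) (Q j (y b)) * inner (t h a) (t h b))).
  apply: ler_sum => j _; rewrite -subr_ge0.
  refine (le_trans (@tensor_ge0 R K X (fun x x' => inner x x' - inner (T j x) (T j x'))
    _ (ball_idx k N) (t h) (fun a => Q j (y a)) _ _ _) _).
  - move=> a x x' z; rewrite lin1 ipDl ipZl; ring.
  - move=> z a x x'; rewrite lin2 ipDr ipZr; ring.
  - by move=> x; rewrite subr_ge0; apply: le_ip; exact: T1.
  rewrite le_eqVlt; apply/orP; left; apply/eqP.
  rewrite -sumrB; apply: eq_bigr => a _; rewrite -sumrB; apply: eq_bigr => b _.
  ring.
(* Third loss: the Bessel inequality of the [Q j] on the states. *)
rewrite -subr_ge0.
refine (le_trans (@tensor_ge0 R X K (fun x x' => inner x x' - \sum_j inner (Q j x) (Q j x'))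
    _ (ball_idx k N) y (t h) _ _ _) _).
- move=> a x x' z; rewrite ipDl ipZl.
  under eq_bigr do rewrite lin1.
  by rewrite big_split/= -mulr_sumr; ring.
- move=> z a x x'; rewrite ipDr ipZr.
  under eq_bigr do rewrite lin2.
  by rewrite big_split/= -mulr_sumr; ring.
- move=> x; rewrite subr_ge0 (eq_bigr (fun j => (rn (Q j x) ^+ 2)%:C%C)).
    by rewrite -rmorph_sum ip_rn lecR.
  by move=> j _; rewrite ip_rn.
rewrite le_eqVlt; apply/orP; left; apply/eqP; rewrite /G.
rewrite [X in _ = _ - X]exchange_big/= -sumrB; apply: eq_bigr => a _.
rewrite [X in _ = _ - X]exchange_big/= -sumrB; apply: eq_bigr => b _.
by rewrite mulrBl mulr_suml.
Qed.

Lemma tensor_energy_ge0 N h : 0 <= G N h.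
Proof.
apply: tensor_ge0 => [a x x' z|z a x x'|x].
- by rewrite ipDl ipZl.
- by rewrite ipDr ipZr.
- by rewrite ip_rn ler0c exprn_ge0// rn_ge0.
Qed.

(** If |l| > |h|, then from some N on the partial sums exceed |h|^2 by d / 2 in squared norm, so by
    [tensor_step] the energy [g] drops by d / 2 at each step and becomes negative. *)
Lemma von_neumann h l :
  partial_sum (fun a => f a *: op_monomial T a h) @ totally --> l -> rn l <= rn h.
Proof.
move=> /ball_idx_cvg/cvg_rn hl; rewrite leNgt; apply/negP => lh.
pose P N := \sum_(a <- ball_idx k N) f a *: t h a.
pose g N := complex.Re (G N h).
have g_ge0 N : 0 <= g N by rewrite -ler0c /g -real_CRe ?tensor_energy_ge0.
have step N : rn (P N.+1) ^+ 2 + g N.+1 <= rn h ^+ 2 + g N.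
  have := tensor_step N h; rewrite lecE => /andP[_].
  by rewrite !cReD !Re_ip.
pose d := rn l ^+ 2 - rn h ^+ 2.
have d0 : 0 < d by rewrite subr_gt0 ltrXn2r ?nnegrE ?rn_ge0.
have : (fun N => rn (P N) ^+ 2) @ \oo --> rn l ^+ 2 by rewrite expr2; under eq_fun do rewrite expr2; exact: (cvgM hl hl).
have d20 : 0 < d / 2 by rewrite divr_gt0.
move=> /cvgrPdist_lt/(_ _ d20)[N0 _ hN0].
have PN N : (N0 <= N)%N -> rn h ^+ 2 + d / 2 <= rn (P N) ^+ 2.
  move=> NN; have := hN0 N NN; rewrite /= ltr_norml => /andP[_].
  by rewrite /d; lra.
have gN M : g (N0 + M)%N + M%:R * (d / 2) <= g N0.
  elim: M => [|M ih]; first by rewrite addn0 mul0r addr0.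
  have := step (N0 + M)%N; have := PN (N0 + M).+1 (leqW (leq_addr _ _)).
  rewrite addnS -[M.+1]addn1 natrD; move: ih d20; move: (d / 2) => e; lra.
pose M := Num.Def.archi_bound (g N0 / (d / 2)).
have := archi_boundP (divr_ge0 (g_ge0 N0) (ltW d20)); rewrite -/M ltr_pdivrMr// => hM.
by have := gN M; have := g_ge0 (N0 + M)%N; move: hM; lra.
Qed.

(** S is defined pointwise as a limit. Its tails are bounded by a multiple of [rn x] uniformly in x,
    which upgrades pointwise convergence to convergence in operator norm. *)
Lemma transfer_calculus : exists S : {linear K -> K},
  [/\ continuous S,
      opnorm (fun x => S x - partial_sum (fun a => f a *: op_monomial T a x) A)
        @[A --> totally] --> (0 : R) &
      opnorm S <= 1].
Proof.
have bd x a : rn (f a *: op_monomial T a x) <= rn x * r ^+ deg a.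
  rewrite rnZ -[leRHS]mul1r ler_pM ?rn_ge0 ?transfer_coef_le1//.
  by rewrite mulrC; apply: op_monomial_bound.
have ex x : exists l : K, partial_sum (fun a => f a *: op_monomial T a x) @ totally --> l.
  exact: (@partial_sum_cvg _ _ _ _ (fun A => geom_multi A r0 r1) _ _ _ (rn_ge0 x) (bd x)).
pose S0 x := projT1 (cid (ex x)).
have S0P x : partial_sum (fun a => f a *: op_monomial T a x) @ totally --> S0 x.
  exact: projT2 (cid (ex x)).
have S0lin : linear S0.
  move=> c x x'; apply: (@cvg_unique _ _ (fmap (partial_sum (fun a => f a *: op_monomial T a (c *: x + x'))) totally)).
  - exact: norm_hausdorff.
  - exact: S0P.
  rewrite (_ : partial_sum _ = fun A =>
     c *: partial_sum (fun a => f a *: op_monomial T a x) A +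
     partial_sum (fun a => f a *: op_monomial T a x') A); last first.
    apply/funext => A; rewrite !partial_sumE scaler_sumr -big_split/=.
    apply: eq_bigr => a _; rewrite op_monomial_linear scalerDr !scalerA.
    by rewrite mulrC.
  apply: cvgD; last exact: S0P.
  by apply: cvgZr; exact: S0P.
pose S := mklin S0lin.
have S1 x : rn (S x) <= 1 * rn x by rewrite mul1r; apply: von_neumann (S0P x).
exists S; split.
- exact: bounded_lin_cont S1.
- apply/cvgrPdist_le => e e0.
  have [A0 hA0] := small_geom_tail k r0 r1 e0.
  exists A0 => // A sA; rewrite sub0r normrN.
  have bdA x : rn (S x - partial_sum (fun a => f a *: op_monomial T a x) A) <= e * rn x.
    rewrite mulrC; exact: (partial_sum_tail (rn_ge0 x) (bd x) (S0P x) hA0 sA).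
  rewrite ger0_norm; first by apply: opnorm_le bdA; exact: ltW.
  exact: opnorm_ge0 bdA.
- exact: opnorm_le.
Qed.

End operator.

(** The coefficients required by the functional calculus are the [transfer_coef], which depend on V
    and the [Q j] only; the state equation at each z shows that they are those of phi. *)
Theorem transfer_schur_agler (phi : 'rV[C]_k -> C) : analytic phi ->
  (forall z, polydisc z -> exists x : X,
     V ((1, \sum_j z 0 j *: Q j x) : hpair C X) = (phi z, x)) ->
  schur_agler phi.
Proof.
move=> an hphi; split=> // K T Tstrict Tcom.
have [r [r0 r1 hr]] : exists r, [/\ 0 <= r, r < 1 & forall i, opnorm (T i) <= r].
  by apply: uniform_lt1 => i; case: (Tstrict i).
have Tr i x : rn (T i x) <= r * rn x.
  have [ci _] := Tstrict i.
  by rewrite (le_trans (le_opnorm x ci))// ler_wpM2r ?rn_ge0.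
have [S [Sc Sf S1]] := transfer_calculus r0 r1 Tr Tcom.
exists S; split => //; exists f => // z zD.
have [x xE] := hphi z zD.
have [s [s0 s1 hs]] := uniform_lt1 ((polydiscE z).1 zD).
exact: (transfer_power_series s0 s1 hs xE).
Qed.

End realization.

(** * Transfer functions *)

Section fixed_point.
Variables (R : realType) (W : completeNormedModType R[i]).

(** Banach's fixed point theorem, used in place of the Neumann series of (I - E(z) D)^-1. *)
Lemma affine_fixed_point (g : W -> W) (r : R) : 0 <= r -> r < 1 ->
  (forall x y, rn (g x - g y) <= r * rn (x - y)) -> exists x, x = g x.
Proof.
move=> r0 r1 hg; have r1' : 0 < 1 - r by rewrite subr_gt0.
(* [B] solves |g 0| + r B = B, hence bounds every iterate, and the n-th tail is at most r^n B. *)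
pose u n := iter n g 0; pose B := rn (g 0) / (1 - r).
have B0 : 0 <= B by rewrite divr_ge0 ?rn_ge0 ?ltW.
have gB : rn (g 0) = B * (1 - r) by rewrite divfK ?gt_eqF.
have uB n : rn (u n) <= B.
  elim: n => [|n ih]; first by rewrite rn0.
  have := hg (u n) 0; rewrite subr0 => h.
  have := rnD (g (u n) - g 0) (g 0); rewrite subrK gB => h2.
  have := ler_wpM2l r0 ih; rewrite /= -/(u n); lra.
have ud n m : rn (u (n + m)%N - u n) <= r ^+ n * B.
  elim: n => [|n ih]; first by rewrite add0n subr0 expr0 mul1r.
  by rewrite addSn /= -!/(u _) (le_trans (hg _ _))// exprS -mulrA ler_wpM2l.
have r_n : (fun n => r ^+ n) @ \oo --> (0 : R) by apply: cvg_expr; rewrite ger0_norm.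
have B1 : 0 < 2 * (B + 1) by rewrite mulr_gt0// ltr_wpDl.
have [l ul] : exists l : W, u @ \oo --> l.
  apply: rn_cauchy_cvg => e e0.
  have /cvgrPdist_lt/(_ _ (divr_gt0 e0 B1))[N _ hN] := r_n.
  exists [set n | (N <= n)%N]; first by exists N.
  have hd n : (N <= n)%N -> rn (u n - u N) < e / 2.
    move=> Nn; rewrite -(subnKC Nn) (le_lt_trans (ud _ _))//.
    have := hN N (leqnn N); rewrite sub0r normrN ger0_norm ?exprn_ge0// ltr_pdivlMr//.
    have := exprn_ge0 N r0; move: (r ^+ N) => t; lra.
  move=> i j /= Ni Nj; have h1 := hd i Ni; have h2 := hd j Nj.
  rewrite rnB in h2; have := rn_tri (u N) (u i) (u j); lra.
exists l; apply: rn_unique => e e0.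
have e20 : 0 < e / 2 by rewrite divr_gt0.
have /cvg_rnP/(_ _ e20)[N _ hN] := ul.
have h1 := hN N.+1 (leqnSn N); have h2 := hN N (leqnn N).
have h3 := hg (u N) l; have := rn_tri (u N.+1) l (g l); rewrite rnB in h2.
have := ler_wpM2r (rn_ge0 (u N - l)) (ltW r1); rewrite mul1r; rewrite /= -/(u N) in h1 *; lra.
Qed.

End fixed_point.

Section hsum_coordinates.
Variables (R : realType) (I : finType) (H : I -> hilbertType R).
Notation C := R[i].

Lemma hsum_rn (x : hsum H) : rn x ^+ 2 = \sum_i rn (x i) ^+ 2.
Proof. by rewrite -Re_ip Re_sum; apply: eq_bigr => i _; rewrite Re_ip. Qed.

Lemma hsumP (x y : hsum H) : (forall i, x i = y i) -> x = y.
Proof. exact: functional_extensionality_dep. Qed.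

Lemma hsumDE (x y : hsum H) i : (x + y) i = x i + y i.
Proof. by []. Qed.
Lemma hsumNE (x : hsum H) i : (- x) i = - x i.
Proof. by []. Qed.
Lemma hsumZE (a : C) (x : hsum H) i : (a *: x) i = a *: x i.
Proof. by []. Qed.
Lemma hsum_sumE J (s : seq J) (P : pred J) (f : J -> hsum H) i :
  (\sum_(j <- s | P j) f j) i = \sum_(j <- s | P j) f j i.
Proof. by elim/big_rec2: _ => // j u v _ <-. Qed.

End hsum_coordinates.

Section transfer_function.
Variables (R : realType) (n : nat) (H : 'I_n -> hilbertType R).
Notation C := R[i].

Lemma diag_opD z (x y : hsum H) : diag_op z (x + y) = diag_op z x + diag_op z y.
Proof. by apply: hsumP => i; rewrite hsumDE /diag_op scalerDr. Qed.
Lemma diag_opZ z a (x : hsum H) : diag_op z (a *: x) = a *: diag_op z x.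
Proof. by apply: hsumP => i; rewrite hsumZE /diag_op !scalerA mulrC. Qed.
Lemma diag_opB z (x y : hsum H) : diag_op z (x - y) = diag_op z x - diag_op z y.
Proof. by apply: hsumP => i; rewrite !hsumDE !hsumNE /diag_op scalerBr. Qed.

Lemma diag_op_bound (z : 'rV[C]_n) (r : R) (x : hsum H) : 0 <= r -> (forall i, rn (z 0 i) <= r) ->
  rn (diag_op z x) <= r * rn x.
Proof.
move=> r0 zr; rewrite -(@ler_pXn2r _ 2)// ?nnegrE ?mulr_ge0 ?rn_ge0//.
rewrite exprMn !hsum_rn mulr_sumr; apply: ler_sum => i _.
rewrite /diag_op rnZ exprMn ler_wpM2r ?exprn_ge0 ?rn_ge0//.
by rewrite lerXn2r ?nnegrE ?rn_ge0.
Qed.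

Variable V : {linear colligation_space H -> colligation_space H}.
Hypothesis V_contr : forall x, rn (V x) <= rn x.

Lemma colligation_snd x y : rn ((V (1, x)).2 - (V (1, y)).2) <= rn (x - y).
Proof.
have -> : (V (1, x)).2 - (V (1, y)).2 = (V ((0, x - y) : colligation_space H)).2.
  rewrite -[LHS]/((V (1, x) - V (1, y)).2) -linearB; congr (V _).2.
  by congr pair; rewrite subrr.
rewrite -rn_sqr_le; apply: (@le_trans _ _ (rn (V ((0, x - y) : colligation_space H)) ^+ 2)).
  by rewrite [leRHS]hpair_rn lerDr exprn_ge0// rn_ge0.
apply: (@le_trans _ _ (rn ((0, x - y) : colligation_space H) ^+ 2)).
  by rewrite rn_sqr_le.
by rewrite hpair_rn /= rn0 expr0n add0r.
Qed.

Lemma state_exists z : polydisc z -> exists x : hsum H, x = diag_op z (V (1, x)).2.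
Proof.
move=> /polydiscE/uniform_lt1[r [r0 r1 zr]].
apply: (affine_fixed_point r0 r1) => x y.
rewrite -diag_opB (le_trans (diag_op_bound _ r0 zr))// ler_wpM2l//.
exact: colligation_snd.
Qed.

(** A solution of x = E(z) (C + D x) satisfies (I - E(z) D) x = E(z) C, so the inverse in the
    transfer function returns x, and a + B x is the scalar output. *)
Lemma transfer_functionE z (x : hsum H) : polydisc z ->
  x = diag_op z (V (1, x)).2 -> transfer_function V z = (V (1, x)).1.
Proof.
move=> /polydiscE/uniform_lt1[r [r0 r1 zr]] xE.
have colligation_columns (y : hsum H) : V (1, y) = V (1, 0) + V (0, y).
  by rewrite -linearD; congr (V _); congr pair; rewrite /= ?addr0 ?add0r.
rewrite /transfer_function /block_a /block_B.
set g := (fun y : hsum H => y - diag_op z (block_D V y)).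
have gE y : g y = y - diag_op z (block_D V y) by [].
have gx : diag_op z (block_C V 1) = g x.
  by apply/esym/eqP; rewrite gE subr_eq -diag_opD; apply/eqP; rewrite [LHS]xE colligation_columns.
rewrite gx pinvKV ?inE//; first by rewrite colligation_columns.
(* Injectivity of I - E(z) D: the difference of two preimages is at most r times itself in norm. *)
move=> y y' _ _ /= gyy'; apply/eqP; rewrite -subr_eq0; apply/eqP/rn_eq0.
have e : y - y' = diag_op z ((V (1, y)).2 - (V (1, y')).2).
  apply/eqP; rewrite (colligation_columns y) (colligation_columns y') /= opprD addrACA subrr add0r.
  rewrite -/(block_D V y) -/(block_D V y') diag_opB.
  rewrite subr_eq; move/eqP: gyy'; rewrite !gE subr_eq => /eqP yE.
  by apply/eqP; rewrite [LHS]yE addrAC [RHS]addrAC (addrC y').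
have h1 : rn (y - y') <= r * rn (y - y').
  rewrite {1}e (le_trans (diag_op_bound _ r0 zr))// ler_wpM2l//.
  exact: colligation_snd.
apply/le_anti; rewrite rn_ge0 andbT.
have : 0 < 1 - r by rewrite subr_gt0.
by have := rn_ge0 (y - y'); nra.
Qed.

End transfer_function.

(** * Factors of a colligation with property F *)

Section coordinate_projection.
Variables (R : realType) (n : nat) (H : 'I_n -> hilbertType R).
Notation C := R[i].

(** The projection is an endomorphism of [hsum H], so the block identities can be stated without
    changing the space. *)
Definition coordp (P : pred 'I_n) (x : hsum H) : hsum H :=
  fun i => if P i then x i else 0.

Lemma coordp_linear P : linear (coordp P).
Proof.
move=> a x y; apply: hsumP => i; rewrite hsumDE hsumZE /coordp.
by case: ifP => //; rewrite scaler0 addr0.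
Qed.

HB.instance Definition _ P := GRing.isLinear.Build C (hsum H) (hsum H) *:%R
  (coordp P) (coordp_linear P).

Lemma coordp_rn P x : rn (coordp P x) ^+ 2 = \sum_(i | P i) rn (x i) ^+ 2.
Proof.
rewrite hsum_rn [RHS]big_mkcond; apply: eq_bigr => i _.
by rewrite /coordp; case: ifP; rewrite // rn0 expr0n.
Qed.

Lemma coordp_le P x : rn (coordp P x) <= rn x.
Proof.
rewrite -rn_sqr_le coordp_rn hsum_rn big_mkcond; apply: ler_sum => i _.
by case: ifP => // _; rewrite exprn_ge0 ?rn_ge0.
Qed.

Lemma hsum_extend_restrict P x : hsum_extend (hsum_restrict (P := P) x) = coordp P x.
Proof.
apply: hsumP => i; rewrite /hsum_extend /coordp.
by destruct (@idP (P i)).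
Qed.

Section coordinates.
Variables (k : nat) (s : 'I_k -> 'I_n).
Hypothesis s_inj : injective s.

(** The k variables go to the positions [s j] and the other coordinates are 0; written with
    [delta_mx], the map is visibly linear, which gives differentiability. *)
Definition embed_vars (z : 'rV[C]_k) : 'rV[C]_n := \sum_j z 0 j *: delta_mx 0 (s j).

Lemma embed_varsE z i : embed_vars z 0 i = \sum_(j | s j == i) z 0 j.
Proof.
rewrite summxE [RHS]big_mkcond; apply: eq_bigr => j _.
by rewrite !mxE eqxx /= eq_sym; case: eqP => _; rewrite ?mulr1 ?mulr0.
Qed.

Lemma embed_vars_in z j : embed_vars z 0 (s j) = z 0 j.
Proof.
rewrite embed_varsE (bigD1 j)//= big1 ?addr0// => i /andP[/eqP/s_inj -> ].
by rewrite eqxx.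
Qed.

Lemma embed_vars_out z i : i \notin codom s -> embed_vars z 0 i = 0.
Proof.
move=> iN; rewrite embed_varsE big1// => j /eqP ji.
by move: iN; rewrite -ji codom_f.
Qed.

Lemma embed_polydisc z : polydisc z -> polydisc (embed_vars z).
Proof.
move=> /polydiscE zD; apply/polydiscE => i.
have [/codomP[j ->]|iN] := boolP (i \in codom s); first by rewrite embed_vars_in.
by rewrite embed_vars_out// rn0.
Qed.

Lemma embed_differentiable z : differentiable embed_vars z.
Proof.
rewrite (_ : embed_vars = \sum_j (fun z : 'rV[C]_k => z 0 j *: delta_mx 0 (s j) : 'rV[C]_n)).
  apply: differentiable_sum => j; apply: differentiableZl.
  exact: differentiable_coord.
by apply/funext => u; rewrite fct_sumE.
Qed.

Lemma embed_analytic (f : 'rV[C]_n -> C) (c : C) :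
  analytic f -> analytic (fun z => c * f (embed_vars z)).
Proof.
move=> fan z zD.
apply: (@differentiableZ _ _ _ (f \o embed_vars) c).
apply: differentiable_comp; first exact: embed_differentiable.
exact/fan/embed_polydisc.
Qed.

Definition coordj (j : 'I_k) : {linear hsum H -> hsum H} := coordp (pred1 (s j)).

Lemma coordj_ortho i j x y : i != j -> inner (coordj i x) (coordj j y) = 0.
Proof.
move=> ij; apply: big1 => l _; rewrite /coordj /= /coordp /=.
case: eqP => [->|_]; last by rewrite ip0l.
by rewrite (inj_eq s_inj) (negbTE ij) ip0r.
Qed.

Lemma coordj_bessel x : \sum_j rn (coordj j x) ^+ 2 <= rn x ^+ 2.
Proof.
rewrite hsum_rn (eq_bigr (fun j => rn (x (s j)) ^+ 2)); last first.
  by move=> j _; rewrite coordp_rn big_pred1_eq.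
rewrite -(big_map s xpredT (fun i => rn (x i) ^+ 2)).
rewrite big_uniq/=; last by rewrite (map_inj_uniq s_inj) index_enum_uniq.
rewrite big_mkcond; apply: ler_sum => i _.
by case: ifP => // _; rewrite exprn_ge0 ?rn_ge0.
Qed.

Lemma diag_coordj (z : 'rV[C]_k) (x : hsum H) : \sum_j z 0 j *: coordj j x = diag_op (embed_vars z) x.
Proof.
apply: hsumP => i; rewrite hsum_sumE /diag_op embed_varsE scaler_suml.
rewrite [RHS]big_mkcond; apply: eq_bigr => j _.
rewrite hsumZE /coordj /= /coordp /= eq_sym.
by case: eqP => // _; rewrite scaler0.
Qed.

End coordinates.
End coordinate_projection.

Section factor.
Variables (R : realType) (m n : nat) (lt_mn : (m < n)%N).
Variable H : 'I_n -> hilbertType R.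
Notation C := R[i].
Local Open Scope complex_scope.
Variable V : {linear colligation_space H -> colligation_space H}.
Hypothesis V_iso : isometric V.
Hypothesis V_F : property_F m V.

Definition lo_var (j : 'I_m) : 'I_n := widen_ord (ltnW lt_mn) j.
Definition hi_var (j : 'I_(n - m)) : 'I_n := cast_ord (subnKC (ltnW lt_mn)) (rshift m j).

Lemma lo_inj : injective lo_var.
Proof. by move=> i j /(congr1 val) /= ij; apply: val_inj. Qed.
Lemma hi_inj : injective hi_var.
Proof. by move=> i j /(congr1 val) /= /addnI ij; apply: val_inj. Qed.

Lemma codom_lo (i : 'I_n) : (i \in codom lo_var) = lo m i.
Proof.
apply/codomP/idP => [[j ->]|im]; first by rewrite /lo /= ltn_ord.
by exists (Ordinal im); apply: val_inj.
Qed.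

Lemma codom_hi (i : 'I_n) : (i \in codom hi_var) = hi m i.
Proof.
apply/codomP/idP => [[j ->]|im]; first by rewrite /hi /= leq_addr.
have h : (i - m < n - m)%N by rewrite ltn_sub2r.
by exists (Ordinal h); apply: val_inj; rewrite /= subnKC.
Qed.

Lemma hi_loN (i : 'I_n) : hi m i = ~~ lo m i.
Proof. by rewrite /hi /lo -leqNgt. Qed.

Lemma first_varsE (z : 'rV[C]_n) j : first_vars lt_mn z 0 j = z 0 (lo_var j).
Proof. by rewrite mxE. Qed.
Lemma last_varsE (z : 'rV[C]_n) j : last_vars lt_mn z 0 j = z 0 (hi_var j).
Proof. by rewrite mxE. Qed.

Let Plo := @coordp R n H (lo m).
Let Phi := @coordp R n H (hi m).

Lemma lo_plus_hi x : Plo x + Phi x = x.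
Proof.
apply: hsumP => i; rewrite hsumDE /Plo /Phi /coordp hi_loN.
by case: (lo m i); rewrite /= ?addr0 ?add0r.
Qed.

Lemma rn_lo_hi x : rn x ^+ 2 = rn (Plo x) ^+ 2 + rn (Phi x) ^+ 2.
Proof.
rewrite !coordp_rn hsum_rn (bigID (lo m))/=; congr (_ + _).
by apply: eq_bigl => i; rewrite hi_loN.
Qed.

Lemma diag_embed_lo z x : diag_op (embed_vars lo_var z) x =
  diag_op (embed_vars lo_var z) (Plo x).
Proof.
apply: hsumP => i; rewrite /diag_op /Plo /coordp.
case: ifPn => // /negP; rewrite -codom_lo => /negP iN.
by rewrite embed_vars_out// !scale0r.
Qed.

Lemma diag_embed_hi z x : diag_op (embed_vars hi_var z) x =
  diag_op (embed_vars hi_var z) (Phi x).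
Proof.
apply: hsumP => i; rewrite /diag_op /Phi /coordp.
case: ifPn => // /negP; rewrite -codom_hi => /negP iN.
by rewrite embed_vars_out// !scale0r.
Qed.

Lemma Plo_diag z x : Plo (diag_op (embed_vars lo_var z) x) = diag_op (embed_vars lo_var z) x.
Proof.
apply: hsumP => i; rewrite /diag_op /Plo /coordp.
case: ifPn => // /negP; rewrite -codom_lo => /negP iN.
by rewrite embed_vars_out// !scale0r.
Qed.

Lemma Phi_diag z x : Phi (diag_op (embed_vars hi_var z) x) = diag_op (embed_vars hi_var z) x.
Proof.
apply: hsumP => i; rewrite /diag_op /Phi /coordp.
case: ifPn => // /negP; rewrite -codom_hi => /negP iN.
by rewrite embed_vars_out// !scale0r.
Qed.

Lemma diag_split z x y : diag_op z (Plo x + Phi y) =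
  diag_op (embed_vars lo_var (first_vars lt_mn z)) x +
  diag_op (embed_vars hi_var (last_vars lt_mn z)) y.
Proof.
apply: hsumP => i; rewrite !hsumDE /diag_op !hsumDE /Plo /Phi /coordp.
have := codom_hi i; have := codom_lo i; rewrite hi_loN.
case: (lo m i) => /= iN.
  move=> iN'; rewrite (embed_vars_out (s := hi_var)) ?iN'// scale0r !addr0.
  by have /codomP[j ->] := iN; rewrite embed_vars_in ?first_varsE//; exact: lo_inj.
move=> iN'; rewrite (embed_vars_out (s := lo_var)) ?iN// scale0r !add0r.
by have /codomP[j ->] := iN'; rewrite embed_vars_in ?last_varsE//; exact: hi_inj.
Qed.

Let a : C := (V (1, 0)).1.
Let Cv : hsum H := (V (1, 0)).2.
Hypothesis a0 : a != 0.

Lemma colligation_rn x : rn (V x) = rn x.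
Proof. by rewrite /rn V_iso.2. Qed.

Lemma colligation_columns (c : C) (x : hsum H) : V (c, x) = c *: V (1, 0) + V (0, x).
Proof.
rewrite -linearZ -linearD; congr (V _).
by congr pair; rewrite /= ?[c *: _]mulr1 ?addr0 ?scaler0 ?add0r.
Qed.

(** The form in which D_21 = 0 is used: a state in H_1^m contributes nothing to the output in
    H_(m+1)^n. *)
Lemma state_hi_of_lo c x : Phi (V (c, Plo x)).2 = c *: Phi Cv.
Proof.
have [h _] := V_F; rewrite colligation_columns [(_ + _).2]/= /Phi linearD linearZ/= -[RHS]addr0.
congr (_ + _); have := h (hsum_restrict x); rewrite /block_D21 /block_D.
rewrite hsum_extend_restrict -/(Plo x) => hx.
by rewrite -hsum_extend_restrict hx; apply: hsumP => i; rewrite /hsum_extend; destruct (@idP (hi m i)).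
Qed.

(** The form in which a D_12 = C_1 B_2 is used: after division by a, the output c C_1 + D_12 x is
    the scalar output c a + B_2 x over a, times C_1. *)
Lemma state_lo_of_hi c x : Plo (V (c, Phi x)).2 = (a^-1 * (V (c, Phi x)).1) *: Plo Cv.
Proof.
have [_ h] := V_F; have := h (hsum_restrict x).
rewrite /block_D12 /block_C1 /block_C /block_B2 /block_D /block_B.
rewrite hsum_extend_restrict -/(Phi x) => hx.
have hx' : a *: Plo (V (0, Phi x)).2 = (V (0, Phi x)).1 *: Plo Cv.
  apply: hsumP => i; rewrite !hsumZE /Plo /coordp.
  case: (boolP (lo m i)) => [li|_]; last by rewrite !scaler0.
  have := congr1 (fun g : hsubsum H (lo m) => g (exist _ i li)) hx.
  have V00 : V (0, 0) = 0 by exact: linear0.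
  by rewrite /hsum_restrict /= (colligation_columns (V (0, Phi x)).1 0) V00 addr0.
rewrite colligation_columns [(_ + _).2]/= [(_ + _).1]/= /Plo linearD linearZ/= -/Plo.
rewrite mulrDr scalerDl; congr (_ + _).
  by congr (_ *: _); rewrite -[c *: _]/(c * a) mulrCA mulVf ?mulr1.
by rewrite -scalerA -hx' scalerA mulVf ?scale1r.
Qed.

Let b : R := Num.sqrt (rn a ^+ 2 + rn (Plo Cv) ^+ 2).

Lemma a_rn_gt0 : 0 < rn a.
Proof. by rewrite lt_def rn_ge0 andbT; apply: contra a0 => /eqP/rn_eq0->. Qed.

Lemma b_sqr : b ^+ 2 = rn a ^+ 2 + rn (Plo Cv) ^+ 2.
Proof. by rewrite sqr_sqrtr// addr_ge0// exprn_ge0 ?rn_ge0. Qed.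

Lemma b_gt0 : 0 < b.
Proof. by rewrite sqrtr_gt0 ltr_pwDl ?exprn_gt0 ?a_rn_gt0 ?exprn_ge0 ?rn_ge0. Qed.

Lemma first_column : b ^+ 2 + rn (Phi Cv) ^+ 2 = 1.
Proof.
rewrite b_sqr -addrA -rn_lo_hi -[rn a ^+ 2 + _]/(rn (V (1, 0)).1 ^+ 2 + rn (V (1, 0)).2 ^+ 2).
by rewrite -hpair_rn colligation_rn hpair_rn /= rn0 expr0n addr0 rn1 expr1n.
Qed.

(* V is the product of [left_map] and [right_map], each completed by the identity. *)
Definition left_map (p : hpair C (hsum H)) : hpair C (hsum H) :=
  let q := V ((b^-1)%:C * p.1, Plo p.2) in (q.1, Plo q.2).

Definition right_map (p : hpair C (hsum H)) : hpair C (hsum H) :=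
  let q := V (p.1, Phi p.2) in (b%:C / a * q.1, Phi q.2).

Lemma left_map_linear : linear left_map.
Proof.
move=> c p q; rewrite /left_map.
have -> : ((b^-1)%:C * (c *: p + q).1, Plo (c *: p + q).2) =
   c *: (((b^-1)%:C * p.1, Plo p.2) : colligation_space H) + ((b^-1)%:C * q.1, Plo q.2).
  congr pair; last by rewrite /Plo linearP.
  by rewrite /= mulrDr; congr (_ + _); exact: mulrCA.
by rewrite linearP; congr pair; rewrite /Plo linearP.
Qed.

Lemma right_map_linear : linear right_map.
Proof.
move=> c p q; rewrite /right_map.
have -> : ((c *: p + q).1, Phi (c *: p + q).2) =
   c *: ((p.1, Phi p.2) : colligation_space H) + (q.1, Phi q.2).
  by congr pair; rewrite /Phi linearP.
rewrite linearP; congr pair; last by rewrite /Phi linearP.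
by rewrite /= mulrDr; congr (_ + _); exact: mulrCA.
Qed.

(** Isometric on C and H_1^m together: V preserves the norm of (c / b, x), and by [state_hi_of_lo]
    the discarded part is (c / b) C_2. What remains of the scalar term is |c|^2 (1 - |C_2|^2) / b^2,
    equal to |c|^2 by [first_column]. *)
Lemma left_map_contr p : rn (left_map p) <= rn p.
Proof.
rewrite -rn_sqr_le; apply: (@le_trans _ _ (rn p.1 ^+ 2 + rn (Plo p.2) ^+ 2)); last first.
  by rewrite [leRHS]hpair_rn lerD2l rn_sqr_le coordp_le.
rewrite /left_map; set q := V _.
have := congr1 (fun t => t ^+ 2) (colligation_rn ((b^-1)%:C * p.1, Plo p.2)); rewrite -/q /=.
rewrite !hpair_rn /= rnM rnC ger0_norm ?invr_ge0 ?(ltW b_gt0)//.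
rewrite (rn_lo_hi q.2) state_hi_of_lo rnZ rnM rnC ger0_norm ?invr_ge0 ?(ltW b_gt0)//.
rewrite !exprMn => h; rewrite [leLHS](_ : _ = rn p.1 ^+ 2 + rn (Plo p.2) ^+ 2)//.
have e : b^-1 ^+ 2 = 1 + b^-1 ^+ 2 * rn (Phi Cv) ^+ 2.
  have := first_column; move: b_gt0 => b0 e.
  have -> : rn (Phi Cv) ^+ 2 = 1 - b ^+ 2 by rewrite -e; ring.
  by field; rewrite gt_eqF.
move: h; rewrite [X in _ = X * _ + _]e => h.
have -> : rn q.1 ^+ 2 + rn (Plo q.2) ^+ 2 =
  (rn q.1 ^+ 2 + (rn (Plo q.2) ^+ 2 + b^-1 ^+ 2 * rn p.1 ^+ 2 * rn (Phi Cv) ^+ 2)) -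
   b^-1 ^+ 2 * rn p.1 ^+ 2 * rn (Phi Cv) ^+ 2 by ring.
by rewrite h; ring.
Qed.

(** The discarded part is (s / a) C_1 with s the scalar output, and |s|^2 + |s / a|^2 |C_1|^2 =
    |s|^2 b^2 / |a|^2: the factor b / a on the scalar output compensates exactly. *)
Lemma right_map_contr p : rn (right_map p) <= rn p.
Proof.
rewrite -rn_sqr_le; apply: (@le_trans _ _ (rn p.1 ^+ 2 + rn (Phi p.2) ^+ 2)); last first.
  by rewrite [leRHS]hpair_rn lerD2l rn_sqr_le coordp_le.
rewrite /right_map; set q := V _.
have := congr1 (fun t => t ^+ 2) (colligation_rn (p.1, Phi p.2)); rewrite -/q /=.
rewrite !hpair_rn /= (rn_lo_hi q.2) state_lo_of_hi -/q => <-.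
have ra := a_rn_gt0.
have rV : rn a^-1 = (rn a)^-1.
  apply: (mulfI (lt0r_neq0 ra)); rewrite -rnM divff// rn1 divff// gt_eqF//.
rewrite rnM rnM rnZ rnM rV rnC ger0_norm ?(ltW b_gt0)// addrA lerD2r.
rewrite le_eqVlt; apply/orP; left; apply/eqP.
rewrite !exprMn b_sqr; field; rewrite gt_eqF//.
Qed.

Variable theta : 'rV[C]_n -> C.
Hypothesis theta_an : analytic theta.
Hypothesis theta_tau : forall z, polydisc z -> theta z = transfer_function V z.

Lemma theta_state z : polydisc z -> exists2 x : hsum H,
  x = diag_op z (V (1, x)).2 & theta z = (V (1, x)).1.
Proof.
move=> zD; have Vc x : rn (V x) <= rn x by rewrite colligation_rn.
have [x xE] := state_exists Vc zD; exists x => //.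
by rewrite theta_tau// (transfer_functionE Vc zD xE).
Qed.

Definition left_factor (z : 'rV[C]_m) : C := (b^-1)%:C * theta (embed_vars lo_var z).
Definition right_factor (w : 'rV[C]_(n - m)) : C := b%:C / a * theta (embed_vars hi_var w).

Lemma left_factor_SA : schur_agler left_factor.
Proof.
apply: (@transfer_schur_agler R m (hsum H) (mklin left_map_linear) left_map_contr
  (coordj H lo_var) (coordj_ortho lo_inj) (coordj_bessel lo_inj)).
  exact: (embed_analytic lo_inj).
move=> z zD; have [x xE tE] := theta_state (embed_polydisc lo_inj zD).
(* [left_map] divides the scalar input by b, so the state is divided by b as well and linearity
   returns V (1, x) / b. *)
exists ((b^-1)%:C *: Plo (V (1, x)).2).
rewrite diag_coordj diag_opZ -diag_embed_lo -xE /= /left_map /=.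
have -> : ((b^-1)%:C * 1, Plo ((b^-1)%:C *: x)) = (b^-1)%:C *: ((1, x) : colligation_space H).
  have Px : Plo x = x by rewrite [in LHS]xE Plo_diag -xE.
  by rewrite -[in RHS]Px; congr pair; rewrite /Plo linearZ.
by rewrite linearZ; congr pair; rewrite /left_factor ?tE // /Plo linearZ.
Qed.

Lemma right_factor_SA : schur_agler right_factor.
Proof.
apply: (@transfer_schur_agler R (n - m) (hsum H) (mklin right_map_linear) right_map_contr
  (coordj H hi_var) (coordj_ortho hi_inj) (coordj_bessel hi_inj)).
  exact: (embed_analytic hi_inj).
move=> z zD; have [x xE tE] := theta_state (embed_polydisc hi_inj zD).
exists (Phi (V (1, x)).2).
rewrite diag_coordj -diag_embed_hi -xE /= /right_map /=.
have Px : Phi x = x by rewrite [in LHS]xE Phi_diag -xE.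
by rewrite Px /right_factor tE.
Qed.

Lemma factorization z : polydisc z ->
  theta z = left_factor (first_vars lt_mn z) * right_factor (last_vars lt_mn z).
Proof.
move=> zD; have /polydiscE zD' := zD.
have z1D : polydisc (first_vars lt_mn z) by apply/polydiscE => i; rewrite first_varsE.
have z2D : polydisc (last_vars lt_mn z) by apply/polydiscE => i; rewrite last_varsE.
have [x1 x1E t1] := theta_state (embed_polydisc lo_inj z1D).
have [x2 x2E t2] := theta_state (embed_polydisc hi_inj z2D).
set q1 := V (1, x1) in x1E t1; set q2 := V (1, x2) in x2E t2.
have Px1 : Plo x1 = x1 by rewrite x1E Plo_diag.
have Px2 : Phi x2 = x2 by rewrite x2E Phi_diag.
(* The scalar input of the first factor should be theta(0, w) / a. The scalar output of V at
   [s *: x1 + x2] is then s theta(z, 0) + theta(0, w) - s a = s theta(z, 0). *)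
pose s := a^-1 * q2.1.
have Vx : V (1, s *: x1 + x2) = s *: q1 + q2 - s *: V (1, 0).
  rewrite -!linearZ -linearD -linearB; congr (V _); congr pair => /=.
    by rewrite addrAC subrr add0r.
  by rewrite scaler0 subr0.
(* By the two block identities the H_1^m part of [q2] and the H_(m+1)^n part of [s *: q1] are those
   of s V (1, 0), so the subtraction removes them. *)
have x_fix : s *: x1 + x2 = diag_op z (V (1, s *: x1 + x2)).2.
  have -> : (V (1, s *: x1 + x2)).2 = Plo (s *: q1.2) + Phi q2.2.
    rewrite Vx -[LHS]lo_plus_hi /Plo /Phi !linearB !linearD !linearZ/= -/Plo -/Phi.
    have := state_hi_of_lo 1 x1; have := state_lo_of_hi 1 x2.
    rewrite Px1 Px2 -/q1 -/q2 -/s => -> ->; rewrite scale1r.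
    rewrite !scalerN; congr (_ + _); first by rewrite addrK.
    by rewrite addrAC subrr add0r.
  by rewrite diag_split diag_opZ -x1E -x2E.
have Vc x : rn (V x) <= rn x by rewrite colligation_rn.
rewrite theta_tau// (transfer_functionE Vc zD x_fix) Vx.
rewrite -[LHS]/(s * q1.1 + q2.1 - s * a) /left_factor /right_factor t1 t2.
have bC : b%:C != 0 by rewrite -[0]/(0%:C) (inj_eq (@complexI _)) gt_eqF ?b_gt0.
rewrite /s fmorphV; field.
by apply/andP; split; [exact: a0|exact: bC].
Qed.

End factor.

(** * Separation and projection in Hilbert spaces *)

Section best_approximation.
Variables (R : realType) (H : hilbertType R).
Notation C := R[i].
Local Open Scope complex_scope.

(** The closure of S, stated with real radii. *)
Definition near_set (S : set H) : set H :=
  [set y | forall e : R, 0 < e -> exists2 x, S x & rn (y - x) < e].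

(** First-order condition at a minimum of the norm: divide |v - t y|^2 - |v|^2 by t and make t
    small. *)
Lemma Re_ip_variation (v y : H) :
  (forall t : R, 0 < t -> t <= 1 -> rn v <= rn (v - t%:C *: y)) ->
  complex.Re (inner v y) <= 0.
Proof.
move=> h; rewrite leNgt; apply/negP => g0; set g := complex.Re _ in g0.
have ht t : 0 < t -> t <= 1 -> 2 * g <= t * rn y ^+ 2.
  move=> t0 t1; have := h t t0 t1; rewrite -rn_sqr_le rn2B ipZr conjCE conjc_real cReZ.
  rewrite rnZ rnC (ger0_norm (ltW t0)) -/g => h1.
  by rewrite -(ler_pM2l t0); move: h1; rewrite exprMn expr2; lra.
have y2 : 0 <= rn y ^+ 2 by rewrite exprn_ge0// rn_ge0.
pose t := Num.min 1 (g / (rn y ^+ 2 + 1)).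
have y21 : 0 < rn y ^+ 2 + 1 by rewrite ltr_wpDl.
have t0 : 0 < t by rewrite lt_min ltr01 divr_gt0.
have t1 : t <= 1 by rewrite ge_min lexx.
have t2 : t * (rn y ^+ 2 + 1) <= g by rewrite -ler_pdivlMr// ge_min lexx orbT.
have := ht t t0 t1; move: t2; lra.
Qed.

(** Near-minimizers form a filter, which is Cauchy by the parallelogram law applied to midpoints. *)
Lemma best_approximation (S : set H) (M : H) : S !=set0 ->
  (forall x y, S x -> S y -> S ((2^-1)%:C *: (x + y))) ->
  exists2 p, near_set S p & forall y, near_set S y -> rn (M - p) <= rn (M - y).
Proof.
move=> [x0 Sx0] Smid.
pose D := [set rn (M - x) | x in S]; pose d := inf D.
have lbD : has_lbound D by exists 0 => _ [x _ <-]; exact: rn_ge0.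
have infD : has_inf D by split=> //; exists (rn (M - x0)), x0.
have dS x : S x -> d <= rn (M - x) by move=> Sx; apply: ge_inf => //; exists x.
have d0 : 0 <= d by apply: lb_le_inf; [case: infD|move=> _ [x _ <-]; exact: rn_ge0].
pose B (e : R) := [set x | S x /\ rn (M - x) < d + e].
pose F := filter_from [set e : R | 0 < e] B.
have FF : ProperFilter F.
  apply: filter_from_proper.
    apply: filter_from_filter; first by exists 1; rewrite /= ltr01.
    move=> e1 e2 /= h1 h2; exists (Num.min e1 e2); first by rewrite /= lt_min h1.
    move=> x [Sx hx]; split; split => //; apply: (lt_le_trans hx); rewrite lerD2l.
      by rewrite ge_min lexx.
    by rewrite ge_min lexx orbT.
  move=> e /= e0; have [_ [x Sx <-] hx] := inf_adherent e0 infD.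
  by exists x.
have [p /cvg_rnP hp] : exists p : H, id @ F --> p.
  apply: rn_cauchy_cvg => e e0.
  (* The parallelogram law gives |x - y|^2 <= 4 (d + t)^2 - 4 d^2 <= (8 d + 4) t for t <= 1,
     strictly below c t. *)
  pose c := 8 * d + 5; have c0 : 0 < c by rewrite /c; lra.
  have [t [t0 t1 tc]] : exists t, [/\ 0 < t, t <= 1 & t * c <= e ^+ 2].
    exists (Num.min 1 (e ^+ 2 / c)); split.
    - by rewrite lt_min ltr01 divr_gt0// exprn_gt0.
    - by rewrite ge_min lexx.
    - by rewrite -ler_pdivlMr// ge_min lexx orbT.
  exists (B t); first by exists t.
  move=> x y [Sx hx] [Sy hy].
  rewrite -(@ltr_pXn2r _ 2)// ?nnegrE ?rn_ge0 ?ltW//.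
  have := parallelogram (M - x) (M - y).
  have -> : (M - x) + (M - y) = 2%:C *: (M - (2^-1)%:C *: (x + y)).
    rewrite scalerBr scalerA -rmorphM /= divff ?pnatr_eq0// scale1r.
    rewrite addrACA -opprD; congr (_ - _).
    by rewrite (rmorph_nat (real_complex R) 2) scaler_nat mulr2n.
  have -> : M - x - (M - y) = - (x - y) by rewrite !opprB addrC addrA subrK.
  rewrite rnN rnZ rnC ger0_norm// exprMn.
  have := dS _ (Smid _ _ Sx Sy).
  move: (rn (M - _ *: _)) (rn (x - y)) (rn_ge0 (M - x)) (rn_ge0 (M - y)) hx hy.
  move: (rn (M - x)) (rn (M - y)) => a b u v a0 b0 ha hb hu.
  have : d ^+ 2 <= u ^+ 2 by rewrite lerXn2r ?nnegrE// (le_trans d0).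
  have dt0 : 0 <= d + t by rewrite addr_ge0// ltW.
  have : a ^+ 2 <= (d + t) ^+ 2 by rewrite lerXn2r ?nnegrE// ltW.
  have : b ^+ 2 <= (d + t) ^+ 2 by rewrite lerXn2r ?nnegrE// ltW.
  have tt : t * t <= t by rewrite -[leRHS]mulr1 ler_wpM2l// ltW.
  move: tc; rewrite /c; nra.
have pS : near_set S p.
  move=> e e0; have [t t0 ht] := hp _ e0.
  have [x Bx] := filter_ex (ex_intro2 _ _ t t0 (@subset_refl _ (B t)) : F (B t)).
  by exists x; [case: Bx|exact: ht].
have pd : rn (M - p) <= d.
  apply/ler_addgt0Pl => e e0; have e20 : 0 < e / 2 by rewrite divr_gt0.
  have : F (B (e / 2)) by exists (e / 2).
  move=> /(filterI (hp _ e20))/filter_ex[x [h1 [_ h2]]].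
  have := rn_tri x M p; rewrite [rn (x - p)]rnB; move: h1 h2; rewrite /=; lra.
exists p => // y yS; apply: (le_trans pd); apply/ler_addgt0Pl => e e0.
have [x Sx hx] := yS e e0; rewrite (le_trans (dS x Sx))//.
by have := rn_tri y M x; move: hx; lra.
Qed.

(** With p the point of the closed cone nearest to M, the separator is p - M. Moving p by a cone
    element gives the first inequality, shrinking p towards 0 the second. *)
Lemma cone_separation (S : set H) (M : H) : S 0 ->
  (forall x y, S x -> S y -> S (x + y)) ->
  (forall (t : R) x, 0 < t -> S x -> S (t%:C *: x)) ->
  near_set S M \/
  exists w, (forall x, S x -> 0 <= complex.Re (inner x w)) /\
            complex.Re (inner M w) < 0.
Proof.
move=> S0 Sadd Ssc.
have [||p pS pmin] := @best_approximation S M; first by exists 0.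
  by move=> x y Sx Sy; apply: Ssc; rewrite ?invr_gt0//; exact: Sadd.
have [->|pM] := eqVneq M p; first by left.
right; exists (p - M); split=> [x Sx|].
  have h : complex.Re (inner (M - p) x) <= 0.
    apply: Re_ip_variation => t t0 _; rewrite -addrA -opprD; apply: pmin => e e0.
    have [y Sy hy] := pS e e0; exists (y + t%:C *: x).
      by apply: Sadd => //; exact: Ssc.
    by rewrite opprD addrACA subrr addr0.
  by rewrite ipC cRe_conj -opprB ipNl cReN oppr_ge0.
have h : complex.Re (inner (M - p) (- p)) <= 0.
  (* The case t = 1 is treated apart because [Ssc] scales by positive numbers only; there the
     competitor is 0. *)
  apply: Re_ip_variation => t t0; rewrite le_eqVlt => /orP[/eqP ->|t1].
    rewrite scale1r opprK subrK -[in leRHS](subr0 M); apply: pmin => e e0.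
    by exists 0 => //; rewrite subrr rn0.
  rewrite -addrA -opprD; apply: pmin => e e0.
  have t1' : 0 < 1 - t by rewrite subr_gt0.
  have [y Sy hy] := pS e e0; exists ((1 - t)%:C *: y); first exact: Ssc.
  have -> : p + t%:C *: - p - (1 - t)%:C *: y = (1 - t)%:C *: (p - y).
    by rewrite scalerBr [in (1 - t)%:C *: p]rmorphB scalerBl scale1r scalerN.
  rewrite rnZ rnC ger0_norm ?ltW//; apply: le_lt_trans hy.
  by rewrite -[leRHS]mul1r ler_wpM2r ?rn_ge0// lerBlDr lerDl ltW.
have Mp0 : 0 < rn (M - p) ^+ 2.
  rewrite exprn_gt0// lt_def rn_ge0 andbT; apply: contra pM => /eqP/rn_eq0/eqP.
  by rewrite subr_eq0.
have -> : inner M (p - M) = inner (M - p) (p - M) + inner p (p - M).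
  by rewrite -ipDl subrK.
rewrite -[p - M]opprB !ipNr cReD !cReN Re_ip [inner p _]ipC cRe_conj.
by move: h Mp0; rewrite ipNr cReN; lra.
Qed.

(** In a subspace the variations x, - x and i x are all allowed, so the full complex inner product
    vanishes. *)
Lemma orthogonal_projection (S : set H) (M : H) : S 0 ->
  (forall (a : C) x y, S x -> S y -> S (a *: x + y)) ->
  exists2 p, near_set S p & forall x, S x -> inner x (M - p) = 0.
Proof.
move=> S0 Slin.
have [||p pS pmin] := @best_approximation S M; first by exists 0.
  by move=> x y Sx Sy; rewrite -[_ *: _]addr0; apply: (Slin _ (x + y)) => //; rewrite -[x]scale1r; exact: Slin.
exists p => //.
have h x : S x -> complex.Re (inner (M - p) x) <= 0.
  move=> Sx; apply: Re_ip_variation => t t0 _; rewrite -addrA -opprD; apply: pmin => e e0.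
  have [y Sy hy] := pS e e0; exists (t%:C *: x + y); first exact: Slin.
  by rewrite [_ *: _ + _]addrC opprD addrACA subrr addr0.
have h2 x : S x -> complex.Re (inner (M - p) x) = 0.
  move=> Sx; apply/le_anti; rewrite h//= -oppr_le0 -cReN -ipNr; apply: h.
  by rewrite -[- x]addr0 -scaleN1r; apply: Slin.
move=> x Sx; rewrite ipC.
have h3 := h2 _ Sx; have Six : S ('i *: x) by rewrite -[_ *: _]addr0; exact: Slin.
have := h2 _ Six; rewrite ipZr conjCE; move: h3; case: (inner _ _) => a b /= ->.
by rewrite mul0r mulN1r sub0r opprK => ->; rewrite conjCE /= oppr0.
Qed.

End best_approximation.

(** * The Hilbert space of a positive definite matrix *)

Section gram_space.
Variables (R : realType) (N : nat) (G : 'I_N -> 'I_N -> R[i]) (c : R).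
Notation C := R[i].
Local Open Scope complex_scope.
Notation W := (hsum (fun _ : 'I_N => (R[i] : hilbertType R))).

Definition gram_form (x y : W) : C := \sum_i \sum_j x i * Num.conj (y j) * G i j.

Hypothesis G_herm : forall i j, G i j = Num.conj (G j i).
Hypothesis c0 : 0 < c.
Hypothesis G_pos : forall x, c * rn x ^+ 2 <= complex.Re (gram_form x x).

(* The proofs are made parameters of the type because the instances need them. *)
Definition gram_space : Type := let _ := (G_herm, c0, G_pos) in W.

HB.instance Definition _ := GRing.Lmodule.copy gram_space W.

Definition gram_inner (x y : gram_space) : C := gram_form x y.

Fact gram_inner_bilinear : bilinear_for
  (GRing.Scale.Law.clone _ _ ( *%R ) _)
  (GRing.Scale.Law.clone _ _ (conjC \; *%R ) _) gram_inner.
Proof.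
split=> [u'|u] a x y; rewrite /gram_inner /gram_form /=.
  rewrite mulr_sumr -big_split; apply: eq_bigr => i _ /=.
  rewrite mulr_sumr -big_split; apply: eq_bigr => j _ /=.
  rewrite -[(a *: x + y) i]/(a * x i + y i); ring.
rewrite mulr_sumr -big_split; apply: eq_bigr => i _ /=.
rewrite mulr_sumr -big_split; apply: eq_bigr => j _ /=.
by rewrite -[(a *: x + y) j]/(a * x j + y j) rmorphD rmorphM/=; ring.
Qed.

HB.instance Definition _ := bilinear_isBilinear.Build C
  gram_space gram_space C
  ( *%R ) (conjC \; *%R ) gram_inner gram_inner_bilinear.

Fact gram_inner_hermitian x y :
  gram_inner x y = (-1) ^+ false * Num.conj (gram_inner y x).
Proof.
rewrite mul1r /gram_inner /gram_form rmorph_sum exchange_big/=.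
apply: eq_bigr => i _; rewrite rmorph_sum; apply: eq_bigr => j _ /=.
by rewrite G_herm !rmorphM/= conjCK; ring.
Qed.

HB.instance Definition _ := isHermitianSesquilinear.Build C gram_space
  false conjC gram_inner gram_inner_hermitian.

Lemma gram_inner_real x : gram_inner x x = (complex.Re (gram_inner x x))%:C.
Proof.
rewrite RRe_real//; apply/CrealP.
by rewrite {2}gram_inner_hermitian mul1r.
Qed.

Fact gram_inner_gt0 x : x != 0 -> 0 < gram_inner x x.
Proof.
move=> x0; rewrite gram_inner_real ltcR (lt_le_trans _ (G_pos x))//.
rewrite mulr_gt0// exprn_gt0// lt_def rn_ge0 andbT.
by apply: contra x0 => /eqP/(@rn_eq0 _ W) ->.
Qed.

HB.instance Definition _ := isDotProduct.Build C gram_space gram_inner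
  gram_inner_gt0.

HB.instance Definition _ := @Lmodule_isNormed.Build C gram_space
  (dot_norm gram_inner) (dot_normD gram_inner)
  (dot_normZ gram_inner) (@dot_norm0_eq0 _ _ gram_inner).

Lemma gram_rn2 (x : gram_space) : rn x ^+ 2 = complex.Re (gram_form x x).
Proof.
apply: complexI; rewrite -gram_inner_real rmorphXn /= -rnE.
exact: (sqr_dot_norm gram_inner).
Qed.

Lemma gram_rn_lower (x : gram_space) : c * rn (x : W) ^+ 2 <= rn x ^+ 2.
Proof. by rewrite gram_rn2. Qed.

Definition gram_bound : R := \sum_i \sum_j rn (G i j).

Lemma gram_form_bound (x : W) : rn (gram_form x x) <= gram_bound * rn x ^+ 2.
Proof.
rewrite (le_trans (rn_sum _ _ _))// mulr_suml; apply: ler_sum => i _.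
rewrite (le_trans (rn_sum _ _ _))// mulr_suml; apply: ler_sum => j _.
have h l : rn (x l) <= rn x.
  by rewrite -rn_sqr_le hsum_rn (bigD1 l)//= lerDl sumr_ge0// => *; rewrite exprn_ge0// rn_ge0.
rewrite rnM rnM rn_conj mulrC ler_wpM2l ?rn_ge0// expr2.
by rewrite ler_pM ?rn_ge0.
Qed.

Lemma gram_rn_upper (x : gram_space) : rn x ^+ 2 <= gram_bound * rn (x : W) ^+ 2.
Proof. by rewrite gram_rn2 (le_trans (Re_le_rn _))// gram_form_bound. Qed.

(** [gram_rn_lower] and [gram_rn_upper] make the norm equivalent to that of W, whose completeness is
    inherited. *)
Lemma gram_cauchy_cvg (F : set_system gram_space) :
  ProperFilter F -> cauchy F -> cvg F.
Proof.
move=> FF /cauchy_ballP Fc.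
have [l hl] : exists l : W, (id : gram_space -> W) @ F --> l.
  apply: rn_cauchy_cvg => e e0.
  have d0 : 0 < Num.sqrt c * e by rewrite mulr_gt0// sqrtr_gt0.
  pose r : R := Num.sqrt c * e / 2.
  have d1' : 0 < r%:C :> C by rewrite ltcR divr_gt0.
  have [/= [A1 B1] [FA1 FB1] AB1] := Fc _ d1'.
  exists (A1 `&` B1)%classic; first exact: filterI.
  move=> x y [Ax _] [_ By]; have := AB1 (x, y) (conj Ax By).
  rewrite /= -ball_normE/= lt_rn => h.
  have h1 := gram_rn_lower (x - y).
  have : rn (x - y) ^+ 2 <= r ^+ 2.
    by rewrite lerXn2r ?nnegrE ?rn_ge0 ?(ltW h)// divr_ge0 ?(ltW d0).
  move/(le_trans h1); rewrite /r !exprMn sqr_sqrtr ?(ltW c0)// -mulrA ler_pM2l// => h2.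
  rewrite -(@ltr_pXn2r _ 2)// ?nnegrE ?rn_ge0 ?(ltW e0)//; apply: (le_lt_trans h2).
  have := exprn_gt0 2 e0; rewrite exprVn; lra.
apply: (@cvgP _ _ (l : gram_space)); apply/cvg_rnP => e e0.
have B0 : 0 <= gram_bound.
  by rewrite sumr_ge0// => i _; rewrite sumr_ge0// => j _; rewrite rn_ge0.
have s0 : 0 < Num.sqrt (gram_bound + 1) by rewrite sqrtr_gt0 ltr_wpDl.
move/cvg_rnP : hl => /(_ _ (divr_gt0 e0 s0)); apply: filterS => x /= h.
rewrite -(@ltr_pXn2r _ 2)// ?nnegrE ?rn_ge0 ?(ltW e0)//.
apply: (le_lt_trans (gram_rn_upper _)).
move: h; rewrite ltr_pdivlMr// -(@ltr_pXn2r _ 2)// ?nnegrE ?mulr_ge0 ?rn_ge0 ?(ltW s0) ?(ltW e0)//.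
rewrite exprMn sqr_sqrtr ?addr_ge0// mulrDr mulr1 mulrC; apply: le_lt_trans.
by rewrite lerDl exprn_ge0// rn_ge0.
Qed.

HB.instance Definition _ := Uniform_isComplete.Build gram_space gram_cauchy_cvg.

HB.instance Definition _ := @NormedModule_isHilbert.Build R gram_space
  gram_inner (sqr_dot_norm gram_inner).

End gram_space.

(** * The Agler decomposition *)

Section finite_pick.
Variables (R : realType) (k N : nat).
Notation C := R[i].
Local Open Scope complex_scope.
Variable la : 'I_N -> 'rV[C]_k.
Hypothesis laD : forall i, polydisc (la i).
Hypothesis k0 : (0 < k)%N.
Notation W := (hsum (fun _ : 'I_N => (R[i] : hilbertType R))).
Notation MM := (hsum (fun _ : 'I_N * 'I_N => (R[i] : hilbertType R))).

(** A list of pairs (variable, function), possibly with repetitions, so that sums in the cone are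
    concatenations. *)
Definition pick_sum (s : seq ('I_k * ('I_N -> C))) (i j : 'I_N) : C :=
  \sum_(p <- s) (1 - la i 0 p.1 * Num.conj (la j 0 p.1)) * (p.2 i * Num.conj (p.2 j)).

Definition pick_cone : set MM := [set X | exists s, X = fun ij => pick_sum s ij.1 ij.2].

Definition outer (f : 'I_N -> C) : MM := fun ij => f ij.1 * Num.conj (f ij.2).

Lemma la_bound : exists r : R, [/\ 0 <= r, r < 1 & forall i p, rn (la i 0 p) <= r].
Proof.
have /boolp.choice[u hu] : forall i, exists u : R, [/\ 0 <= u, u < 1 & forall p, rn (la i 0 p) <= u].
  by move=> i; exact: (uniform_lt1 ((polydiscE _).1 (laD i))).
have [|r [r0 r1 hr]] := @uniform_lt1 R N u; first by move=> i; case: (hu i).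
exists r; split=> // i p; have [_ _ h] := hu i; exact: le_trans (h p) (hr i).
Qed.

Section separated.
Variable w : MM.
Hypothesis w_pos : forall X, pick_cone X -> 0 <= complex.Re (inner X w).

(** Hermitian part of the conjugate of w, the only part that Q sees. *)
Let G0 (i j : 'I_N) : C := (Num.conj (w (i, j)) + w (j, i)) / 2.
Let Q (f : 'I_N -> C) : R := complex.Re (inner (outer f) w).

Lemma separator_herm i j : G0 i j = Num.conj (G0 j i).
Proof.
rewrite /G0 rmorphM rmorphD/= conjCK fmorphV rmorph_nat.
by rewrite addrC.
Qed.

Lemma separator_form (f : W) : complex.Re (gram_form G0 f f) = Q f.
Proof.
set Z := inner (outer f) w.
have -> : gram_form G0 f f = (Z + Num.conj Z) * (2^-1)%:C.
  rewrite /gram_form.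
  have ZE : Z = \sum_i \sum_j f i * Num.conj (f j) * Num.conj (w (i, j)).
    by rewrite pair_big; apply: eq_bigr => -[].
  have -> : Num.conj Z = \sum_i \sum_j f i * Num.conj (f j) * w (j, i).
    rewrite ZE rmorph_sum exchange_big; apply: eq_bigr => i _ /=.
    rewrite rmorph_sum; apply: eq_bigr => j _ /=.
    rewrite !rmorphM/= !conjCK; ring.
  rewrite ZE -big_split mulr_suml; apply: eq_bigr => i _ /=.
  rewrite -big_split mulr_suml; apply: eq_bigr => j _ /=.
  rewrite /G0 fmorphV (rmorph_nat (real_complex R)); ring.
by rewrite mulrC cReZ cReD cRe_conj /Q -/Z; field.
Qed.

(** The inequality for w on the single generator (p, f), read as contractivity of multiplication by
    the p-th coordinate. *)
Lemma separator_contraction p (f : 'I_N -> C) : Q (fun i => la i 0 p * f i) <= Q f.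
Proof.
rewrite -subr_ge0 /Q -cReN -cReD -ipNl -ipDl; apply: w_pos.
exists [:: (p, f)]; apply: hsumP => ij; rewrite hsumDE hsumNE /outer /pick_sum big_seq1 /=.
rewrite rmorphM/=; ring.
Qed.

Lemma separator_bound (f : W) : `|Q f| <= gram_bound G0 * rn f ^+ 2.
Proof.
rewrite -separator_form (le_trans _ (gram_form_bound _ _))//.
by rewrite -lecR -rnE normc_ge_Re.
Qed.

(** Multiplying f repeatedly by one coordinate does not increase Q, while it sends f to 0 since the
    points lie in a polydisc of radius r < 1; hence Q f is at least the limit 0. *)
Lemma separator_ge0 (f : 'I_N -> C) : 0 <= Q f.
Proof.
have [r [r0 r1 hr]] := la_bound.
pose p := Ordinal k0; pose g n (i : 'I_N) : C := la i 0 p ^+ n * f i.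
have gQ n : Q (g n) <= Q f.
  elim: n => [|n ih]; first by rewrite (_ : g 0%N = f)//; apply/funext => i; rewrite /g mul1r.
  apply: le_trans ih; apply: le_trans (separator_contraction p (g n)).
  by rewrite le_eqVlt; apply/orP; left; apply/eqP; congr Q; apply/funext => i; rewrite /g exprS mulrA.
have gb n : rn (g n : W) <= r ^+ n * rn (f : W).
  rewrite -(@ler_pXn2r _ 2)// ?nnegrE ?mulr_ge0 ?exprn_ge0 ?rn_ge0//.
  rewrite exprMn !hsum_rn mulr_sumr; apply: ler_sum => i _.
  rewrite /g rnM exprMn ler_wpM2r ?exprn_ge0 ?rn_ge0// lerXn2r ?nnegrE ?rn_ge0 ?exprn_ge0//.
  by rewrite rnX lerXn2r ?nnegrE ?rn_ge0.
apply/ler_addgt0Pl => e e0.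
pose B := gram_bound G0 * rn (f : W) ^+ 2.
have GB0 : 0 <= gram_bound G0.
  by rewrite sumr_ge0// => i _; rewrite sumr_ge0// => j _; rewrite rn_ge0.
have B0 : 0 <= B by rewrite mulr_ge0// exprn_ge0// rn_ge0.
have B1 : 0 < B + 1 by rewrite ltr_wpDl.
have /cvgrPdist_lt/(_ _ (divr_gt0 e0 B1))[n _ hn] : (fun n => r ^+ n) @ \oo --> (0 : R).
  by apply: cvg_expr; rewrite ger0_norm.
have := hn n (leqnn n); rewrite sub0r normrN ger0_norm ?exprn_ge0// ltr_pdivlMr// => h.
have h2 := separator_bound (g n); rewrite ler_norml in h2; case/andP: h2 => h2 _.
have h3 : gram_bound G0 * rn (g n : W) ^+ 2 <= r ^+ n * B.
  rewrite /B [leRHS]mulrCA; apply: ler_wpM2l => //.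
  apply: (@le_trans _ _ ((r ^+ n * rn (f : W)) ^+ 2)).
    by rewrite lerXn2r ?nnegrE ?rn_ge0 ?mulr_ge0 ?exprn_ge0 ?rn_ge0.
  rewrite exprMn ler_wpM2r ?exprn_ge0 ?rn_ge0// expr2 -[leRHS]mulr1 ler_wpM2l ?exprn_ge0//.
  by rewrite exprn_ile1// ltW.
move: h h2 h3 (gQ n) (exprn_ge0 n r0); rewrite mulrDr mulr1.
move: (gram_bound G0 * _) (r ^+ n * B) (r ^+ n) (Q (g n)) (Q f) => x1 x2 x3 x4 x5.
by clear -x1; lra.
Qed.

Variable e : R.
Hypothesis e0 : 0 < e.

Let G (i j : 'I_N) : C := G0 i j + (i == j)%:R * e%:C.

Lemma pert_form (f : W) : complex.Re (gram_form G f f) = Q f + e * rn f ^+ 2.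
Proof.
have -> : gram_form G f f = gram_form G0 f f + e%:C * inner f f.
  rewrite /gram_form mulr_sumr -big_split; apply: eq_bigr => i _ /=.
  under eq_bigr do rewrite /G mulrDr.
  rewrite big_split/=; congr (_ + _); rewrite (bigD1 i)//= eqxx mul1r big1 => [|j ji].
    by rewrite addr0 mulrC complex_ipE.
  by rewrite eq_sym (negbTE ji) mul0r mulr0.
by rewrite cReD separator_form cReZ Re_ip.
Qed.

Lemma pert_herm i j : G i j = Num.conj (G j i).
Proof.
rewrite /G rmorphD (separator_herm i j); congr (_ + _).
by rewrite rmorphM rmorph_nat /= [Num.conj e%:C]conjc_real eq_sym.
Qed.

Lemma pert_pos (f : W) : e * rn f ^+ 2 <= complex.Re (gram_form G f f).
Proof. by rewrite pert_form lerDr separator_ge0. Qed.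

Let K : hilbertType R := gram_space pert_herm e0 pert_pos.

Definition mult_op (p : 'I_k) (x : K) : K := fun i => la i 0 p * x i.

Lemma mult_op_linear p : linear (mult_op p).
Proof.
move=> a x y; apply: hsumP => i; rewrite /mult_op.
rewrite -[(a *: x + y) i]/(a * x i + y i) -[RHS]/(a * (la i 0 p * x i) + la i 0 p * y i); ring.
Qed.

Let T p : {linear K -> K} := mklin (mult_op_linear p).

(** Multiplication does not increase Q and shrinks the perturbation e |x|^2 by r^2. The gain e (1 -
    r^2) |x|^2 is at least the fraction d of the whole squared norm, which is at most B |x|^2. *)
Lemma mult_op_contr : exists q : R, [/\ 0 <= q, q < 1 & forall p x, rn (T p x) <= q * rn x].
Proof.
have [r [r0 r1 hr]] := la_bound.
have B0 : 0 <= gram_bound G0.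
  by rewrite sumr_ge0// => i _; rewrite sumr_ge0// => j _; rewrite rn_ge0.
pose B := gram_bound G0 + e; have Bgt : 0 < B by rewrite ltr_wpDl.
pose d := e * (1 - r ^+ 2) / B.
have r2 : r ^+ 2 < 1 by rewrite exprn_ilt1.
have d0 : 0 < d by rewrite divr_gt0// mulr_gt0// subr_gt0.
have d1 : d <= 1.
  rewrite ler_pdivrMr// mul1r (@le_trans _ _ e)//; last by rewrite lerDr.
  by rewrite -[leRHS]mulr1 ler_wpM2l ?(ltW e0)// lerBlDr lerDl exprn_ge0.
exists (Num.sqrt (1 - d)); split.
- exact: sqrtr_ge0.
- by rewrite -[ltRHS]sqrtr1 ltr_sqrt// ltrBlDr ltrDl.
move=> p x; rewrite -(@ler_pXn2r _ 2)// ?nnegrE ?mulr_ge0 ?sqrtr_ge0 ?rn_ge0//.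
rewrite exprMn sqr_sqrtr ?subr_ge0// !gram_rn2 !pert_form.
have h1 := separator_contraction p x.
have h2 : rn (T p x : W) ^+ 2 <= r ^+ 2 * rn (x : W) ^+ 2.
  rewrite !hsum_rn mulr_sumr; apply: ler_sum => i _; rewrite /= /mult_op rnM exprMn.
  by rewrite ler_wpM2r ?exprn_ge0 ?rn_ge0// lerXn2r ?nnegrE ?rn_ge0.
have h3 := separator_bound x; rewrite ler_norml in h3; case/andP: h3 => _ h3.
have h4 : d * (Q x + e * rn (x : W) ^+ 2) <= e * (1 - r ^+ 2) * rn (x : W) ^+ 2.
  rewrite -[leRHS](_ : d * (B * rn (x : W) ^+ 2) = _); last first.
    by rewrite mulrA /d divfK ?gt_eqF.
  by rewrite ler_wpM2l ?(ltW d0)// /B mulrDl lerD2r.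
have h5 : e * rn (T p x : W) ^+ 2 <= e * (r ^+ 2 * rn (x : W) ^+ 2).
  by rewrite ler_wpM2l ?(ltW e0).
move: h1 h4 h5; rewrite /T /= /mult_op; lra.
Qed.

Lemma op_monomial_mult a (x : K) i : op_monomial T a x i = monomial (la i) a * x i.
Proof.
rewrite /op_monomial /monomial.
elim: (index_enum _) => [|j s ih]; first by rewrite !big_nil mul1r.
rewrite !big_cons /= -[in RHS]mulrA -ih.
elim: (a j) => [|n ihn] /=; first by rewrite expr0 mul1r.
by rewrite /mult_op ihn exprS mulrA.
Qed.

(** phi(T) applied to the constant function 1 is the vector of the values phi(la_i), so
    [opnorm S <= 1] compares two norms in K. *)
Lemma mult_op_calculus (phi : 'rV[C]_k -> C) : schur_agler phi ->
  rn ((fun i => phi (la i)) : K) <= rn ((fun=> 1) : K).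
Proof.
move=> [_ hphi]; have [q [q0 q1 hq]] := mult_op_contr.
have Tc p : continuous (T p) by exact: bounded_lin_cont (hq p).
have Tstrict p : strict_contraction (T p).
  by split=> //; apply: le_lt_trans q1; exact: opnorm_le.
have Tcom i j x : T i (T j x) = T j (T i x).
  by apply: hsumP => l; rewrite /= /mult_op mulrCA.
have [S [Sc [c hc hS] S1]] := hphi K T Tstrict Tcom.
have Sone := le_opnorm ((fun=> 1) : K) Sc.
suff -> : ((fun i => phi (la i)) : K) = S (fun=> 1).
  by rewrite (le_trans Sone)// -[leRHS]mul1r ler_wpM2r ?rn_ge0.
apply: hsumP => i; apply: rn_unique => d d0.
have d20 : 0 < d / 2 by rewrite divr_gt0.
have /cvg_rnP/(_ _ d20)[A1 _ hA1] := hc _ (laD i).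
pose u : K := fun=> 1.
(* A coordinate is at most the norm of K divided by sqrt e, by [gram_rn_lower]; [rn u + 1] is a
   positive substitute for [rn u]. *)
pose D := d / 2 * Num.sqrt e / (rn u + 1).
have u1 : 0 < rn u + 1 by rewrite ltr_wpDl ?rn_ge0.
have D0 : 0 < D by rewrite divr_gt0// mulr_gt0 ?divr_gt0 ?sqrtr_gt0.
have /cvgrPdist_lt/(_ _ D0)[A2 _ hA2] := hS.
have := hA1 (A1 `|` A2)%fset; rewrite /= fsubsetUl => /(_ isT).
have := hA2 (A1 `|` A2)%fset; rewrite /= fsubsetUr => /(_ isT).
move: (A1 `|` A2)%fset => A; rewrite sub0r normrN => hA hA'.
pose P x := partial_sum (fun a => c a *: op_monomial T a x) A.
have gl : linear (fun x => S x - P x).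
  move=> b x y; rewrite linearP /P !partial_sumE scalerBr scaler_sumr.
  rewrite addrACA -opprD -big_split/=; congr (_ - _); apply: eq_bigr => a _.
  by rewrite (op_monomial_linear T a) scalerDr !scalerA mulrC.
have T1 p x : rn (T p x) <= 1 * rn x.
  by rewrite (le_trans (hq p x))// ler_wpM2r ?rn_ge0// ltW.
have gb x : rn (mklin gl x) <= (1 + \sum_(a <- A) rn (c a)) * rn x.
  rewrite /= (le_trans (rnD _ _))// rnN mulrDl lerD//.
    by rewrite (le_trans (le_opnorm x Sc))// ler_wpM2r ?rn_ge0.
  rewrite /P partial_sumE (le_trans (rn_sum _ _ _))// mulr_suml.
  apply: ler_sum => a _; rewrite rnZ ler_wpM2l ?rn_ge0//.
  by have := op_monomial_bound a x ler01 T1; rewrite expr1n mul1r.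
have hu := le_opnorm u (bounded_lin_cont gb).
have gu : rn (S u - P u) < d / 2 * Num.sqrt e.
  have o0 := opnorm_ge0 gb.
  apply: (le_lt_trans hu); rewrite (@le_lt_trans _ _ (opnorm (mklin gl) * (rn u + 1)))//.
    by rewrite ler_wpM2l// lerDl.
  rewrite -ltr_pdivlMr//; apply: le_lt_trans hA; exact: ler_norm.
have ci : rn ((S u) i - P u i) < d / 2.
  have h1 := gram_rn_lower (S u - P u).
  have h2 : rn ((S u) i - P u i) <= rn ((S u - P u) : W).
    rewrite -rn_sqr_le hsum_rn (bigD1 i)//= lerDl sumr_ge0// => j _.
    by rewrite exprn_ge0// rn_ge0.
  apply: (le_lt_trans h2); rewrite -(ltr_pM2r (_ : 0 < Num.sqrt e)) ?sqrtr_gt0//.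
  apply: le_lt_trans gu; rewrite -(@ler_pXn2r _ 2)// ?nnegrE ?mulr_ge0 ?rn_ge0 ?sqrtr_ge0//.
  by rewrite exprMn sqr_sqrtr ?(ltW e0)// mulrC.
have Pi : P u i = partial_sum (fun a => c a * monomial (la i) a) A.
  rewrite /P !partial_sumE.
  transitivity (\sum_(a <- A) (c a *: op_monomial T a u) i).
    by elim/big_rec2: _ => // a x y _ <-.
  apply: eq_bigr => a _; rewrite -[LHS]/(c a * op_monomial T a u i).
  by rewrite op_monomial_mult mulr1.
rewrite -/u; have := rn_tri (P u i) (phi (la i)) (S u i).
by rewrite [rn (P u i - _)]rnB; move: ci hA'; rewrite Pi /=; lra.
Qed.

End separated.

(** If M stays away from the cone, a separator gives Q(1) < Q(phi), against [mult_op_calculus].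
    Otherwise M is only approached by the cone, whence the error e. *)
Lemma finite_pick (phi : 'rV[C]_k -> C) (e : R) : schur_agler phi -> 0 < e ->
  exists s, forall i j,
    rn (1 - phi (la i) * Num.conj (phi (la j)) - pick_sum s i j) < e.
Proof.
move=> phiSA e0.
pose M : MM := outer (fun=> 1) - outer (fun i => phi (la i)).
have [|||hM|[w [w_pos wM]]] := @cone_separation R MM pick_cone M.
- by exists [::]; apply: hsumP => ij; rewrite /pick_sum big_nil.
- move=> _ _ [s ->] [t ->]; exists (s ++ t); apply: hsumP => ij.
  by rewrite hsumDE /pick_sum big_cat.
- move=> t _ t0 [s ->]; exists [seq (p.1, fun i => (Num.sqrt t)%:C * p.2 i) | p <- s].
  apply: hsumP => ij; rewrite hsumZE /pick_sum big_map scaler_sumr; apply: eq_bigr => p _ /=.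
  rewrite rmorphM/= [Num.conj (Num.sqrt t)%:C]conjc_real -[LHS]/(t%:C * _).
  by rewrite -[t in LHS](sqr_sqrtr (ltW t0)) rmorphXn/=; ring.
- have [_ [s ->] hs] := hM e e0; exists s => i j; apply: le_lt_trans hs.
  set X := (X in rn X <= _); set Y := (Y in _ <= rn Y).
  have -> : X = Y (i, j) by rewrite /X /Y hsumDE hsumNE /M hsumDE hsumNE /outer /= conjC1 mulr1.
  by rewrite -rn_sqr_le hsum_rn (bigD1 (i, j))//= lerDl sumr_ge0// => ij _; rewrite exprn_ge0// rn_ge0.
exfalso; pose d := - complex.Re (inner M w); have d0 : 0 < d by rewrite oppr_gt0.
(* The squared norm of the constant 1 is N, so the perturbation costs at most [eps * N], which is
   less than d. *)
pose eps := d / (2 * N.+1%:R).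
have N1 : 0 < 2 * N.+1%:R :> R by rewrite mulr_gt0// ltr0n.
have eps0 : 0 < eps by rewrite divr_gt0.
have := mult_op_calculus w_pos eps0 phiSA.
rewrite -rn_sqr_le !gram_rn2 !pert_form => h.
have hM : complex.Re (inner (outer (fun=> 1)) w) - complex.Re (inner (outer (fun i => phi (la i))) w) = - d.
  by rewrite /d opprK /M ipDl ipNl cReD cReN.
have hN : rn ((fun=> 1) : W) ^+ 2 = N%:R.
  rewrite hsum_rn (eq_bigr (fun=> 1)) => [|i _]; last by rewrite rn1 expr1n.
  by rewrite sumr_const card_ord.
have epsN : eps * (2 * N.+1%:R) = d by rewrite divfK ?gt_eqF.
have h2 : 0 <= eps * rn ((fun i => phi (la i)) : W) ^+ 2.
  by rewrite mulr_ge0 ?(ltW eps0)// exprn_ge0// rn_ge0.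
have h3 : 0 <= eps * N%:R by rewrite mulr_ge0 ?ler0n ?(ltW eps0).
move: h h2 h3 hM epsN; rewrite hN -[N.+1]addn1 natrD; lra.
Qed.

End finite_pick.

(** * From finitely many points to a sequence of points *)

Section ultralimit.
Variable R : realType.
Notation C := R[i].
Local Open Scope complex_scope.
Variables (F : set_system nat) (FU : UltraFilter F).

(** The segment is compact, so there is a cluster point, and an ultrafilter converges to its cluster
    points. *)
Lemma ultra_real_cvg (u : nat -> R) (b : R) :
  (\forall N \near F, `|u N| <= b) -> exists l : R, u @ F --> l.
Proof.
move=> ub; have FP := @ultra_proper _ _ FU.
have [l [_ hl]] : `[- b, b]%classic `&` cluster (u @ F) !=set0.
  apply: segment_compact; apply: filterS ub => N; rewrite /= in_itv/= ler_norml.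
  by [].
exists l => B lB; have [//|nB] := in_ultra_setVsetC (u @^-1` B) FU.
have [x [nBx Bx]] := hl (~` B) B nB lB.
by [].
Qed.

Lemma ultra_complex_cvg (u : nat -> C) (b : R) :
  (\forall N \near F, rn (u N) <= b) -> exists l : C, u @ F --> l.
Proof.
move=> ub; have FP := @ultra_proper _ _ FU.
have [a ha] : exists a : R, (fun N => complex.Re (u N)) @ F --> a.
  apply: (@ultra_real_cvg _ b); apply: filterS ub => N; apply: le_trans.
  by rewrite -lecR -rnE normc_ge_Re.
have [c hc] : exists c : R, (fun N => complex.Im (u N)) @ F --> c.
  apply: (@ultra_real_cvg _ b); apply: filterS ub => N; apply: le_trans.
  by rewrite -lecR -rnE -(normrN (complex.Im _)) -ReiNIm (le_trans (normc_ge_Re _))// normrM normci mulr1.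
exists (a +i* c); apply/cvg_rnP => e e0.
have e20 : 0 < e / 2 by rewrite divr_gt0.
have /cvgrPdist_lt/(_ _ e20) ha' := ha.
have /cvgrPdist_lt/(_ _ e20) hc' := hc.
apply: filterS (filterI ha' hc') => N [h1 h2].
have -> : a +i* c - u N = (a - complex.Re (u N))%:C + 'i * (c - complex.Im (u N))%:C.
  by case: (u N) => x y; simpc.
have -> : e = e / 2 + e / 2 by rewrite -splitr.
apply: (le_lt_trans (rnD _ _)); rewrite rnM !rnC.
by rewrite (_ : rn 'i = 1) ?mul1r ?ltrD// /rn normci.
Qed.

End ultralimit.

Section pick_sequence.
Variables (R : realType) (k : nat).
Notation C := R[i].
Local Open Scope complex_scope.
Variable la : nat -> 'rV[C]_k.
Hypothesis laD : forall i, polydisc (la i).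
Hypothesis k0 : (0 < k)%N.
Variable phi : 'rV[C]_k -> C.
Hypothesis phiSA : schur_agler phi.

Let M (i j : nat) : C := 1 - phi (la i) * Num.conj (phi (la j)).
Let X (U : 'I_k -> nat -> nat -> C) (N i j : nat) : C :=
  \sum_p (1 - la i 0 p * Num.conj (la j 0 p)) * \sum_(l < N) U p i l * Num.conj (U p j l).

Lemma finite_pick_triangular (N : nat) (e : R) : 0 < e ->
  exists U : 'I_k -> nat -> nat -> C,
    (forall p i l, (i < l)%N -> (i < N)%N -> U p i l = 0) /\
    (forall i j, (i < N)%N -> (j < N)%N -> rn (M i j - X U N i j) < e).
Proof.
move=> e0.
have [s hs] := finite_pick (fun i : 'I_N => laD i) k0 phiSA e0.
pose p0 (q : 'I_(size s)) := tnth (in_tuple s) q.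
(* The coordinates of [v p i] are the values at la_i of the listed functions attached to p, and 0
   for the others, so the Gram matrix of [v p] is the part of [pick_sum] belonging to p. Indices i
   >= N get 0. *)
pose v (p : 'I_k) (i : nat) : hsum (fun _ : 'I_(size s) => (R[i] : hilbertType R)) :=
  fun q => if (p0 q).1 == p then (if insub i is Some i' then (p0 q).2 i' else 0) else 0.
have /boolp.choice[U hU] : forall p, exists U : nat -> nat -> C,
    (forall i l, (i < l)%N -> (i < N)%N -> U i l = 0) /\
    (forall i j, (i < N)%N -> (j < N)%N ->
       inner (v p i) (v p j) = \sum_(l < N) U i l * Num.conj (U j l)).
  by move=> p; exact: triangular_gram.
exists U; split=> [p|i j iN jN]; first by case: (hU p).
have := hs (Ordinal iN) (Ordinal jN); rewrite /M /= => h; apply: le_lt_trans h.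
rewrite le_eqVlt; apply/orP; left; apply/eqP; congr (rn (_ - _)).
rewrite /X; under eq_bigr do rewrite -(hU _).2//.
rewrite /pick_sum [RHS]big_tnth.
transitivity (\sum_(q < size s) \sum_p (1 - la i 0 p * Num.conj (la j 0 p)) *
    (v p i q * Num.conj (v p j q))).
  rewrite [RHS]exchange_big; apply: eq_bigr => p _ /=.
  by rewrite -mulr_sumr.
apply: eq_bigr => q _; rewrite (bigD1 (p0 q).1)//= big1 ?addr0; last first.
  by move=> p pq; rewrite /v eq_sym (negbTE pq) mul0r mulr0.
rewrite /v eqxx (insubT (fun i => (i < N)%N) iN) (insubT (fun i => (i < N)%N) jN).
by rewrite /= /p0.
Qed.

(** The decompositions on the first N points have errors below 1 / (N + 1) and bounded entries;
    their entrywise limits satisfy the identity exactly. *)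
Lemma pick_sequence : exists U : 'I_k -> nat -> nat -> C,
  (forall p i l, (i < l)%N -> U p i l = 0) /\
  (forall n i j, (i < n)%N -> (j < n)%N -> M i j = X U n i j).
Proof.
have /boolp.choice[U hU] : forall N : nat, exists U : 'I_k -> nat -> nat -> C,
    (forall p i l, (i < l)%N -> (i < N)%N -> U p i l = 0) /\
    (forall i j, (i < N)%N -> (j < N)%N -> rn (M i j - X U N i j) < N.+1%:R^-1).
  by move=> N; apply: finite_pick_triangular; rewrite invr_gt0 ltr0n.
(* One ultrafilter makes all entries converge together, in place of a diagonal subsequence. *)
have [F [FU Foo]] := @ultraFilterLemma nat _ eventually_filter.
have FP := @ultra_proper _ _ FU.
have Fge n : \forall N \near F, (n < N)%N.
  by apply: Foo; exists n.+1.
(* Row i < n ends before column n, so the limit is taken in a sum of fixed length n. *)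
have XN N n i j : (i < n)%N -> (n <= N)%N -> (j < n)%N -> X (U N) N i j = X (U N) n i j.
  move=> iN nN jn; rewrite /X; apply: eq_bigr => p _; congr (_ * _).
  rewrite [RHS](big_ord_widen N (fun l => U N p i l * Num.conj (U N p j l)) nN) [RHS]big_mkcond.
  apply: eq_bigr => l _; case: ltnP => // nl; rewrite (hU N).1 ?mul0r//.
    exact: leq_trans iN nl.
  exact: leq_trans iN nN.
(* For i = j the real part of [X] is a sum of nonnegative terms bounded by 2, so d |U|^2 <= 2 for
   each entry; the bound on |U| itself follows from t <= t^2 + 1. *)
have bnd p i l : exists b : R, \forall N \near F, rn (U N p i l) <= b.
  pose d := 1 - rn (la i 0 p) ^+ 2.
  have lap q : rn (la i 0 q) ^+ 2 < 1.
    by rewrite exprn_ilt1 ?rn_ge0//; exact: ((polydiscE _).1 (laD i)).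
  have d0 : 0 < d by rewrite subr_gt0.
  exists (2 / d + 1); apply: filterS (Fge (maxn i l)) => N; rewrite gtn_max => /andP[iN lN].
  have hX : complex.Re (X (U N) N i i) <= 2.
    have h1 := (hU N).2 i i iN iN.
    have h2 : complex.Re (M i i) <= 1.
      by rewrite /M cReD cReN -rn2E lerBlDr lerDl exprn_ge0// rn_ge0.
    have h3 := Re_le_rn (X (U N) N i i - M i i); rewrite rnB cReD cReN in h3.
    have h4 : N.+1%:R^-1 <= 1 :> R by rewrite invf_le1 ?ltr0n// ler1n.
    move: h1 h2 h3 h4; move: (N.+1%:R^-1) (rn (M i i - _)) => x y; lra.
  have XE : complex.Re (X (U N) N i i) =
      \sum_q (1 - rn (la i 0 q) ^+ 2) * \sum_(t < N) rn (U N q i t) ^+ 2.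
    rewrite /X Re_sum; apply: eq_bigr => q _.
    have -> : 1 - la i 0 q * Num.conj (la i 0 q) = (1 - rn (la i 0 q) ^+ 2)%:C.
      by rewrite rmorphB rmorphXn /= -rnE normCK.
    by rewrite cReZ Re_sum; congr (_ * _); apply: eq_bigr => t _; rewrite rn2E.
  have h1 : d * rn (U N p i l) ^+ 2 <= 2.
    apply: le_trans hX; rewrite XE (bigD1 p)//= -[leLHS]addr0 lerD//.
      rewrite ler_wpM2l ?(ltW d0)// (bigD1 (Ordinal lN))//= lerDl sumr_ge0// => t _.
      by rewrite exprn_ge0// rn_ge0.
    apply: sumr_ge0 => q _; rewrite mulr_ge0 ?subr_ge0 ?(ltW (lap q))// sumr_ge0// => t _.
    by rewrite exprn_ge0// rn_ge0.
  have h2 : rn (U N p i l) ^+ 2 <= 2 / d by rewrite ler_pdivlMr// mulrC.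
  have t0 := rn_ge0 (U N p i l); have := sqr_ge0 (rn (U N p i l) - 1).
  move: h2; rewrite sqrrB1; have := divr_ge0 (ler0n R 2) (ltW d0).
  move: (2 / d) (rn (U N p i l)) t0 => x t; nra.
have lim p i l : exists a : C, (fun N => U N p i l) @ F --> a.
  by have [b hb] := bnd p i l; exact: (ultra_complex_cvg FU hb).
pose V p i l := projT1 (cid (lim p i l)).
have hV p i l : (fun N => U N p i l) @ F --> V p i l := projT2 (cid (lim p i l)).
exists V; split=> [p i l il|n i j ilt jlt].
  apply: (@cvg_unique _ (@norm_hausdorff _ C) _ (fmap_proper_filter _ _) _ _ (hV p i l)).
  apply/cvg_rnP => e e0; apply: filterS (Fge i) => N iN.
  by rewrite (hU N).1// subrr rn0.
have cX : (fun N => X (U N) n i j) @ F --> X V n i j.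
  apply: cvg_sumr => p; apply: cvgM; first exact: cvg_cst.
  apply: cvg_sumr => l; apply: cvgM; first exact: hV.
  have /cvg_rnP h := hV p j l; apply/cvg_rnP => e e0; apply: filterS (h e e0) => N.
  by rewrite -rmorphB rn_conj.
apply: (@cvg_unique _ (@norm_hausdorff _ C) _ (fmap_proper_filter _ _) _ _ _ cX).
apply/cvg_rnP => e e0.
pose m := Num.Def.archi_bound e^-1.
apply: filterS (filterI (Fge n) (Fge m)) => N [nN mN].
rewrite rnB -(XN N n)//; last exact: ltnW.
have := (hU N).2 i j (ltn_trans ilt nN) (ltn_trans jlt nN); rewrite rnB => /lt_trans; apply.
rewrite -[e]invrK ltf_pV2 ?posrE ?invr_gt0 ?ltr0n//.
have := archi_boundP (ltW (_ : 0 < e^-1)); rewrite invr_gt0 => /(_ e0) /lt_le_trans; apply.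
by rewrite ler_nat leqW// ltnW.
Qed.

End pick_sequence.

(** * Square-summable sequences *)

Lemma dominated_series (R : realType) (W : completeNormedModType R[i])
    (a : nat -> W) (b : nat -> R) (M : R) :
  (forall n, rn (a n) <= b n) -> (forall N, \sum_(n < N) b n <= M) ->
  exists l : W, (fun N => \sum_(n < N) a n) @ \oo --> l.
Proof.
move=> ab bM.
have b0 n : 0 <= b n by apply: le_trans (ab n); exact: rn_ge0.
have nd : nondecreasing_seq (fun N => \sum_(n < N) b n).
  by apply/nondecreasing_seqP => N; rewrite big_ord_recr lerDl.
have ub : has_ubound (range (fun N => \sum_(n < N) b n)).
  by exists M => _ [N _ <-].
have := nondecreasing_cvgn nd ub; set s := sup _ => hs.
have sN N : \sum_(n < N) b n <= s by apply: sup_ubound => //; exists N.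
apply: rn_cauchy_cvg => e e0.
have /cvgrPdist_lt/(_ _ e0)[N0 _ hN0] := hs.
have tail N N' : (N0 <= N)%N -> (N <= N')%N ->
    rn (\sum_(n < N') a n - \sum_(n < N) a n) < e.
  move=> N0N NN'; apply: (@le_lt_trans _ _ (\sum_(n < N') b n - \sum_(n < N) b n)).
    have E (W' : zmodType) (c : nat -> W') :
        \sum_(n < N') c n - \sum_(n < N) c n = \sum_(N <= n < N') c n.
      by rewrite -!(big_mkord xpredT c) [X in X - _](big_cat_nat (n := N))//= addrAC subrr add0r.
    by rewrite !E (le_trans (rn_sum _ _ _))// ler_sum.
  have := hN0 N N0N; rewrite ger0_norm ?subr_ge0//; apply: le_lt_trans.
  by rewrite lerD2r.
exists [set N | (N0 <= N)%N]; first by exists N0.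
move=> N N' /= h h'; case: (leqP N N') => [NN'|/ltnW NN'].
  by rewrite rnB; exact: tail.
exact: tail.
Qed.

Section l2.
Variables (R : realType) (Y : hilbertType R).
Notation C := R[i].
Local Open Scope complex_scope.

Definition sqsum (f : nat -> Y) (N : nat) : R := \sum_(n < N) rn (f n) ^+ 2.

Definition l2_pred : {pred (nat -> Y)} :=
  [pred f : nat -> Y | `[< exists M : R, forall N, sqsum f N <= M >]].

Fact l2_submod : submod_closed l2_pred.
Proof.
split; first by apply/asboolP; exists 0 => N; rewrite /sqsum big1// => n _; rewrite rn0 expr0n.
move=> a f g /asboolP[M hM] /asboolP[M' hM']; apply/asboolP.
exists (2 * rn a ^+ 2 * M + 2 * M') => N.
apply: (@le_trans _ _ (2 * rn a ^+ 2 * sqsum f N + 2 * sqsum g N)); last first.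
  by rewrite lerD// ler_wpM2l// mulr_ge0// exprn_ge0// rn_ge0.
rewrite /sqsum !mulr_sumr -big_split; apply: ler_sum => n _ /=.
have := parallelogram (a *: f n) (g n); rewrite rnZ exprMn mulrA => <-.
by rewrite -[(a *: f + g) n]/(a *: f n + g n) lerDl exprn_ge0// rn_ge0.
Qed.

HB.instance Definition _ := GRing.isSubmodClosed.Build C (nat -> Y) l2_pred l2_submod.

Record l2 := L2 { l2_val :> nat -> Y; l2_valP : l2_val \in l2_pred }.

HB.instance Definition _ := [isSub for l2_val].
HB.instance Definition _ := [Choice of l2 by <:].
HB.instance Definition _ := [SubChoice_isSubLmodule of l2 by <:].

Lemma l2P (f g : l2) : (forall n, f n = g n) -> f = g.
Proof. by move=> h; apply/val_inj/funext. Qed.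

Lemma l2_ip_cvg (f g : l2) : exists l : C,
  (fun N => \sum_(n < N) inner (f n) (g n)) @ \oo --> l.
Proof.
have [Mf hf] := asboolP _ (l2_valP f); have [Mg hg] := asboolP _ (l2_valP g).
apply: (@dominated_series R C (fun n => inner (f n) (g n)) (fun n => rn (f n) ^+ 2 + rn (g n) ^+ 2) (Mf + Mg)).
  move=> n; apply: (le_trans (ip_CS _ _)).
  have := sqr_ge0 (rn (f n) - rn (g n)); have := rn_ge0 (f n); have := rn_ge0 (g n).
  by move: (rn (f n)) (rn (g n)) => x y; nra.
by move=> N; rewrite big_split lerD; [|exact: hf|exact: hg].
Qed.

Definition l2_inner (f g : l2) : C := projT1 (cid (l2_ip_cvg f g)).

Lemma l2_innerP (f g : l2) :
  (fun N => \sum_(n < N) inner (f n) (g n)) @ \oo --> l2_inner f g.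
Proof. exact: projT2 (cid (l2_ip_cvg f g)). Qed.

Lemma l2_inner_unique (f g : l2) (l : C) :
  (fun N => \sum_(n < N) inner (f n) (g n)) @ \oo --> l -> l2_inner f g = l.
Proof. by move=> h; exact: (@cvg_unique _ (@norm_hausdorff _ C) _ (fmap_proper_filter _ _) _ _ (@l2_innerP f g) h). Qed.

Fact l2_inner_bilinear : bilinear_for
  (GRing.Scale.Law.clone _ _ ( *%R ) _)
  (GRing.Scale.Law.clone _ _ (conjC \; *%R ) _) l2_inner.
Proof.
split=> [u'|u] a x y /=; apply: l2_inner_unique.
  have -> : (fun N => \sum_(n < N) inner ((a *: x + y) n) (u' n)) =
    (fun N => a * \sum_(n < N) inner (x n) (u' n) + \sum_(n < N) inner (y n) (u' n)).
    apply/funext => N; rewrite mulr_sumr -big_split; apply: eq_bigr => n _ /=.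
    by rewrite -[inner _ _ in LHS]/(inner (a *: x n + y n) (u' n)) ipDl ipZl.
  by apply: cvgD; [apply: cvgM; [exact: cvg_cst|]|]; exact: l2_innerP.
have -> : (fun N => \sum_(n < N) inner (u n) ((a *: x + y) n)) =
  (fun N => Num.conj a * \sum_(n < N) inner (u n) (x n) + \sum_(n < N) inner (u n) (y n)).
  apply/funext => N; rewrite mulr_sumr -big_split; apply: eq_bigr => n _ /=.
  by rewrite -[inner _ _ in LHS]/(inner (u n) (a *: x n + y n)) ipDr ipZr.
by apply: cvgD; [apply: cvgM; [exact: cvg_cst|]|]; exact: l2_innerP.
Qed.

HB.instance Definition _ := bilinear_isBilinear.Build C l2 l2 C
  ( *%R ) (conjC \; *%R ) l2_inner l2_inner_bilinear.

Fact l2_inner_hermitian x y : l2_inner x y = (-1) ^+ false * Num.conj (l2_inner y x).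
Proof.
rewrite mul1r; apply: l2_inner_unique.
have /cvg_rnP h := @l2_innerP y x; apply/cvg_rnP => e e0; apply: filterS (h e e0) => N.
rewrite -(rn_conj (_ - _)) rmorphB rmorph_sum/=.
by under eq_bigr do rewrite -ipC.
Qed.

HB.instance Definition _ := isHermitianSesquilinear.Build C l2 false conjC
  l2_inner l2_inner_hermitian.

Lemma l2_inner_sq (f : l2) : sqsum f @ \oo --> complex.Re (l2_inner f f) /\
  l2_inner f f = (complex.Re (l2_inner f f))%:C.
Proof.
have h := @l2_innerP f f.
have E N : \sum_(n < N) inner (f n) (f n) = (sqsum f N)%:C.
  by rewrite rmorph_sum; apply: eq_bigr => n _; rewrite ip_rn.
split.
  apply/cvgrPdist_lt => e e0; move/cvg_rnP : h => /(_ e e0); apply: filterS => N.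
  rewrite E; apply: le_lt_trans.
  rewrite -[sqsum f N in leLHS]/(complex.Re (sqsum f N)%:C) -cReN -cReD.
  by rewrite -lecR -rnE normc_ge_Re.
rewrite RRe_real//; apply/CrealP.
by rewrite {2}l2_inner_hermitian mul1r.
Qed.

Lemma sqsum_le (f : l2) N : sqsum f N <= complex.Re (l2_inner f f).
Proof.
have [h _] := l2_inner_sq f.
rewrite leNgt; apply/negP => lt; have := subr_gt0 (complex.Re (l2_inner f f)) (sqsum f N).
rewrite lt => e0; have /cvgrPdist_lt/(_ _ e0)[N0 _ hN0] := h.
have := hN0 (maxn N0 N) (leq_maxl _ _).
have : sqsum f N <= sqsum f (maxn N0 N).
  rewrite /sqsum -!(big_mkord xpredT (fun n => rn (f n) ^+ 2)).
  rewrite [leRHS](big_cat_nat (n := N)) ?leq_maxr//= lerDl sumr_ge0// => i _.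
  by rewrite exprn_ge0// rn_ge0.
by rewrite ltr_norml => h1 /andP[h2 _]; move: h1 h2; lra.
Qed.

Lemma sqsum_lim_le (f : l2) M : (forall N, sqsum f N <= M) ->
  complex.Re (l2_inner f f) <= M.
Proof.
move=> hM; apply/ler_addgt0Pl => e e0.
have [/cvgrPdist_lt/(_ _ e0)[N0 _ hN0] _] := l2_inner_sq f.
have := hN0 N0 (leqnn _); have := hM N0.
by rewrite ltr_norml => h1 /andP[_ h2]; move: h1 h2; lra.
Qed.

Lemma l2_coord_sq (f : l2) n : rn (f n) ^+ 2 <= complex.Re (l2_inner f f).
Proof.
apply: le_trans (sqsum_le f n.+1); rewrite /sqsum big_ord_recr/= lerDr.
by rewrite sumr_ge0// => i _; rewrite exprn_ge0// rn_ge0.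
Qed.

Fact l2_inner_gt0 x : x != 0 -> 0 < l2_inner x x.
Proof.
move=> x0; rewrite (l2_inner_sq x).2 ltcR.
have [n xn] : exists n, x n != 0.
  apply: contrapT => h; move/eqP: x0; apply; apply: l2P => n.
  by apply/eqP; apply: contrapT => /negP xn; apply: h; exists n.
apply: lt_le_trans (l2_coord_sq x n); rewrite exprn_gt0// lt_def rn_ge0 andbT.
by apply: contra xn => /eqP/rn_eq0 ->.
Qed.

HB.instance Definition _ := isDotProduct.Build C l2 l2_inner l2_inner_gt0.

HB.instance Definition _ := @Lmodule_isNormed.Build C l2
  (dot_norm l2_inner) (dot_normD l2_inner)
  (dot_normZ l2_inner) (@dot_norm0_eq0 _ _ l2_inner).

Lemma l2_rn (x : l2) : rn x ^+ 2 = complex.Re (l2_inner x x).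
Proof.
apply: complexI; rewrite -(l2_inner_sq x).2 rmorphXn /= -rnE.
exact: (sqr_dot_norm l2_inner).
Qed.

Lemma l2_coord (x : l2) n : rn (x n) <= rn x.
Proof. by rewrite -rn_sqr_le l2_rn l2_coord_sq. Qed.

(** The limit is taken coordinatewise. Bounds on [sqsum] pass to it for each N, and being uniform in
    N they give both its square summability and the convergence. *)
Lemma l2_cauchy_cvg (F : set_system l2) : ProperFilter F -> cauchy F -> cvg F.
Proof.
move=> FF /cauchy_ballP Fc.
have Fe (e : R) : 0 < e -> exists2 A, F A & forall x y : l2, A x -> A y -> rn (x - y) < e.
  move=> e0; have e20' : 0 < (e / 2)%:C :> C by rewrite ltcR divr_gt0.
  have [/= [A1 B1] [FA1 FB1] AB1] := Fc _ e20'.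
  exists (A1 `&` B1)%classic; first exact: filterI.
  move=> x y [Ax Bx] [Ay By].
  have := AB1 (x, y) (conj Ax By); have := AB1 (y, y) (conj Ay By).
  rewrite /= -!ball_normE/= !lt_rn => _ h; apply: (lt_trans h).
  by rewrite ltr_pdivrMr// ltr_pMr// ltr1n.
have ex n : exists l : Y, (fun x : l2 => x n) @ F --> l.
  apply: rn_cauchy_cvg => e e0; have [A FA hA] := Fe e e0; exists A => // x y Ax Ay.
  apply: le_lt_trans (hA x y Ax Ay); exact: (l2_coord (x - y) n).
pose g n : Y := projT1 (cid (ex n)).
have hg n : (fun x : l2 => x n) @ F --> g n := projT2 (cid (ex n)).
have key (e : R) : 0 < e -> exists2 A, F A & forall x : l2, A x ->
    forall N, sqsum ((x : nat -> Y) - g) N <= e ^+ 2.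
  move=> e0; have [A FA hA] := Fe e e0; exists A => // x Ax N.
  rewrite leNgt; apply/negP => lt.
  have hc : (fun y : l2 => sqsum ((x : nat -> Y) - (y : nat -> Y)) N) @ F -->
      sqsum ((x : nat -> Y) - g) N.
    rewrite /sqsum; apply: (@cvg_sumr R R) => n; rewrite expr2; under eq_fun do rewrite expr2.
    have h : (fun y : l2 => rn (x n - y n)) @ F --> rn (x n - g n).
      by apply: cvg_rn; apply: cvgB; [exact: cvg_cst|exact: hg].
    exact: (cvgM h h).
  have := subr_gt0 (e ^+ 2) (sqsum ((x : nat -> Y) - g) N); rewrite lt => d0.
  have /cvgrPdist_lt/(_ _ d0) hd := hc.
  have [y [Ay hy]] := filter_ex (filterI FA hd).
  have h1 := sqsum_le (x - y) N; rewrite -l2_rn in h1.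
  have h2 : rn (x - y) ^+ 2 < e ^+ 2.
    by rewrite ltrXn2r// ?nnegrE ?rn_ge0 ?(ltW e0)//; exact: hA.
  move: hy h1 h2; rewrite ltr_norml => /andP[_].
  rewrite -[sqsum (x - y) N]/(sqsum ((x : nat -> Y) - (y : nat -> Y)) N).
  set a := sqsum _ N; set b := sqsum _ N; set c := rn _ ^+ 2; lra.
have gP : g \in l2_pred.
  have [A FA hA] := key 1 ltr01; have [x Ax] := filter_ex FA.
  have -> : g = (x : nat -> Y) - ((x : nat -> Y) - g) by rewrite opprB addrC subrK.
  by rewrite rpredB ?l2_valP//; apply/asboolP; exists (1 ^+ 2) => N; exact: hA.
apply: (@cvgP _ _ (L2 gP)); apply/cvg_rnP => e e0.
have e20 : 0 < e / 2 by rewrite divr_gt0.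
have [A FA hA] := key _ e20; apply: filterS FA => x Ax.
rewrite rnB; apply: (@le_lt_trans _ _ (e / 2)); last first.
  by rewrite ltr_pdivrMr// ltr_pMr// ltr1n.
rewrite -(@ler_pXn2r _ 2)// ?nnegrE ?rn_ge0 ?(ltW e20)// l2_rn.
by apply: sqsum_lim_le => N; exact: (hA x Ax N).
Qed.

HB.instance Definition _ := Uniform_isComplete.Build l2 l2_cauchy_cvg.

HB.instance Definition _ := @NormedModule_isHilbert.Build R l2
  l2_inner (sqr_dot_norm l2_inner).

Lemma l2_finite_ip (f g : l2) n : (forall l, (n <= l)%N -> f l = 0) ->
  inner f g = \sum_(l < n) inner (f l) (g l).
Proof.
move=> f0; apply: l2_inner_unique.
apply: cvg_near_cst; exists n => // N /= nN.
rewrite -!(big_mkord xpredT (fun l => inner (f l) (g l))) (big_cat_nat (n := n))//=.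
rewrite [X in _ + X]big_nat_cond [X in _ + X]big1 ?addr0// => l /andP[/andP[nl _] _].
by rewrite f0// ip0l.
Qed.

Lemma finite_l2_pred (f : nat -> Y) n : (forall l, (n <= l)%N -> f l = 0) -> f \in l2_pred.
Proof.
move=> f0; apply/asboolP; exists (sqsum f n) => N.
have [Nn|nN] := leqP N n.
  rewrite /sqsum -!(big_mkord xpredT (fun n => rn (f n) ^+ 2)).
  rewrite [leRHS](big_cat_nat (n := N))//= lerDl sumr_ge0// => i _.
  by rewrite exprn_ge0// rn_ge0.
rewrite /sqsum -!(big_mkord xpredT (fun n => rn (f n) ^+ 2)).
rewrite [leLHS](big_cat_nat (n := n)) ?(ltnW nN)//=.
rewrite [X in _ + X]big_nat_cond [X in _ + X]big1 ?addr0// => l /andP[/andP[nl _] _].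
by rewrite f0// rn0 expr0n.
Qed.

Fact l2_cons_pred (q : Y) (f : l2) : (fun n => if n is n'.+1 then f n' else q) \in l2_pred.
Proof.
have [M hM] := asboolP _ (l2_valP f); apply/asboolP; exists (rn q ^+ 2 + M) => -[|N].
  by rewrite /sqsum big_ord0 addr_ge0 ?exprn_ge0 ?rn_ge0// (le_trans _ (hM 0%N))// /sqsum big_ord0.
by rewrite /sqsum big_ord_recl lerD2l; exact: hM.
Qed.

Definition l2_cons (q : Y) (f : l2) : l2 := L2 (l2_cons_pred q f).

Lemma l2_cons_linear a q q' f f' :
  l2_cons (a *: q + q') (a *: f + f') = a *: l2_cons q f + l2_cons q' f'.
Proof. by apply: l2P => -[]. Qed.

Lemma l2_cons_rn q f : rn (l2_cons q f) ^+ 2 = rn q ^+ 2 + rn f ^+ 2.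
Proof.
apply/le_anti/andP; split.
  rewrite [leLHS]l2_rn; apply: sqsum_lim_le => -[|N].
    by rewrite /sqsum big_ord0 addr_ge0 ?exprn_ge0 ?rn_ge0.
  by rewrite /sqsum big_ord_recl lerD2l l2_rn; exact: sqsum_le.
rewrite -lerBrDl [rn f ^+ 2]l2_rn; apply: sqsum_lim_le => N.
rewrite lerBrDl [leRHS]l2_rn.
by have := sqsum_le (l2_cons q f) N.+1; rewrite {1}/sqsum big_ord_recl.
Qed.

End l2.

(** * The lurking isometry *)

Section isometry_extension.
Variables (R : realType) (Y : hilbertType R) (d r : nat -> Y).
Notation C := R[i].
Local Open Scope complex_scope.
Hypothesis gram_eq : forall i j, inner (d i) (d j) = inner (r i) (r j).

Let comb (v : nat -> Y) (s : seq (C * nat)) : Y := \sum_(t <- s) t.1 *: v t.2.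

Let comb_rn s : rn (comb d s) = rn (comb r s).
Proof.
apply/eqP; rewrite -(@eqrXn2 _ 2)// ?rn_ge0//; apply/eqP.
rewrite -!Re_ip /comb !ip_suml; congr (complex.Re _); apply: eq_bigr => t _.
rewrite !ip_sumr; apply: eq_bigr => u _.
by rewrite !ipZl !ipZr gram_eq.
Qed.

Let combZD v a s s' : comb v ([seq (a * t.1, t.2) | t <- s] ++ s') = a *: comb v s + comb v s'.
Proof.
rewrite /comb big_cat big_map scaler_sumr; congr (_ + _); apply: eq_bigr => t _ /=.
by rewrite scalerA.
Qed.

Let D : set Y := [set y | exists s, y = comb d s].

(* Closure of the graph of the partial isometry d_i |-> r_i. *)
Let graph (p : Y * Y) : Prop := forall e : R, 0 < e ->
  exists s, rn (p.1 - comb d s) < e /\ rn (p.2 - comb r s) < e.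

Let graph_lin a p q : graph p -> graph q -> graph (a *: p.1 + q.1, a *: p.2 + q.2).
Proof.
move=> hp hq e e0.
have a1 : 0 < rn a + 1 by rewrite ltr_wpDl ?rn_ge0.
have e1 : 0 < e / 2 / (rn a + 1) by rewrite !divr_gt0.
have e2 : 0 < e / 2 by rewrite divr_gt0.
have [s [s1 s2]] := hp _ e1; have [t [t1 t2]] := hq _ e2.
exists ([seq (a * u.1, u.2) | u <- s] ++ t); rewrite !combZD /=.
have key (x y x' y' : Y) : rn (x - x') < e / 2 / (rn a + 1) -> rn (y - y') < e / 2 ->
    rn (a *: x + y - (a *: x' + y')) < e.
  move=> hx hy; rewrite opprD addrACA -scalerBr (splitr e).
  apply: (le_lt_trans (rnD _ _)); apply: ler_ltD => //; rewrite rnZ.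
  apply: (@le_trans _ _ ((rn a + 1) * rn (x - x'))).
    by rewrite ler_wpM2r ?rn_ge0// lerDl.
  by rewrite mulrC -ler_pdivlMr// ltW.
by split; exact: key.
Qed.

Let graph_rn p : graph p -> rn p.1 = rn p.2.
Proof.
move=> hp; apply/eqP; rewrite -subr_eq0 -normr_le0; apply/ler_addgt0Pl => e e0.
rewrite addr0; have e2 : 0 < e / 2 by rewrite divr_gt0.
have [s [s1 s2]] := hp _ e2.
have h1 := rnD (p.1 - comb d s) (comb d s); rewrite subrK in h1.
have h2 := rnD (p.2 - comb r s) (comb r s); rewrite subrK in h2.
have h3 := rnD (comb d s - p.1) p.1; rewrite subrK rnB in h3.
have h4 := rnD (comb r s - p.2) p.2; rewrite subrK rnB in h4.
rewrite comb_rn in h1 h3; rewrite ler_norml; apply/andP; split; lra.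
Qed.

Let graph_ortho p q : graph p -> (forall x, D x -> inner x q = 0) -> inner p.1 q = 0.
Proof.
move=> hp hq; apply: rn_unique => e e0; rewrite subr0.
have q1 : 0 < rn q + 1 by rewrite ltr_wpDl ?rn_ge0.
have [s [s1 _]] := hp _ (divr_gt0 e0 q1).
have -> : inner p.1 q = inner (p.1 - comb d s) q.
  by rewrite ipDl ipNl (hq (comb d s)) ?subr0//; exists s.
apply: (le_lt_trans (ip_CS _ _)).
apply: (@le_lt_trans _ _ (rn (p.1 - comb d s) * (rn q + 1))).
  by rewrite ler_wpM2l ?rn_ge0// lerDl.
by rewrite -ltr_pdivlMr.
Qed.

(* w = (V0 x, Q0 x) with Q0 the projection onto the complement of the span of d. *)
Let rel (x : Y) (w : Y * Y) := graph (x - w.2, w.1) /\ forall u, D u -> inner u w.2 = 0.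

Let rel_ex x : exists w, rel x w.
Proof.
have [||p pD pO] := @orthogonal_projection R Y D x.
- by exists [::]; rewrite /comb big_nil.
- by move=> a _ _ [s ->] [t ->]; exists ([seq (a * u.1, u.2) | u <- s] ++ t); rewrite combZD.
(* Combinations of the d_i tending to the projection p form a filter; by [comb_rn] the same
   combinations of the r_i are Cauchy, and their limit is the value of V0. *)
pose B (e : R) := [set s | rn (p - comb d s) < e].
have FF : ProperFilter (filter_from [set e : R | 0 < e] B).
  apply: filter_from_proper.
    apply: filter_from_filter; first by exists 1; rewrite /= ltr01.
    move=> e1 e2 /= h1 h2; exists (Num.min e1 e2); first by rewrite /= lt_min h1.
    by move=> s; rewrite /B /= lt_min => /andP[].
  by move=> e /= e0; have [_ [s ->] hs] := pD e e0; exists s.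
have [y /cvg_rnP hy] : exists y : Y, comb r @ (filter_from [set e : R | 0 < e] B) --> y.
  apply: rn_cauchy_cvg => e e0; have e2 : 0 < e / 2 by rewrite divr_gt0.
  exists (B (e / 2)); first by exists (e / 2).
  move=> s t hs ht.
  have cB v : comb v s - comb v t = comb v ([seq (-1 * u.1, u.2) | u <- t] ++ s).
    by rewrite combZD scaleN1r addrC.
  rewrite cB -comb_rn -cB; apply: (le_lt_trans (rn_tri p _ _)).
  by rewrite (splitr e) rnB ltrD.
exists (y, x - p); split=> //= e e0; rewrite opprB addrC subrK.
have [s [hs1 hs2]] := filter_ex (filterI (hy e e0)
  (ex_intro2 _ _ e e0 (@subset_refl _ _) : filter_from [set e : R | 0 < e] B (B e))).
by exists s.
Qed.

(** The difference of two solutions is in the closed graph, and its first component lies in the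
    closed span of d and is orthogonal to it, hence is 0; [graph_rn] then kills the second. *)
Let rel_unique x w w' : rel x w -> rel x w' -> w = w'.
Proof.
case: w w' => [y q] [y' q'] [/= h1 h2] [/= h1' h2'].
have g := graph_lin (-1) h1' h1; rewrite /= !scaleN1r opprB in g.
have e1 : q' - x + (x - q) = q' - q by rewrite addrA subrK.
rewrite e1 in g.
have o : inner (q' - q) (q' - q) = 0.
  apply: (graph_ortho g) => u Du /=; rewrite ipDr ipNr h2 // h2' // subrr //.
have qq : q' - q = 0 by apply: rn_eq0; apply/eqP; rewrite -sqrf_eq0 -Re_ip o.
have := graph_rn g; rewrite /= qq rn0 => /esym/rn_eq0 yy.
move/eqP: qq; rewrite subr_eq0 => /eqP ->.
by move/eqP: yy; rewrite addrC subr_eq0 => /eqP ->.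
Qed.

Lemma isometry_extension : exists (V0 Q0 : {linear Y -> Y}),
  [/\ forall i, V0 (d i) = r i, forall i, Q0 (d i) = 0 &
      forall x, rn (V0 x) ^+ 2 + rn (Q0 x) ^+ 2 = rn x ^+ 2].
Proof.
have /boolp.choice[W hW] := rel_ex.
(* Linearity comes from uniqueness, the relation being stable under linear combinations. *)
have Wlin a x y : W (a *: x + y) = (a *: (W x).1 + (W y).1, a *: (W x).2 + (W y).2).
  apply: (rel_unique (hW _)); have [g1 o1] := hW x; have [g2 o2] := hW y; split=> /=.
    have := graph_lin a g1 g2; rewrite /= scalerBr addrACA -opprD; exact.
  by move=> u Du; rewrite ipDr ipZr o1// o2// mulr0 addr0.
have l1 : linear (fun x => (W x).1) by move=> a x y; rewrite Wlin.
have l2 : linear (fun x => (W x).2) by move=> a x y; rewrite Wlin.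
have Wd i : W (d i) = (r i, 0).
  apply: (rel_unique (hW _)); split=> /= [e e0|u _]; last by rewrite ip0r.
  exists [:: (1, i)]; rewrite /comb !big_seq1 /= !scale1r subr0 !subrr.
  by rewrite rn0.
exists (mklin l1), (mklin l2); split=> [i|i|x] /=; rewrite ?Wd//.
have [g o] := hW x; have := graph_rn g => /= <-.
have o' := graph_ortho g o; rewrite /= in o'.
by rewrite -[in RHS](subrK (W x).2 x) [in RHS]rn2D o' mulr0 addr0.
Qed.

End isometry_extension.

Section dense_points.
Variables (R : realType) (k : nat).
Notation C := R[i].
Local Open Scope complex_scope.

Lemma rat_dense (x e : R) : 0 < e -> exists q : rat, `|x - ratr q| < e.
Proof.
move=> e0; have [|q] := @rat_in_itvoo R (x - e) (x + e); first by lra.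
rewrite in_itv/= => /andP[q1 q2]; exists q; rewrite ltr_norml; apply/andP; split; lra.
Qed.

Lemma dense_points : exists la : nat -> 'rV[C]_k, (forall i, polydisc (la i)) /\
  forall z, polydisc z -> forall e : R, 0 < e ->
    exists i, forall j, rn (z 0 j - la i 0 j) < e.
Proof.
pose pt (q : {ffun 'I_k -> rat * rat}) : 'rV[C]_k :=
  \row_j (ratr (q j).1 +i* ratr (q j).2).
(* An enumeration of the points with Gaussian rational coordinates; numbers that encode no point of
   the polydisc give 0. *)
pose la n := if (choice.unpickle n : option {ffun 'I_k -> rat * rat}) is Some q then (if `[< polydisc (pt q) >] then pt q else 0) else 0.
have D0 : polydisc (0 : 'rV[C]_k) by apply/polydiscE => i; rewrite mxE rn0.
exists la; split=> [i|z /polydiscE zD e e0].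
  by rewrite /la; case: choice.unpickle => // q; case: asboolP.
(* A precision below 1 - |z_j| keeps the rational point in the polydisc. *)
have /boolp.choice[q hq] : forall j, exists q : rat * rat,
    rn (z 0 j - (ratr q.1 +i* ratr q.2)) < Num.min e (1 - rn (z 0 j)).
  move=> j; set m := Num.min _ _.
  have m0 : 0 < m / 2 by rewrite divr_gt0// /m lt_min e0 subr_gt0 zD.
  have [q1 h1] := rat_dense (complex.Re (z 0 j)) m0.
  have [q2 h2] := rat_dense (complex.Im (z 0 j)) m0.
  exists (q1, q2) => /=.
  have -> : z 0 j - (ratr q1 +i* ratr q2) =
     (complex.Re (z 0 j) - ratr q1)%:C + 'i * (complex.Im (z 0 j) - ratr q2)%:C.
    by case: (z 0 j) => x y; simpc.
  apply: (le_lt_trans (rnD _ _)); rewrite rnM !rnC (splitr m).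
  by rewrite (_ : rn 'i = 1) ?mul1r ?ltrD// /rn normci.
exists (choice.pickle [ffun j => q j]) => j.
have pD : polydisc (pt [ffun j => q j]).
  apply/polydiscE => i; rewrite mxE ffunE.
  have := hq i; rewrite lt_min => /andP[_ h].
  have := rnD (ratr (q i).1 +i* ratr (q i).2 - z 0 i) (z 0 i).
  by rewrite subrK rnB; move: h; lra.
rewrite /la choice.pickleK asboolT// mxE ffunE.
by have := hq j; rewrite lt_min => /andP[].
Qed.

End dense_points.

(** * Isometric realization of a Schur-Agler function *)

Section spaces.
Variable R : realType.
Notation C := R[i].

(* [state_space n] does not depend on the number k <= n of variables, so that the
   realizations of both factors share it. *)
Definition base_space : hilbertType R := l2 (R[i] : hilbertType R).
Definition base_sum k : hilbertType R := hpair R[i] (hsum (fun _ : 'I_k => base_space)).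
Definition state_space n : hilbertType R := hpair base_space (l2 (base_sum n)).

Variables (n k : nat).
Hypothesis le_kn : (k <= n)%N.

(** The defect of a factor in k variables is padded with zeros to fit the shift of the common state
    space. *)
Definition widen_sum (y : base_sum k) : base_sum n :=
  (y.1, fun i : 'I_n => if insub (val i) is Some j then y.2 j else 0).

Lemma widen_sum_linear : linear widen_sum.
Proof.
move=> a x y; congr pair; apply: hsumP => i /=.
rewrite hsumDE hsumZE; case: insub => [j|]; first by rewrite hsumDE hsumZE.
by rewrite scaler0 addr0.
Qed.

Lemma widen_sum_rn y : rn (widen_sum y) = rn y.
Proof.
apply/eqP; rewrite -(@eqrXn2 _ 2)// ?rn_ge0//; apply/eqP.
rewrite !hpair_rn !hsum_rn /=; congr (_ + _).
pose g (i : nat) : R := if insub i is Some j then rn (y.2 j) ^+ 2 else 0.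
transitivity (\sum_(i < n) g i).
  by apply: eq_bigr => i _; rewrite /g; case: insub => // ; rewrite rn0 expr0n.
transitivity (\sum_(i < k) g i).
  rewrite [RHS](big_ord_widen n g le_kn) [RHS]big_mkcond; apply: eq_bigr => i _ /=.
  by case: ltnP => // ki; rewrite /g insubF// ltnNge ki.
by apply: eq_bigr => i _; rewrite /g valK.
Qed.

End spaces.

Section realization.
Variables (R : realType) (n k : nat).
Hypothesis le_kn : (k <= n)%N.
Hypothesis k0 : (0 < k)%N.
Notation C := R[i].
Notation G := (base_space R).
Notation Hu := (state_space R n).
Notation Hs := (fun _ : 'I_k => Hu).

Section model.
Variables (V0 Q0 : {linear base_sum R k -> base_sum R k}).
Hypothesis VQ : forall x, rn (V0 x) ^+ 2 + rn (Q0 x) ^+ 2 = rn x ^+ 2.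

Definition base_part (w : colligation_space Hs) : base_sum R k :=
  (w.1, fun p => (w.2 p).1).

(* The defect [Q0 y] is stored in slot 0 of a unilateral shift. *)
Definition model_map (w : colligation_space Hs) : colligation_space Hs :=
  let y := base_part w in
  ((V0 y).1, fun p => ((V0 y).2 p,
     if p == Ordinal k0 then l2_cons (widen_sum n (Q0 y)) (w.2 p).2 else (w.2 p).2)).

Lemma model_map_linear : linear model_map.
Proof.
move=> a x y; rewrite /model_map.
have -> : base_part (a *: x + y) = a *: base_part x + base_part y by [].
rewrite !linearP /=; congr pair; apply: hsumP => p.
rewrite hsumDE hsumZE; congr pair => /=.
by case: ifP => _ //; rewrite widen_sum_linear// l2_cons_linear.
Qed.

(** V0 alone need not be isometric; by [VQ] the missing norm is that of [Q0 y], which [l2_cons]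
    stores without loss. *)
Lemma model_map_rn w : rn (model_map w) = rn w.
Proof.
apply/eqP; rewrite -(@eqrXn2 _ 2)// ?rn_ge0//; apply/eqP.
rewrite !hpair_rn !hsum_rn /=.
under eq_bigr do rewrite hpair_rn /=.
under [in RHS]eq_bigr do rewrite hpair_rn /=.
rewrite !big_split/=.
have -> : \sum_p rn (if p == Ordinal k0 then l2_cons (widen_sum n (Q0 (base_part w))) (w.2 p).2
    else (w.2 p).2) ^+ 2 = rn (Q0 (base_part w)) ^+ 2 + \sum_p rn (w.2 p).2 ^+ 2.
  rewrite (bigD1 (Ordinal k0))//= ?eqxx l2_cons_rn widen_sum_rn// [in RHS](bigD1 (Ordinal k0))//=.
  rewrite -addrA; congr (_ + (_ + _)); apply: eq_bigr => p /negbTE pk.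
  by rewrite pk.
have := VQ (base_part w); rewrite [rn (V0 _) ^+ 2]hpair_rn hsum_rn.
rewrite [rn (base_part w) ^+ 2]hpair_rn hsum_rn /= => h.
by rewrite !addrA -h -!addrA; congr (_ + (_ + _)); rewrite addrC -addrA addrC.
Qed.

End model.

(** At the points of the dense sequence the state equation is the lurking isometry itself. At any
    other z it is solved by [state_exists], and comparison with nearby points identifies the output
    as phi(z). *)
Theorem schur_agler_realization (phi : 'rV[C]_k -> C) : schur_agler phi ->
  exists V : {linear colligation_space Hs -> colligation_space Hs},
    isometric V /\
    forall z, polydisc z -> exists y, V (1, diag_op z y) = (phi z, y).
Proof.
move=> phiSA; have [la [laD la_dense]] := @dense_points R k.
have [U [U0 UM]] := pick_sequence laD k0 phiSA.
have Ufin p i : forall l, (i.+1 <= l)%N -> U p i l = 0 by move=> l; exact: U0.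
pose u i : hsum (fun _ : 'I_k => G) := fun p => L2 (finite_l2_pred (Ufin p i)).
pose d i : base_sum R k := (1, diag_op (la i) (u i)).
pose r i : base_sum R k := (phi (la i), u i).
have uip i j p : inner (u i p) (u j p) =
    \sum_(l < (maxn i j).+1) U p i l * Num.conj (U p j l).
  apply: (@l2_finite_ip _ _ _ _ (maxn i j).+1) => l il; apply: U0.
  by apply: leq_trans il; rewrite ltnS leq_maxl.
(* The identity of [pick_sequence] with terms moved across: 1 + <E u_i, E u_j> = phi_i conj(phi_j) +
   <u_i, u_j>. *)
have gram i j : inner (d i) (d j) = inner (r i) (r j).
  rewrite !hpair_ipE /= !complex_ipE mul1r conjC1.
  have := UM (maxn i j).+1 i j; rewrite !ltnS leq_maxl leq_maxr => /(_ isT isT)/eqP.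
  rewrite subr_eq addrC -subr_eq => /eqP <-.
  rewrite -addrA; congr (_ + _); apply/eqP; rewrite -subr_eq; apply/eqP.
  rewrite -[inner (diag_op _ _) _]/(\sum_p inner (diag_op (la i) (u i) p) (diag_op (la j) (u j) p)).
  rewrite -[inner (u i) (u j)]/(\sum_p inner (u i p) (u j p)).
  rewrite -sumrB -sumrN; apply: eq_bigr => p _.
  by rewrite /diag_op ipZl ipZr -uip; ring.
have [V0 [Q0 [V0d Q0d VQ]]] := isometry_extension gram.
pose V := mklin (model_map_linear V0 Q0).
have Vrn x : rn (V x) = rn x := model_map_rn VQ x.
have Viso : isometric V.
  split; last by move=> x; rewrite !rnE Vrn.
  by apply: (@bounded_lin_cont _ _ _ V 1) => x; rewrite Vrn mul1r.
exists V; split=> // z zD.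
have Vc x : rn (V x) <= rn x by rewrite Vrn.
(* Since [Q0 (d i) = 0], nothing enters the shift, and its component stays 0 on these states. *)
pose y i : hsum Hs := fun p => (u i p, 0).
have Vy i : V (1, diag_op (la i) (y i)) = (phi (la i), y i).
  rewrite /= /model_map.
  have -> : base_part (1, diag_op (la i) (y i)) = d i by [].
  rewrite V0d Q0d; congr pair; apply: hsumP => p; congr pair => /=.
  rewrite scaler0; case: ifP => // _.
  have -> : widen_sum n (0 : base_sum R k) = 0 by exact: (linear0 (mklin (@widen_sum_linear R n k))).
  by apply: l2P => -[].
have [x xE] := state_exists Vc zD; set t := (V (1, x)).2 in xE.
exists t; rewrite -xE [LHS]surjective_pairing -/t; congr pair.
have [q [q0 q1 zq]] := uniform_lt1 ((polydiscE _).1 zD).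
(* Subtracting the state equations at la_i and z gives |s| <= q |y_i - t| + e |y_i|, while |y_i - t|
   <= |s| and |y_i| <= |y_i - t| + |t|. For e <= (1 - q) / 2 half of the gap 1 - q absorbs e |y_i -
   t|, whence the factor 2 / (1 - q). *)
have est i (e : R) : (forall j, rn (la i 0 j - z 0 j) <= e) -> 0 <= e -> e <= (1 - q) / 2 ->
    rn (phi (la i) - (V (1, x)).1) <= e * rn t * (2 / (1 - q) + 1).
  move=> hla e0 e1.
  pose s := diag_op (la i) (y i) - x.
  have Vs : V ((0, s) : colligation_space Hs) = (phi (la i) - (V (1, x)).1, y i - t).
    have -> : ((0, s) : colligation_space Hs) = (1, diag_op (la i) (y i)) - (1, x).
      by congr pair; rewrite /= subrr.
    by rewrite linearB Vy.
  have sE : s = diag_op z (y i - t) + diag_op (la i - z) (y i).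
    rewrite /s [in LHS]xE; apply: hsumP => p.
    rewrite !hsumDE !hsumNE /diag_op !mxE hsumDE hsumNE scalerBr scalerBl.
    by rewrite [RHS]addrC addrA subrK.
  have sb : rn s <= q * rn (y i - t) + e * rn (y i).
    rewrite sE (le_trans (rnD _ _))// lerD//; first exact: diag_op_bound.
    by apply: diag_op_bound => // j; rewrite !mxE.
  have s2 : rn (phi (la i) - (V (1, x)).1) ^+ 2 + rn (y i - t) ^+ 2 = rn s ^+ 2.
    have := congr1 (fun t => t ^+ 2) (Vrn ((0, s) : colligation_space Hs)).
    by rewrite Vs !hpair_rn /= rn0 expr0n add0r.
  have f1 : rn (phi (la i) - (V (1, x)).1) <= rn s.
    by rewrite -rn_sqr_le -s2 lerDl exprn_ge0// rn_ge0.
  have f2 : rn (y i - t) <= rn s.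
    by rewrite -rn_sqr_le -s2 lerDr exprn_ge0// rn_ge0.
  have f3 : rn (y i) <= rn (y i - t) + rn t by have := rnD (y i - t) t; rewrite subrK.
  have q2 : 0 < 1 - q by rewrite subr_gt0.
  apply: (le_trans f1).
  have := divfK (lt0r_neq0 q2) 2; have := rn_ge0 t; have := rn_ge0 (y i - t).
  have : 0 < 2 / (1 - q) by rewrite divr_gt0.
  move: (rn s) (rn (y i - t)) (rn t) (rn (y i)) (2 / (1 - q)) sb f2 f3 => S T0 T1 Y c.
  move=> h1 h2 h3 c0 T00 T10 hc.
  have h4 : e * Y <= e * (T0 + T1) by rewrite ler_wpM2l.
  have h5 : e * T0 <= (1 - q) / 2 * T0 by rewrite ler_wpM2r.
  have h6 : (1 - q) / 2 * T0 <= e * T1 by lra.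
  have h7 : T0 <= c * (e * T1).
    have : c * ((1 - q) / 2 * T0) <= c * (e * T1) by rewrite ler_wpM2l// ltW.
    by have -> : c * ((1 - q) / 2 * T0) = T0 by rewrite !mulrA hc divff ?mul1r// pnatr_eq0.
  have h8 : S <= T0 + e * T1 by move: q2; nra.
  by rewrite mulrDr mulr1; move: h7 h8; rewrite mulrC; lra.
apply: rn_unique => e e0.
have e20 : 0 < e / 2 by rewrite divr_gt0.
have [phian _] := phiSA.
have /cvg_rnP/(_ _ e20) : phi x @[x --> z] --> phi z.
  exact: differentiable_continuous (phian z zD).
move=> /nbhs_ballP[eta eta0 heta].
have q2 : 0 < 1 - q by rewrite subr_gt0.
pose c := rn t * (2 / (1 - q) + 1) + 1.
have c0 : 0 < c by rewrite ltr_wpDl// mulr_ge0 ?rn_ge0// addr_ge0// divr_ge0// ltW.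
have eta1 : 0 < complex.Re eta by rewrite -ltcR -real_CRe// ltW.
pose dl := Num.min (complex.Re eta) (Num.min ((1 - q) / 2) (e / 2 / c)).
have dl0 : 0 < dl by rewrite !lt_min eta1 !divr_gt0.
have [i hi] := la_dense z zD dl dl0.
have h1 : rn (phi z - phi (la i)) < e / 2.
  apply: heta; split=> // a b; rewrite ord1 -ball_normE /= (real_CRe (ltW eta0)) lt_rn.
  by apply: (lt_le_trans (hi b)); rewrite ge_min lexx.
have h2 : rn (phi (la i) - (V (1, x)).1) <= dl * rn t * (2 / (1 - q) + 1).
  apply: est; [by move=> j; rewrite rnB ltW|exact: ltW|].
  by rewrite !ge_min lexx orbT.
have h3 : dl * c <= e / 2 by rewrite -ler_pdivlMr// !ge_min lexx !orbT.
have h4 := rn_tri (phi (la i)) (phi z) (V (1, x)).1.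
rewrite rnB; apply: (le_lt_trans h4).
by move: h1 h2 h3 dl0; rewrite /c mulrDr mulr1 mulrA; lra.
Qed.

End realization.

(** * Product of two colligations *)

Section gluing.
Variables (R : realType) (m n : nat) (lt_mn : (m < n)%N) (K : hilbertType R).
Notation C := R[i].
Notation Hn := (fun _ : 'I_n => K).
Notation Hm := (fun _ : 'I_m => K).
Notation Hp := (fun _ : 'I_(n - m) => K).

Definition lo_part (x : hsum Hn) : hsum Hm := fun j => x (lo_var lt_mn j).
Definition hi_part (x : hsum Hn) : hsum Hp := fun j => x (hi_var lt_mn j).
Definition glue (x : hsum Hm) (y : hsum Hp) : hsum Hn := fun i =>
  match fintype.split (cast_ord (esym (subnKC (ltnW lt_mn))) i) with
  | inl j => x j | inr j => y j end.

Lemma glue_lo x y j : glue x y (lo_var lt_mn j) = x j.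
Proof.
rewrite /glue; have -> : cast_ord (esym (subnKC (ltnW lt_mn))) (lo_var lt_mn j) = lshift (n - m) j.
  exact: val_inj.
by rewrite (unsplitK (inl j : 'I_m + 'I_(n - m))).
Qed.

Lemma glue_hi x y j : glue x y (hi_var lt_mn j) = y j.
Proof.
rewrite /glue; have -> : cast_ord (esym (subnKC (ltnW lt_mn))) (hi_var lt_mn j) = rshift m j.
  exact: val_inj.
by rewrite (unsplitK (inr j : 'I_m + 'I_(n - m))).
Qed.

Lemma lo_hi_ind (P : 'I_n -> Prop) :
  (forall j, P (lo_var lt_mn j)) -> (forall j, P (hi_var lt_mn j)) -> forall i, P i.
Proof.
move=> h1 h2 i; case: (boolP (lo m i)) => il.
  by move: il; rewrite -(codom_lo lt_mn) => /codomP[j ->].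
by move: il; rewrite -hi_loN -(codom_hi lt_mn) => /codomP[j ->].
Qed.

Lemma sum_lo_hi (W : nmodType) (F : 'I_n -> W) :
  \sum_i F i = \sum_j F (lo_var lt_mn j) + \sum_j F (hi_var lt_mn j).
Proof.
rewrite (reindex (cast_ord (subnKC (ltnW lt_mn)))); last first.
  by exists (cast_ord (esym (subnKC (ltnW lt_mn)))) => i _; rewrite ?cast_ordK ?cast_ordKV.
rewrite big_split_ord /=; congr (_ + _).
by apply: eq_bigr => j _; congr F; apply: val_inj.
Qed.

Lemma glue_rn x y : rn (glue x y) ^+ 2 = rn x ^+ 2 + rn y ^+ 2.
Proof.
rewrite !hsum_rn sum_lo_hi; congr (_ + _); apply: eq_bigr => j _.
  by rewrite glue_lo.
by rewrite glue_hi.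
Qed.

Lemma lo_hi_rn x : rn x ^+ 2 = rn (lo_part x) ^+ 2 + rn (hi_part x) ^+ 2.
Proof. by rewrite !hsum_rn sum_lo_hi. Qed.

Lemma glueP a x y x' y' : glue (a *: x + x') (a *: y + y') = a *: glue x y + glue x' y'.
Proof.
apply: hsumP; apply: lo_hi_ind => j; rewrite [RHS]hsumDE hsumZE.
  by rewrite !glue_lo.
by rewrite !glue_hi.
Qed.

Lemma diag_glue (z : 'rV[C]_n) x y : diag_op z (glue x y) =
  glue (diag_op (first_vars lt_mn z) x) (diag_op (last_vars lt_mn z) y).
Proof.
apply: hsumP; apply: lo_hi_ind => j; rewrite /diag_op.
  by rewrite !glue_lo first_varsE.
by rewrite !glue_hi last_varsE.
Qed.

Variable V1 : {linear colligation_space Hm -> colligation_space Hm}.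
Variable V2 : {linear colligation_space Hp -> colligation_space Hp}.
Hypothesis V1_rn : forall x, rn (V1 x) = rn x.
Hypothesis V2_rn : forall x, rn (V2 x) = rn x.

Definition compose_map (w : colligation_space Hn) : colligation_space Hn :=
  let w2 := V2 (w.1, hi_part w.2) in
  let w1 := V1 (w2.1, lo_part w.2) in (w1.1, glue w1.2 w2.2).

Lemma compose_map_linear : linear compose_map.
Proof.
move=> a x y; rewrite /compose_map.
have -> : ((a *: x + y).1, hi_part (a *: x + y).2) =
  a *: ((x.1, hi_part x.2) : colligation_space Hp) + (y.1, hi_part y.2) by [].
rewrite linearP.
set u := V2 (x.1, _); set v := V2 (y.1, _).
have -> : ((a *: u + v).1, lo_part (a *: x + y).2) =
  a *: ((u.1, lo_part x.2) : colligation_space Hm) + (v.1, lo_part y.2) by [].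
by rewrite linearP -[RHS]/(_, _); congr pair; rewrite /= glueP.
Qed.

Lemma compose_map_rn w : rn (compose_map w) = rn w.
Proof.
apply/eqP; rewrite -(@eqrXn2 _ 2)// ?rn_ge0//; apply/eqP.
rewrite /compose_map; set w2 := V2 _; set w1 := V1 _.
have e1 := congr1 (fun t => t ^+ 2) (V1_rn (w2.1, lo_part w.2)).
have e2 := congr1 (fun t => t ^+ 2) (V2_rn (w.1, hi_part w.2)).
rewrite -/w1 !hpair_rn /= in e1; rewrite -/w2 !hpair_rn /= in e2.
rewrite !hpair_rn /= glue_rn (lo_hi_rn w.2); move: e1 e2; lra.
Qed.

(** A state of H_1^m enters only [V1], which acts last, so it never reaches the other summands. A
    state of H_(m+1)^n acts on H_1^m only through the scalar c that [V2] produces; with a, b, u as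
    below, both sides of the second identity equal a b c u. *)
Lemma compose_map_F : property_F m compose_map.
Proof.
have V1Z c : V1 (c, 0) = c *: V1 (1, 0).
  by rewrite -linearZ; congr (V1 _); congr pair; rewrite /= ?[c *: _]mulr1 ?scaler0.
have V2Z c : V2 (c, 0) = c *: V2 (1, 0).
  by rewrite -linearZ; congr (V2 _); congr pair; rewrite /= ?[c *: _]mulr1 ?scaler0.
have lo0 : lo_part 0 = 0 by [].
have hi0 : hi_part 0 = 0 by [].
pose a := (V1 (1, 0)).1; pose b := (V2 (1, 0)).1; pose u := (V1 (1, 0)).2.
have Ec c : compose_map (c, 0) = (c * b * a, glue ((c * b) *: u) (c *: (V2 (1, 0)).2)).
  by rewrite /compose_map /= hi0 lo0 V2Z V1Z.
split=> [x|y].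
  have hx : hi_part (hsum_extend x) = 0.
    apply: hsumP => j; rewrite /hi_part /hsum_extend.
    destruct (@idP (lo m (hi_var lt_mn j))) as [h|]; last by [].
    by exfalso; move: h; rewrite -[lo _ _]negbK -hi_loN -(codom_hi lt_mn) codom_f.
  apply: hsumP => -[i hi_i].
  rewrite /block_D21 /hsum_restrict /block_D /compose_map /= hx V2Z scale0r.
  have /codomP[j ij] : i \in codom (hi_var lt_mn) by rewrite codom_hi.
  by rewrite -[RHS]/(0 : K) ij glue_hi.
have hy : lo_part (hsum_extend y) = 0.
  apply: hsumP => j; rewrite /lo_part /hsum_extend.
  destruct (@idP (hi m (lo_var lt_mn j))) as [h|]; last by [].
  by exfalso; move: h; rewrite hi_loN -(codom_lo lt_mn) codom_f.
apply: hsumP => -[i lo_i].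
pose c := (V2 (0, hi_part (hsum_extend y))).1.
have Ey : compose_map (0, hsum_extend y) =
    (c * a, glue (c *: u) (V2 (0, hi_part (hsum_extend y))).2).
  by rewrite /compose_map /= hy V1Z.
rewrite hsumZE /block_D12 /block_C1 /block_C /hsum_restrict /block_D /block_B2 /block_B /block_a.
rewrite Ey !Ec /=.
have /codomP[j ->] : i \in codom (lo_var lt_mn) by rewrite codom_lo.
by rewrite !glue_lo !hsumZE scalerA; congr (_ *: _); ring.
Qed.

Lemma compose_map_transfer (z : 'rV[C]_n) (p q : C) y1 y2 : polydisc z ->
  V1 (1, diag_op (first_vars lt_mn z) y1) = (p, y1) ->
  V2 (1, diag_op (last_vars lt_mn z) y2) = (q, y2) ->
  transfer_function (mklin compose_map_linear) z = p * q.
Proof.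
(* [V1] receives the scalar q instead of 1, so its state is scaled by q. *)
move=> zD e1 e2; pose y := glue (q *: y1) y2.
have Vy : compose_map (1, diag_op z y) = (p * q, y).
  rewrite /compose_map /= diag_glue.
  have -> : hi_part (glue (diag_op (first_vars lt_mn z) (q *: y1))
      (diag_op (last_vars lt_mn z) y2)) = diag_op (last_vars lt_mn z) y2.
    by apply: hsumP => j; rewrite /hi_part glue_hi.
  have -> : lo_part (glue (diag_op (first_vars lt_mn z) (q *: y1))
      (diag_op (last_vars lt_mn z) y2)) = q *: diag_op (first_vars lt_mn z) y1.
    by apply: hsumP => j; rewrite /lo_part glue_lo diag_opZ.
  rewrite e2 /=.
  have -> : (q, q *: diag_op (first_vars lt_mn z) y1) =
     q *: ((1, diag_op (first_vars lt_mn z) y1) : colligation_space Hm).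
    by congr pair; rewrite /= [q *: _]mulr1.
  by rewrite linearZ e1 /= [q *: p]mulrC.
have Vc w : rn (mklin compose_map_linear w) <= rn w by rewrite /= compose_map_rn.
have VyE : mklin compose_map_linear (1, diag_op z y) = (p * q, y) by exact: Vy.
by rewrite (transfer_functionE (x := diag_op z y) Vc zD) VyE.
Qed.

End gluing.

(** * The factorization theorem *)

Theorem theorem2p4 (R : realType) (m n : nat) (m_ge1 : (1 <= m)%N)
    (lt_mn : (m < n)%N) (theta : 'rV[R[i]]_n -> R[i])
    (theta_SA : schur_agler theta) (theta0 : theta 0 <> 0) :
  (exists (phi : 'rV[R[i]]_m -> R[i]) (psi : 'rV[R[i]]_(n - m) -> R[i]),
     [/\ schur_agler phi, schur_agler psi &
         forall z, polydisc z ->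
           theta z = phi (first_vars lt_mn z) * psi (last_vars lt_mn z)])
  <->
  (exists (H : 'I_n -> hilbertType R)
          (V : {linear colligation_space H -> colligation_space H}),
     [/\ isometric V, property_F m V &
         forall z, polydisc z -> theta z = transfer_function V z]).
Proof.
split=> [[phi [psi [phiSA psiSA fact]]]|[H [V [Viso VF tau]]]].
  have [V1 [V1iso V1E]] := schur_agler_realization (ltnW lt_mn) m_ge1 phiSA.
  have nm0 : (0 < n - m)%N by rewrite subn_gt0.
  have [V2 [V2iso V2E]] := schur_agler_realization (leq_subr m n) nm0 psiSA.
  have V1rn x : rn (V1 x) = rn x by rewrite /rn V1iso.2.
  have V2rn x : rn (V2 x) = rn x by rewrite /rn V2iso.2.
  exists (fun=> state_space R n), (mklin (compose_map_linear lt_mn V1 V2)); split.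
  - split=> [|x]; last by rewrite !rnE /= compose_map_rn.
    by apply: (@bounded_lin_cont _ _ _ _ 1) => x; rewrite /= compose_map_rn// mul1r.
  - exact: compose_map_F.
  move=> z zD; have /polydiscE zD' := zD.
  have [|y1 e1] := V1E (first_vars lt_mn z).
    by apply/polydiscE => i; rewrite first_varsE.
  have [|y2 e2] := V2E (last_vars lt_mn z).
    by apply/polydiscE => i; rewrite last_varsE.
  by rewrite fact// (compose_map_transfer V1rn V2rn zD e1 e2).
have D0 : polydisc (0 : 'rV[R[i]]_n) by apply/polydiscE => i; rewrite mxE rn0.
(* At z = 0 the state vanishes, so theta(0) = a, which is therefore nonzero. *)
have [x xE tE] := theta_state Viso tau D0.
have x0 : x = 0 by rewrite xE; apply: hsumP => i; rewrite /diag_op mxE scale0r.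
have a0 : (V (1, 0)).1 != 0 by rewrite -[in V _]x0 -tE; apply/eqP.
have [theta_an _] := theta_SA.
exists (left_factor lt_mn V theta), (right_factor lt_mn V theta); split.
- exact: left_factor_SA.
- exact: right_factor_SA.
- exact: factorization.
Qed.
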